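(* Let $v\in S_\infty$ and let $k,p\ge1$ be integers. Then $$\mathcal G_v(x)\,\mathcal G_{(p)}(x_1,\ldots,x_k)\;=\;\sum(-1)^{\ell(\gamma)-p}\,\mathcal G_{\mathrm{end}(\gamma)}(x),$$ where the sum is over all saturated chains in the $k$-Bruhat order on $S_\infty$ $$\gamma:\quad v=v_0\xrightarrow{(a_1,b_1)}v_1\xrightarrow{(a_2,b_2)}\cdots\xrightarrow{(a_q,b_q)}v_q=\mathrm{end}(\gamma),\qquad q=\ell(\gamma),$$ together with a choice of $p$ marked covers, satisfying: (P1$'$) $a_1\le a_2\le\cdots\le a_q$; (P2$'$) if $(a_i,b_i)$ is marked, then $b_j\ne b_i$ for $j<i$; (P3$'$) if $(a_i,b_i)$ is unmarked and $i+1\le q$, then $(a_i,b_i)\triangleleft(a_{i+1},b_{i+1})$; (P4$'$) if $a_1=\cdots=a_r$ and $b_1<\cdots<b_r$ for some $r\ge1$, then $(a_r,b_r)$ is marked. This formula has no cancellations (i.e. any two terms of the sum with the same endpoint have the same sign).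
   Context: $S_\infty=\bigcup_n S_n$ under the usual inclusions $S_n\hookrightarrow S_{n+1}$; $\ell(w)$ is the number of inversions of a permutation $w$. Permutations multiply so that $w(a,b)$ is obtained from $w$ by exchanging the values in positions $a$ and $b$. Grothendieck polynomials: on $\mathbb Z[x_1,x_2,\ldots]$ let $s_i$ act by interchanging $x_i$ and $x_{i+1}$, let $\partial_i f=(f-s_if)/(x_i-x_{i+1})$ and $\pi_i f=\partial_i\big((1-x_{i+1})f\big)=f+(1-x_i)\partial_i f$. Set $\mathcal G_{\omega_0}(x)=x_1^{n-1}x_2^{n-2}\cdots x_{n-1}$ for $\omega_0=n\cdots21$ the longest element of $S_n$, and $\mathcal G_{ws_i}(x)=\pi_i\mathcal G_w(x)$ whenever $\ell(ws_i)=\ell(w)-1$, where in $ws_i$ the symbol $s_i$ is the transposition $(i,i+1)$. These are well defined and independent of $n$, so $\mathcal G_w(x)$ is defined for $w\in S_\infty$; they form a basis of $\mathbb Z[x_1,x_2,\ldots]$. $\mathcal G_{(p)}(x_1,\ldots,x_k):=\mathcal G_{r_{[k,p]}}(x)$, where $r_{[k,p]}$ is the cycle $(k+p,k+p-1,\ldots,k)$, i.e. the permutation with $r(k)=k+p$, $r(i)=i-1$ for $k+1\le i\le k+p$, and $r(i)=i$ otherwise. The $k$-Bruhat order is the suborder of the Bruhat order on $S_\infty$ whose covers are $u\lessdot u(a,b)$ with $a\le k<b$ and $\ell(u(a,b))=\ell(u)+1$; such a cover is written $u\xrightarrow{(a,b)}u(a,b)$. On pairs of positive integers define $(a,b)\triangleleft(c,d)$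 iff $a<c$, or $a=c$ and $b>d$. The same chain with different sets of marked covers gives different terms of the sum. *)

(* Defs.v *)
From HB Require Import structures.
From Stdlib Require Import ClassicalEpsilon.
From mathcomp Require Import all_boot all_order all_algebra.
From mathcomp Require Import zify finmap.
From mathcomp.multinomials Require Import monalg.

Set Implicit Arguments.
Unset Strict Implicit.
Unset Printing Implicit Defensive.

Import GRing.Theory.
Local Open Scope fset_scope.
Local Open Scope ring_scope.

(* 0-based throughout: the positions, values and variables                   *)
(* 1, 2, 3, ... of the usual conventions are 0, 1, 2, ... here, so that      *)
(* "position a <= k < b" becomes "a < k <= b".                               *)

(* {fsfun nat -> nat} is the type of the functions equal to the identity off *)
(* a finite set; such a function is bijective as soon as it is injective.    *)
Record Sinf := SPerm { sfun :> {fsfun nat -> nat}; _ : fsinjectiveb sfun }.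
HB.instance Definition _ := [isSub for sfun].
HB.instance Definition _ := [Choice of Sinf by <:].

Lemma Sinf_inj (w : Sinf) : injective w.
Proof. by apply/fsinjectiveP; case: w. Qed.

Lemma SinfP (u w : Sinf) : u =1 w <-> u = w.
Proof. by split=> [/fsfunP e|->//]; apply: val_inj. Qed.

Fact mkS_subproof (f : nat -> nat) (n : nat) :
  injective f -> (forall i, n <= i -> f i = i)%N ->
  fsinjectiveb ([fsfun i in [fset j | j in iota 0 n] => f i] : {fsfun nat -> nat}).
Proof.
move=> fI fn; apply/fsinjectiveP => i j; rewrite !fsfunE !inE !mem_iota /= !add0n.
have E k : (if (k < n)%N then f k else k) = f k by case: ltnP => // /fn.
by rewrite !E; apply: fI.
Qed.

Definition mkS f n (fI : injective f) (fn : forall i, (n <= i)%N -> f i = i) :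
  Sinf := SPerm (mkS_subproof fI fn).

Lemma mkSE f n fI fn : @mkS f n fI fn =1 f.
Proof.
by move=> k; rewrite /= fsfunE !inE mem_iota /= add0n; case: ltnP => // /fn.
Qed.

Definition sbound (w : Sinf) : nat := \max_(i <- finsupp w) i.+1.

Lemma sboundP (w : Sinf) i : (sbound w <= i)%N -> w i = i.
Proof.
move=> h; apply: fsfun_dflt; apply: contraL h => iw; rewrite -ltnNge.
by rewrite /sbound (big_fsetD1 i) //= leq_max leqnn.
Qed.

(* All inversions of w are pairs of positions below sbound w.                *)
Definition len (w : Sinf) : nat :=
  (\sum_(j < sbound w) \sum_(i < j) (w j < w i))%N.

Definition transp (a b i : nat) : nat :=
  if i == a then b else if i == b then a else i.

Lemma transp_inj a b : injective (transp a b).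
Proof.
apply: (can_inj (g := transp a b)) => i; rewrite /transp.
by have [->|ia] := eqVneq i a; [|have [->|ib] := eqVneq i b];
  rewrite ?eqxx ?(negPf ia) ?(negPf ib) //; case: eqP => // ->.
Qed.

Fact swap_inj (w : Sinf) a b : injective (fun i => w (transp a b i)).
Proof. by move=> i j /Sinf_inj /transp_inj. Qed.

Fact swap_fix (w : Sinf) a b i :
  (maxn (sbound w) (maxn a b).+1 <= i)%N -> w (transp a b i) = i.
Proof.
rewrite !geq_max gtn_max => /and3P[wi ai bi].
by rewrite /transp !gtn_eqF //; apply: sboundP.
Qed.

(* w (a, b), the values in positions a and b being exchanged                 *)
Definition swap (w : Sinf) (a b : nat) : Sinf := mkS (@swap_inj w a b) (@swap_fix w a b).

Definition rev_fun (n i : nat) : nat := if (i < n)%N then (n.-1 - i)%N else i.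

Fact rev_inj n : injective (rev_fun n).
Proof. by move=> i j; rewrite /rev_fun; case: (ltnP i n); case: (ltnP j n); lia. Qed.

Fact rev_fix n i : (n <= i)%N -> rev_fun n i = i.
Proof. by rewrite /rev_fun ltnNge => ->. Qed.

(* the longest element of S_n                                                *)
Definition w0 (n : nat) : Sinf := mkS (@rev_inj n) (@rev_fix n).

Definition rcyc_fun (k p i : nat) : nat :=
  if i == k.-1 then (k.-1 + p)%N else
  if (k.-1 < i <= k.-1 + p)%N then i.-1 else i.

Fact rcyc_inj k p : injective (rcyc_fun k p).
Proof.
move=> i j; rewrite /rcyc_fun.
case: (i =P k.-1); case: (j =P k.-1);
  case: (boolP (k.-1 < i <= k.-1 + p)%N);
  case: (boolP (k.-1 < j <= k.-1 + p)%N); lia.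
Qed.

Fact rcyc_fix k p i : ((k.-1 + p).+1 <= i)%N -> rcyc_fun k p i = i.
Proof.
rewrite /rcyc_fun.
by case: (i =P k.-1); case: (boolP (k.-1 < i <= k.-1 + p)%N); lia.
Qed.

(* r_[k,p] for 0 < k, with positions and values shifted down by one          *)
Definition rcyc (k p : nat) : Sinf := mkS (@rcyc_inj k p) (@rcyc_fix k p).

(* Z[x_0, x_1, x_2, ...]                                                     *)
Definition poly_inf := {malg int[{cmonom nat}]}.

Definition Xv (i : nat) : poly_inf := << ucm i >>.

(* x_j is replaced by x_(t j) in the monomial m.                             *)
Definition mrename (t : nat -> nat) (m : {cmonom nat}) : poly_inf :=
  \prod_(j <- finsupp m) Xv (t j) ^+ m j.

Definition rename (t : nat -> nat) (f : poly_inf) : poly_inf :=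
  mmap (@malgC {cmonom nat} int) (mrename t) f.

Lemma mrenameEw t (m : {cmonom nat}) (d : {fset nat}) : finsupp m `<=` d ->
  mrename t m = \prod_(j <- d) Xv (t j) ^+ m j.
Proof.
move=> le; rewrite [LHS](big_fset_incl _ le) => //= j _.
by rewrite -cmE_eq0 => /eqP ->; rewrite expr0.
Qed.

Lemma mrename_mmorph t : mmorphism (mrename t).
Proof.
split=> [m1 m2|]; last by rewrite /mrename mdom1 big_seq_fset0.
have le1 : finsupp m1 `<=` finsupp (mmul m1 m2) by rewrite mdomD fsubsetUl.
have le2 : finsupp m2 `<=` finsupp (mmul m1 m2) by rewrite mdomD fsubsetUr.
rewrite (mrenameEw _ le1) (mrenameEw _ le2) -big_split /=.
by apply: eq_bigr => j _; rewrite cmM exprD.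
Qed.

HB.instance Definition _ t :=
  isMultiplicative.Build {cmonom nat} poly_inf (mrename t) (mrename_mmorph t).


HB.instance Definition _ t := GRing.RMorphism.copy (rename t)
  (mmap (@malgC {cmonom nat} int) (mrename t)).


Lemma renameX t i : rename t (Xv i) = Xv (t i).
Proof.
by rewrite /rename mmapU mul1r /= /mrename mdomU big_seq_fset1 cmUU expr1.
Qed.

Lemma poly_inf_ind (P : poly_inf -> Prop) :
  (forall c : int, P c%:MP) -> (forall i, P (Xv i)) ->
  (forall f g, P f -> P g -> P (f + g)) ->
  (forall f g, P f -> P g -> P (f * g)) -> forall f, P f.
Proof.
move=> PC PX PD PM f; rewrite (monalgE f).
apply: (big_ind P); [by have := PC 0; rewrite malgC0E | exact: PD | move=> m _].
have -> : << f@_m *g m >> = (f@_m)%:MP * << m >> :> poly_inf.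
  by rewrite malgM_def fgmulUU mulr1 mul1m.
apply: (PM _ _ (PC _)).
elim: {m}(mdeg m) {-2}m (leqnn (mdeg m)) => [|n IHn] m.
  by rewrite leqn0 mdeg_eq0 => /eqP ->; apply: (PC 1).
have [->|m_neq1 le_m] := eqVneq m mone; first by move=> _; apply: (PC 1).
have [i im] : exists i, i \in finsupp m.
  apply/fset0Pn; apply: contra m_neq1 => /eqP m0; apply/eqP/eqP/cmP => i.
  by rewrite cm1; apply/eqP; rewrite cmE_eq0 m0.
have Em : m = mmul (ucm i) (divcm m (ucm i)).
  apply/eqP/cmP => j; rewrite cmM divcmE cmU.
  by case: eqVneq => [<-|]; rewrite ?subn0 // subnKC // lt0n cmE_neq0.
have -> : << m >> = Xv i * << divcm m (ucm i) >> :> poly_inf.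
  by rewrite malgM_def fgmulUU mulr1 -Em.
apply: (PM _ _ (PX i)); apply: IHn.
by move: le_m; rewrite {1}Em mdegM mdegU.
Qed.

Definition sact (i : nat) (f : poly_inf) : poly_inf := rename (transp i i.+1) f.

Fact leibniz_subproof (R : comRingType) (d f g sf sg q r : R) :
  d * q = f - sf -> d * r = g - sg -> d * (q * g + sf * r) = f * g - sf * sg.
Proof.
move=> fE gE; rewrite mulrDr mulrA fE mulrCA gE.
by rewrite mulrBl mulrBr addrA subrK.
Qed.

Lemma divdiff_ex i f : exists g, (Xv i - Xv i.+1) * g = f - sact i f.
Proof.
rewrite /sact; elim/poly_inf_ind: f => [c|j|f g [q fE] [r gE]|f g [q fE] [r gE]].
- by exists 0; rewrite mulr0 /rename mmapC subrr.
- rewrite renameX /transp; have [->|ji] := eqVneq j i.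
    by exists 1; rewrite mulr1.
  have [->|ji'] := eqVneq j i.+1; last by exists 0; rewrite mulr0 subrr.
  by exists (- 1); rewrite mulrN1 opprB.
- by exists (q + r); rewrite mulrDr fE gE rmorphD /= opprD addrACA.
- exists (q * g + rename (transp i i.+1) f * r).
  have -> : rename (transp i i.+1) (f * g) =
      rename (transp i i.+1) f * rename (transp i i.+1) g by exact: rmorphM.
  exact: (@leibniz_subproof {malg int[{cmonom nat}]} _ _ _ _ _ _ _ fE gE).
Qed.

Fact argmax_seq (T : eqType) (F : T -> nat) (s : seq T) (x : T) :
  x \in s -> exists2 m, m \in s & {in s, forall m', F m' <= F m}%N.
Proof.
elim: s x => // y s IHs x _.
case: s IHs => [_|z s /(_ z (mem_head _ _)) [m ms mmax]].
  by exists y; rewrite ?mem_head // => m'; rewrite inE => /eqP ->.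
have [le|lt] := leqP (F y) (F m).
  by exists m; [rewrite inE ms orbT | move=> m'; rewrite inE => /predU1P[->|/mmax]].
exists y; first exact: mem_head.
by move=> m'; rewrite inE => /predU1P[->|/mmax /leq_trans]; last by apply; apply: ltnW.
Qed.

Lemma divdiff_uniq i (g h : poly_inf) :
  (Xv i - Xv i.+1) * g = (Xv i - Xv i.+1) * h -> g = h.
Proof.
move=> E; apply/eqP; rewrite -subr_eq0; apply/negPn/negP => nz.
have {E} E : Xv i * (g - h) = Xv i.+1 * (g - h).
  by apply/eqP; rewrite -subr_eq0 -mulrBl mulrBr E subrr.
move: (g - h) nz E => {g h} f nz E.
have XE j (k : {cmonom nat}) :
    (Xv j * f)@_k = \sum_(m <- msupp f) f@_m *+ (mmul (ucm j) m == k).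
  rewrite malgM_def fgmulUg (raddf_sum (mcoeff k)) /=.
  by apply: eq_bigr => m _; rewrite mcoeffU mul1r.
have [m0 m0f] : exists m, m \in msupp f by apply/fset0Pn; rewrite msupp_eq0.
have [m mf mmax] := argmax_seq (fun m : {cmonom nat} => m i) m0f.
have := XE i (mmul (ucm i) m).
rewrite E XE.
rewrite [LHS]big1_seq => [|m' /andP[_ m'f]]; last first.
  suff /negPf -> : mmul (ucm i.+1) m' != mmul (ucm i) m by rewrite mulr0n.
  apply/negP => /cmP /(_ i); rewrite (cmM i (ucm i.+1)) (cmM i (ucm i)).
  rewrite (cmU i.+1) cmUU (gtn_eqF (ltnSn i)) add0n => Ei.
  by have := mmax _ m'f; rewrite /= Ei ltnn.
rewrite (big_fsetD1 m mf) eqxx mulr1n big1_seq => [|m' /andP[_]].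
  by rewrite /= addr0 => /esym/eqP; apply/negP; rewrite mcoeff_neq0.
rewrite in_fsetD1 => /andP[m'm _].
suff /negPf -> : mmul (ucm i) m' != mmul (ucm i) m by rewrite mulr0n.
apply: contra m'm => /cmP e; apply/cmP => j.
by have := e j; rewrite (cmM j (ucm i) m') (cmM j (ucm i) m) => /addnI.
Qed.

Fact divdiff_exb i f : exists g, (Xv i - Xv i.+1) * g == f - sact i f.
Proof. by have [g gE] := divdiff_ex i f; exists g; apply/eqP. Qed.

(* the exact quotient (f - s_i f) / (x_i - x_(i+1)), by divdiffP and divdiff_uniq *)
Definition divdiff (i : nat) (f : poly_inf) : poly_inf := xchoose (divdiff_exb i f).

Lemma divdiffP i f : (Xv i - Xv i.+1) * divdiff i f = f - sact i f.
Proof. exact/eqP/(xchooseP (divdiff_exb i f)). Qed.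

Definition isobaric (i : nat) (f : poly_inf) : poly_inf :=
  divdiff i ((1 - Xv i.+1) * f).

Inductive is_groth : Sinf -> poly_inf -> Prop :=
| is_groth_w0 n : is_groth (w0 n) (\prod_(i < n) Xv i ^+ (n.-1 - i))
| is_groth_step w f i : is_groth w f -> (len (swap w i i.+1)).+1 = len w ->
    is_groth (swap w i i.+1) (isobaric i f).

(* It is a classical fact that is_groth is the graph of a function on Sinf;  *)
(* epsilon extracts this function.                                           *)
Definition groth (w : Sinf) : poly_inf := epsilon (inhabits 0) (is_groth w).

(* the one-row polynomial G_(p)(x_0, ..., x_(k-1)), for 0 < k                *)
Definition groth_row (p k : nat) : poly_inf := groth (rcyc k p).

(* ((a, b), m): a cover u -> u (a, b), marked when m is true. A chain is     *)
(* given by its starting point and the list of its covers.                   *)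
Definition mcover := (nat * nat * bool)%type.
Definition left_pos (e : mcover) : nat := e.1.1.
Definition right_pos (e : mcover) : nat := e.1.2.
Definition marked (e : mcover) : bool := e.2.

Fixpoint is_kchain (k : nat) (v : Sinf) (g : seq mcover) : bool :=
  if g is e :: g' then
    let v' := swap v (left_pos e) (right_pos e) in
    [&& (left_pos e < k <= right_pos e)%N, len v' == (len v).+1 & is_kchain k v' g']
  else true.

Definition endpoint (v : Sinf) (g : seq mcover) : Sinf :=
  foldl (fun u e => swap u (left_pos e) (right_pos e)) v g.

Definition cover_lt (e f : mcover) : bool :=
  (left_pos e < left_pos f)%N ||
  ((left_pos e == left_pos f) && (right_pos f < right_pos e)%N).

Section MarkedChains.
Variable g : seq mcover.
Let e i := nth (0%N, 0%N, false) g i.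
Let a i := left_pos (e i).
Let b i := right_pos (e i).

Definition chain_P1 := forall i, (i.+1 < size g)%N -> (a i <= a i.+1)%N.

Definition chain_P2 := forall i j, (j < i < size g)%N -> marked (e i) -> b j <> b i.

Definition chain_P3 :=
  forall i, (i.+1 < size g)%N -> ~~ marked (e i) -> cover_lt (e i) (e i.+1).

Definition chain_P4 := forall r, (0 < r <= size g)%N ->
  (forall i, (i < r)%N -> a i = a 0%N) ->
  (forall i, (i.+1 < r)%N -> (b i < b i.+1)%N) ->
  marked (e r.-1).
End MarkedChains.

Definition pieri_chain (v : Sinf) (k p : nat) (g : seq mcover) : Prop :=
  [/\ is_kchain k v g, count marked g = p
    & [/\ chain_P1 g, chain_P2 g, chain_P3 g & chain_P4 g]].

(* The truncated subtraction is harmless: at least p covers of g are marked. *)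
Definition pieri_sign (p : nat) (g : seq mcover) : int := (-1) ^+ (size g - p).

(* Main.v *)
Require Import Defs.
From Stdlib Require Import ClassicalEpsilon FunctionalExtensionality.
From mathcomp Require Import all_boot all_order all_algebra.
From mathcomp Require Import finmap.
From mathcomp.multinomials Require Import monalg.
From mathcomp Require Import perm zify ring lra.

(** The proof runs a recursion on the number [k] of left positions. It works
    with the operators [T a b], which send a function [phi] on permutations to
    [v |-> phi (v (a, b))] when [v (a, b)] covers [v], and to 0 otherwise: the
    value at [v] of a word in these operators, applied to [phi], is [phi] at
    the endpoint of the chain from [v] that the word describes, if there is
    such a chain, and 0 if there is none. Sums over chains are thus sums over
    words, and can be transformed by the relations between the [T a b]: they
    square to 0, commute when the four positions are distinct, and satisfy two
    three-term relations.

    The Grothendieck polynomials enter through Lenart's transition formula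
    [groth_transition]: for
      A_l = (1 + T_(l-1,l)) ... (1 + T_(0,l)) (1 - T_(l,N-1)) ... (1 - T_(l,l+1))
    and [N] large, A_l G = (1 - x_l) G as functions of the permutation. The
    three-term relations make A_l commute with the isobaric operators in the
    same way as multiplication by 1 - x_l does ([cpi_Aop] and its variants), so
    the formula propagates downwards from the longest element.

    Let H_k phi be the generating function, in the variable [t] that counts
    marks, of the marked chains which satisfy [chain_P1], [chain_P2] and
    [chain_P3], with left positions less than [k] and right positions from [k]
    to [N - 1], positions being counted from 0. Each cover contributes t if it
    is marked and -1 if it is not; so a cover has weight t - 1 when both are
    allowed. The heart of the proof is the operator identity [Hop_rec],
      (1 - t) H_(l+1) + t H_(l+1) A_l = H_l A_l,
    which holds for arbitrary functions in place of G. It says what happens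
    when [l] ceases to be a left position and becomes a right position
    ([add_right_end]), and is proved by induction on the left positions:
    moving T_(i,l) through the words of the positions between [i] and [l]
    produces terms which either vanish, because the corresponding chains do
    not exist, or cancel against each other ([core_middle]).

    Applied to G, the identity reads (1 - t x_l) H_(l+1) G = (1 - x_l) H_l G up
    to terms of high degree in [t] ([Hop_coef_rec]); for a fixed number of marks
    only finitely many chains are left ([bound_flat]), so that [N] can be chosen
    beyond them. Condition [chain_P4] only changes the weight of the last cover
    of the first ascending run, from t - 1 to t; hence (1 - t) times the sum with
    [chain_P4] is the sum without it, the empty chain apart, times -t
    ([pieri_polyE]). Together this shows that the right-hand side of the
    Pieri formula, for [k] and [p], is q_(k,p) G_v, where q_(k,0) = 1,
    q_(0,p) = 0 for p > 0, and
      q_(k,p) = x_(k-1) q_(k,p-1) + (1 - x_(k-1)) q_(k-1,p)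
    does not depend on [v] ([pieri_sum]). For the identity permutation there is
    only one chain, all of whose covers are marked; it leads to the cycle
    r_[k,p], so q_(k,p) is the one-row polynomial ([qrow_groth]).

    There are no cancellations because all chains from [v] to a given
    permutation have the same length. *)

Set Implicit Arguments.
Unset Strict Implicit.
Unset Printing Implicit Defensive.

Import GRing.Theory Num.Theory.
Local Open Scope fset_scope.
Local Open Scope ring_scope.

(** * Transpositions, length and covers *)

Lemma swapE (v : Sinf) a b i : swap v a b i = v (transp a b i).
Proof. exact: mkSE. Qed.

Lemma transpL a b : transp a b a = b.
Proof. by rewrite /transp eqxx. Qed.

Lemma transpR a b : transp a b b = a.
Proof. by rewrite /transp eqxx; case: eqP. Qed.

Lemma transpD a b i : i <> a -> i <> b -> transp a b i = i.
Proof. by rewrite /transp; case: eqP => // _; case: eqP. Qed.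

Lemma transpK a b : involutive (transp a b).
Proof.
move=> i; case: (i =P a) => [->|ia]; first by rewrite transpL transpR.
case: (i =P b) => [->|ib]; first by rewrite transpR transpL.
by rewrite !transpD.
Qed.

Lemma swapL (v : Sinf) a b : swap v a b a = v b.
Proof. by rewrite swapE transpL. Qed.

Lemma swapR (v : Sinf) a b : swap v a b b = v a.
Proof. by rewrite swapE transpR. Qed.

Lemma swapD (v : Sinf) a b i : i <> a -> i <> b -> swap v a b i = v i.
Proof. by move=> *; rewrite swapE transpD. Qed.

Lemma swapK (v : Sinf) a b : swap (swap v a b) a b = v.
Proof. by apply/SinfP => i; rewrite !swapE transpK. Qed.

Lemma Sinf_neq (v : Sinf) i j : i <> j -> v i <> v j.
Proof. by move=> ij /Sinf_inj. Qed.

Lemma Sinf_lt (v : Sinf) i n : (sbound v <= n)%N -> (i < n)%N -> (v i < n)%N.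
Proof.
move=> vn li; rewrite ltnNge; apply/negP => h.
by have := sboundP (leq_trans vn h) => /Sinf_inj e; lia.
Qed.

Lemma sbound_le (v : Sinf) n : (forall i, (n <= i)%N -> v i = i) -> (sbound v <= n)%N.
Proof.
move=> h; rewrite /sbound; apply/bigmax_leqP_seq => i iv _.
rewrite ltnNge; apply/negP => /h e.
by move: iv; rewrite mem_finsupp e eqxx.
Qed.

Lemma sbound_swap (v : Sinf) a b n : (sbound v <= n)%N -> (a < n)%N -> (b < n)%N ->
  (sbound (swap v a b) <= n)%N.
Proof.
move=> vn an bn; apply: sbound_le => i ni; rewrite swapD; [|lia|lia].
exact: sboundP (leq_trans vn ni).
Qed.

(** The number of inversions in a window of prescribed size: two permutations
    can be compared in the same window. *)
Definition lenn n (v : nat -> nat) : nat :=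
  (\sum_(j < n) \sum_(i < n) ((i < j) && (v j < v i)))%N.

Lemma len_lenn (v : Sinf) n : (sbound v <= n)%N -> len v = lenn n v.
Proof.
move=> vn; rewrite /len /lenn.
have E (j : nat) : (j <= n)%N ->
    (\sum_(i < n) ((i < j) && (v j < v i)) = \sum_(i < j) (v j < v i))%N.
  move=> jn; rewrite (big_ord_widen n (fun i => nat_of_bool (v j < v i)%N) jn) [RHS]big_mkcond.
  by apply: eq_bigr => i _; case: ltnP.
rewrite (big_ord_widen n (fun j => \sum_(i < j) (v j < v i))%N vn) [LHS]big_mkcond.
apply: eq_bigr => j _; rewrite E; last exact: ltnW.
case: ltnP => // vj; rewrite big1 // => i _.
rewrite (sboundP vj); apply/eqP; rewrite eqb0 -leqNgt.
have [vi|vi] := leqP (sbound v) i; first by rewrite (sboundP vi) ltnW.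
by apply: leq_trans vj; apply/ltnW/Sinf_lt.
Qed.

Definition between (v : nat -> nat) a b n : nat :=
  (\sum_(c < n) ((a < c < b) && (v a < v c < v b)))%N.

(** Exchanging two increasing values creates the inversion (a, b) and two more
    for each position between them whose value lies between theirs. The proof
    reindexes the inversions of the new permutation by the transposition, and
    then compares them with those of the old one row by row. *)
Lemma lenn_swap (v : nat -> nat) (w : nat -> nat) a b n : injective v ->
  (forall i, w i = v (transp a b i)) ->
  (a < b < n)%N -> (v a < v b)%N ->
  lenn n w = ((lenn n v).+1 + (between v a b n).*2)%N.
Proof.
move=> vI wE /andP[ab bn] vab.
have an := ltn_trans ab bn.
pose oa := Ordinal an; pose ob := Ordinal bn.
pose s := tperm oa ob.
have sE (i : 'I_n) : s i = transp a b i :> nat.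
  rewrite /s; case: tpermP => [->|->|]; rewrite ?transpL ?transpR //.
  by move=> i1 i2; rewrite transpD // => e; [apply: i1|apply: i2]; apply: val_inj.
have E : lenn n w =
    (\sum_(j < n) \sum_(i < n) ((transp a b i < transp a b j) && (v j < v i)))%N.
  rewrite /lenn (reindex_inj (perm_inj (s := s))); apply: eq_bigr => j _.
  rewrite (reindex_inj (perm_inj (s := s))); apply: eq_bigr => i _.
  by rewrite !wE !sE !transpK.
apply/eqP; rewrite -(eqr_nat int) E /lenn.
pose D i j : int := ((transp a b i < transp a b j) && (v j < v i))%N%:R
   - ((i < j) && (v j < v i))%N%:R.
rewrite -addn1 -addnA -addnn natrD addrC -subr_eq.
have -> : ((\sum_(j < n) \sum_(i < n) ((transp a b i < transp a b j) && (v j < v i)))%N%:R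
  - (\sum_(j < n) \sum_(i < n) ((i < j) && (v j < v i)))%N%:R)
  = \sum_(j < n) \sum_(i < n) D i j.
  rewrite !natr_sum -sumrB; apply: eq_bigr => j _.
  by rewrite !natr_sum -sumrB; apply: eq_bigr.
have nab : ob != oa by rewrite -(inj_eq val_inj) /=; lia.
have S2 (f : 'I_n -> int) : \sum_i f i = f oa + f ob + \sum_(i | (i != oa) && (i != ob)) f i.
  by rewrite (bigD1 oa) //= (bigD1 ob) //= addrA.
have D0 (i j : 'I_n) : i != oa -> i != ob -> j != oa -> j != ob -> D i j = 0.
  rewrite -!(inj_eq val_inj) /= => /eqP ia /eqP ib /eqP ja /eqP jb.
  by rewrite /D !(transpD (a := a)) // subrr.
rewrite S2 /= (S2 (fun i => D i a)) (S2 (fun i => D i b)) /=.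
rewrite [X in _ + X == _](eq_bigr (fun j : 'I_n => D a j + D b j)); last first.
  move=> j /andP[ja jb]; rewrite S2 /= big1 ?addr0 // => i /andP[ia ib].
  exact: D0.
rewrite /= [D a a](_ : _ = 0); last by rewrite /D !ltnn andbF.
rewrite [D b b](_ : _ = 0); last by rewrite /D !ltnn andbF.
rewrite [D b a](_ : _ = 1); last by rewrite /D transpL transpR ab vab ltnNge (ltnW ab).
rewrite [D a b](_ : _ = 0); last first.
  by rewrite /D transpL transpR ab [(b < a)%N]ltnNge (ltnW ab) [(v b < v a)%N]ltnNge (ltnW vab).
rewrite add0r !addr0 [0 + _]add0r -!addrA -!big_split /= natrD.
apply/eqP; congr (_ + _); rewrite natr_sum.
rewrite [RHS]S2 /= !ltnn !andbF /= !add0r.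
apply: eq_bigr => c; rewrite -!(inj_eq val_inj) /= => /andP[/eqP ca /eqP cb].
have vca : v c <> v a by move/vI.
have vcb : v c <> v b by move/vI.
rewrite /D transpL transpR (transpD ca cb).
move: ca cb ab vab vca vcb; move: (v c) (v a) (v b) (nat_of_ord c) => x y z c0.
case: (ltngtP x y) => //; case: (ltngtP x z) => //; case: (ltngtP a c0) => //;
case: (ltngtP c0 b) => //=; rewrite ?subrr ?subr0 ?addr0 ?add0r //; try lia.
Qed.

Definition cov (v : Sinf) a b : bool := (a < b)%N && (len (swap v a b) == (len v).+1).

Lemma len_swap (v : Sinf) a b n : (sbound v <= n)%N -> (a < b < n)%N -> (v a < v b)%N ->
  len (swap v a b) = ((len v).+1 + (between v a b n).*2)%N.
Proof.
move=> vn /andP[ab bn] vab.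
rewrite (len_lenn vn) (@len_lenn _ n); last by apply: sbound_swap => //; lia.
apply: lenn_swap => //; [exact: Sinf_inj | exact: swapE | by rewrite ab].
Qed.

Lemma len_swap_lt (v : Sinf) a b : (a < b)%N -> (v b < v a)%N ->
  (len (swap v a b) < len v)%N.
Proof.
move=> ab vab; rewrite -{2}(swapK v a b).
have := @len_swap (swap v a b) a b (maxn (sbound (swap v a b)) b.+1).
by rewrite swapL swapR => -> //; lia.
Qed.

Lemma covP (v : Sinf) a b : cov v a b <->
  [/\ (a < b)%N, (v a < v b)%N & forall c, (a < c < b)%N -> (v c < v a)%N || (v b < v c)%N].
Proof.
rewrite /cov; split.
  case/andP=> ab /eqP e.
  have vab : (v a < v b)%N.
    have := @Sinf_neq v a b; case: ltngtP => //; last by lia.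
    by move/(len_swap_lt ab); rewrite e; lia.
  split=> // c /andP[ac cb].
  have := @len_swap v a b (maxn (sbound v) b.+1).
  rewrite e leq_maxl ab leq_maxr => /(_ isT isT vab) h.
  have : between v a b (maxn (sbound v) b.+1) = 0%N by lia.
  have cn : (c < maxn (sbound v) b.+1)%N by lia.
  move/eqP; rewrite sum_nat_eq0 => /forallP /(_ (Ordinal cn)) /=.
  rewrite ac cb eqb0 /=.
  have := @Sinf_neq v a c; have := @Sinf_neq v c b; lia.
case=> ab vab h; rewrite ab /=.
have := @len_swap v a b (maxn (sbound v) b.+1).
rewrite leq_maxl ab leq_maxr => /(_ isT isT vab) ->.
rewrite /between big1 ?addn0 // => c _; apply/eqP; rewrite eqb0.
by case: (boolP (a < c < b)%N) => //= /h; lia.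
Qed.

(** * The cover operators and their relations *)

Lemma swap_comm (v : Sinf) a b c d : uniq [:: a; b; c; d] ->
  swap (swap v a b) c d = swap (swap v c d) a b.
Proof.
rewrite /= !inE => H; apply/SinfP => i.
case: (i =P a) => [->|ia].
  by rewrite swapL (@swapD _ c d) ?(@swapD _ c d) ?swapL //; lia.
case: (i =P b) => [->|ib].
  by rewrite swapR (@swapD _ c d) ?(@swapD _ c d) ?swapR //; lia.
case: (i =P c) => [->|ic].
  by rewrite swapL (@swapD _ a b) ?(@swapD _ a b) ?swapL //; lia.
case: (i =P d) => [->|id].
  by rewrite swapR (@swapD _ a b) ?(@swapD _ a b) ?swapR //; lia.
by rewrite !swapD.
Qed.

Section CovComm.
Variables (f g h : nat -> nat) (a b c d : nat).
Hypotheses (U : uniq [:: a; b; c; d]) (fI : injective f).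
Hypotheses (gE : forall i, i <> a -> i <> b -> g i = f i) (ga : g a = f b) (gb : g b = f a).
Hypotheses (hE : forall i, i <> c -> i <> d -> h i = f i) (hc : h c = f d) (hd : h d = f c).

(** The right-hand side of [covP] for bare functions: the case analyses below
    then see injective functions with a few known values, and no permutations. *)
Definition covf (f : nat -> nat) a b := [/\ (a < b)%N, (f a < f b)%N &
  forall c, (a < c < b)%N -> (f c < f a)%N || (f b < f c)%N].

Lemma covf_comm : covf f a b -> covf g c d -> covf f c d /\ covf h a b.
Proof.
move=> [ab vab h1] [cd].
move: U; rewrite /= !inE => H.
have [ac ad bc bd] : [/\ a <> c, a <> d, b <> c & b <> d] by split; lia.
rewrite !gE; try lia; move=> vcd h2.
have [A1 A2 A3 A4] : [/\ f a <> f c, f a <> f d, f b <> f c & f b <> f d].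
  by split; move/fI; lia.
have := h1 c; have := h1 d; have := h2 a; have := h2 b; rewrite ga gb.
move: {H} U => _.
move=> I1 I2 I3 I4; split; split=> //; rewrite ?hE; try lia; move=> e eI.
  case: (e =P a) => [ea|ea]; first by subst e; lia.
  case: (e =P b) => [eb|eb]; first by subst e; lia.
  by have := h2 e eI; rewrite gE.
case: (e =P c) => [ec|ec]; first by subst e; rewrite hc; lia.
case: (e =P d) => [ed|ed]; first by subst e; rewrite hd; lia.
by rewrite hE //; apply: h1.
Qed.
End CovComm.
(** The three permutations at the end of a path of two covers that involves
    three positions are equal in pairs; these lemmas say which of the paths
    exist together, as a function of the order of two of the values. *)
Section CovThree.
Variables (f fij fjk fik : nat -> nat) (i j k : nat).
Hypotheses (ij : (i < j)%N) (jk : (j < k)%N) (fI : injective f).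
Hypotheses (ijD : forall e, e <> i -> e <> j -> fij e = f e) (iji : fij i = f j) (ijj : fij j = f i).
Hypotheses (jkD : forall e, e <> j -> e <> k -> fjk e = f e) (jkj : fjk j = f k) (jkk : fjk k = f j).
Hypotheses (ikD : forall e, e <> i -> e <> k -> fik e = f e) (iki : fik i = f k) (ikk : fik k = f i).

Let nij : f i <> f j. Proof. by move/fI; lia. Qed.
Let njk : f j <> f k. Proof. by move/fI; lia. Qed.
Let ijk : fij k = f k. Proof. by apply: ijD; lia. Qed.
Let jki : fjk i = f i. Proof. by apply: jkD; lia. Qed.
Let ikj : fik j = f j. Proof. by apply: ikD; lia. Qed.

Ltac solve_cov :=
  match goal with
  | |- (is_true (_ < _)%N) => lia
  | H1 : (forall c : nat, is_true (_ < c < _)%N -> _), H2 : (forall c : nat, is_true (_ < c < _)%N -> _) |- _ =>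
    let e := fresh "e" in let eI := fresh in
    have := H1 i; have := H1 j; have := H1 k;
    have := H2 i; have := H2 j; have := H2 k;
    rewrite ?ijk ?jki ?ikj ?iji ?ijj ?jkj ?jkk ?iki ?ikk => ? ? ? ? ? ?;
    move=> e eI; have := H1 e; have := H2 e; clear H1 H2;
    case: (e =P i) => [?|?]; [subst e; rewrite ?ijk ?jki ?ikj ?iji ?ijj ?jkj ?jkk ?iki ?ikk; lia |];
    case: (e =P j) => [?|?]; [subst e; rewrite ?ijk ?jki ?ikj ?iji ?ijj ?jkj ?jkk ?iki ?ikk; lia |];
    case: (e =P k) => [?|?]; [subst e; rewrite ?ijk ?jki ?ikj ?iji ?ijj ?jkj ?jkk ?iki ?ikk; lia |];
    rewrite ?ijD ?jkD ?ikD //; lia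
  end.
Ltac start :=
  let h1 := fresh "h1" in let h2 := fresh "h2" in
  move=> [_ + h1] [_ + h2]; move: h1 h2;
  rewrite ?ijk ?jki ?ikj ?iji ?ijj ?jkj ?jkk ?iki ?ikk => ? ? ? ?.
Ltac fin := split; split; rewrite ?ijk ?jki ?ikj ?iji ?ijj ?jkj ?jkk ?iki ?ikk; solve_cov.

Lemma cov3a1 : covf f i j -> covf fij j k -> (f j < f k)%N -> covf f j k /\ covf fjk i k.
Proof. by start => ?; fin. Qed.
Lemma cov3a2 : covf f i j -> covf fij j k -> (f k < f j)%N -> covf f i k /\ covf fik i j.
Proof. by start => ?; fin. Qed.
Lemma cov3a3 : covf f j k -> covf fjk i k -> [/\ covf f i j, covf fij j k & (f j < f k)%N].
Proof. by start; split; [| | lia]; split; rewrite ?ijk ?jki ?ikj ?iji ?ijj ?jkj ?jkk ?iki ?ikk; solve_cov. Qed.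
Lemma cov3a4 : covf f i k -> covf fik i j -> [/\ covf f i j, covf fij j k & (f k < f j)%N].
Proof. by start; split; [| | lia]; split; rewrite ?ijk ?jki ?ikj ?iji ?ijj ?jkj ?jkk ?iki ?ikk; solve_cov. Qed.
Lemma cov3b1 : covf f j k -> covf fjk i j -> (f j < f i)%N -> covf f i k /\ covf fik j k.
Proof. by start => ?; fin. Qed.
Lemma cov3b2 : covf f j k -> covf fjk i j -> (f i < f j)%N -> covf f i j /\ covf fij i k.
Proof. by start => ?; fin. Qed.
Lemma cov3b3 : covf f i k -> covf fik j k -> [/\ covf f j k, covf fjk i j & (f j < f i)%N].
Proof. by start; split; [| | lia]; split; rewrite ?ijk ?jki ?ikj ?iji ?ijj ?jkj ?jkk ?iki ?ikk; solve_cov. Qed.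
Lemma cov3b4 : covf f i j -> covf fij i k -> [/\ covf f j k, covf fjk i j & (f i < f j)%N].
Proof. by start; split; [| | lia]; split; rewrite ?ijk ?jki ?ikj ?iji ?ijj ?jkj ?jkk ?iki ?ikk; solve_cov. Qed.
End CovThree.

(** How covers change under an exchange of two adjacent values: the position
    [i] plays the role of [i.+1] and conversely, except that a condition on the
    values at [i] and [i.+1] appears on one side or the other. *)
Section CovAdj.
Variables (f g h : nat -> nat) (i a b : nat).
Hypotheses (fI : injective f).
Hypotheses (gD : forall e, e <> i -> e <> i.+1 -> g e = f e) (gi : g i = f i.+1) (gj : g i.+1 = f i).

Section Disj.
Hypotheses (ai : a <> i) (bi : b <> i) (aj : a <> i.+1) (bj : b <> i.+1).
Lemma covN_disj : covf g a b <-> covf f a b.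
Proof.
rewrite /covf !gD //; split=> [] [ab vab H]; split=> // e eI.
- case: (e =P i) => [ei|ei]; first by subst e; rewrite -gj; apply: H; lia.
  case: (e =P i.+1) => [ej|ej]; first by subst e; rewrite -gi; apply: H; lia.
  by rewrite -gD //; apply: H.
- case: (e =P i) => [ei|ei]; first by subst e; rewrite gi; apply: H; lia.
  case: (e =P i.+1) => [ej|ej]; first by subst e; rewrite gj; apply: H; lia.
  by rewrite gD //; apply: H.
Qed.
End Disj.

Ltac caseN e H :=
  case: (e =P i) => [?|?]; [subst e; rewrite ?gi; have := H i; have := H i.+1; rewrite ?gi ?gj; lia |];
  case: (e =P i.+1) => [?|?]; [subst e; rewrite ?gj; have := H i; have := H i.+1; rewrite ?gi ?gj; lia |];
  have := H e; rewrite ?gD //; try lia.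

Lemma covN_ib : (i.+1 < b)%N -> (f i.+1 < f i)%N /\ covf g i b <-> covf f i.+1 b /\ (f b < f i)%N.
Proof.
rewrite /covf => jb; have gb : g b = f b by apply: gD; lia.
have nb : f i <> f b by move/fI; lia.
have gjE : g i.+1 = f i by exact: gj.
rewrite gb gi; split.
- move=> [fji [ib v H]]; have := H i.+1; rewrite gjE => ?.
  by split; [split=> // e eI; caseN e H|lia].
- move=> [[ib v H] v2]; split; first by lia.
  split=> // [|e eI]; first by lia.
  case: (e =P i.+1) => [->|?]; first by rewrite gjE; lia.
  by rewrite gD //; [apply: H; lia|lia].
Qed.

Lemma covN_jb : (i.+1 < b)%N -> (f i.+1 < f i)%N /\ covf g i.+1 b <-> covf f i b /\ (f i.+1 < f b)%N.
Proof.
rewrite /covf => jb; have gb : g b = f b by apply: gD; lia.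
have nb : f i <> f i.+1 by move/fI; lia.
have gjE : g i.+1 = f i by exact: gj.
rewrite gb gj; split.
- move=> [fji [ib v H]].
  split; [split=> // [|e eI]; first by lia|lia].
  case: (e =P i.+1) => [->|?]; first by lia.
  by rewrite -gD; [apply: H; lia|lia|lia].
- move=> [[ib v H] v2]; have := H i.+1 => ?; split; first by lia.
  split=> // e eI; rewrite gD; [apply: H|..]; lia.
Qed.

Lemma covN_ai : (a < i)%N -> (f i.+1 < f i)%N /\ covf g a i <-> covf f a i.+1 /\ (f a < f i)%N /\ (f i.+1 < f i)%N.
Proof.
rewrite /covf => jb; have gb : g a = f a by apply: gD; lia.
rewrite gb gi; split.
- move=> [fji [ib v H]]; split; last by lia.
  split=> // [|e eI]; first by lia.
  case: (e =P i) => [->|?]; first by lia.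
  by rewrite -gD; [apply: H; lia|lia|lia].
- move=> [[ib v H] v2]; split; first by lia.
  split=> // e eI; rewrite gD; [apply: H|..]; lia.
Qed.

Lemma covN_aj : (a < i)%N -> (f i.+1 < f i)%N /\ covf g a i.+1 <-> covf f a i /\ (f i.+1 < f a)%N.
Proof.
rewrite /covf => jb; have gb : g a = f a by apply: gD; lia.
have nb : f a <> f i.+1 by move/fI; lia.
rewrite gb gj; split.
- move=> [fji [ib v H]]; have := H i; rewrite gi => ?; split; last by lia.
  split=> // e eI; rewrite -gD; [apply: H|..]; lia.
- move=> [[ib v H] v2]; split; first by lia.
  split=> // [|e eI]; first by lia.
  case: (e =P i) => [->|?]; first by rewrite gi; lia.
  by rewrite gD; [apply: H; lia|lia|lia].
Qed.
End CovAdj.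

Lemma cov_covf (v : Sinf) a b : cov v a b <-> covf v a b.
Proof. exact: covP. Qed.

Lemma cov_comm (v : Sinf) a b c d : uniq [:: a; b; c; d] ->
  cov v a b && cov (swap v a b) c d = cov v c d && cov (swap v c d) a b.
Proof.
move=> U; apply/idP/idP => /andP[/cov_covf h1 /cov_covf h2].
  have [] := @covf_comm v (swap v a b) (swap v c d) a b c d U (@Sinf_inj v) _ _ _ _ _ _ h1 h2;
    try by move=> *; rewrite ?swapL ?swapR ?swapD.
  by move=> /cov_covf -> /cov_covf ->.
have U' : uniq [:: c; d; a; b] by move: U; rewrite /= !inE; lia.
have [] := @covf_comm v (swap v c d) (swap v a b) c d a b U' (@Sinf_inj v) _ _ _ _ _ _ h1 h2;
  try by move=> *; rewrite ?swapL ?swapR ?swapD.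
by move=> /cov_covf -> /cov_covf ->.
Qed.

Lemma swap3a (v : Sinf) i j k : (i < j < k)%N ->
  swap (swap v i j) j k = swap (swap v j k) i k /\
  swap (swap v i j) j k = swap (swap v i k) i j.
Proof.
move=> H; split; apply/SinfP => e.
  case: (e =P i) => [->|ei].
    by rewrite swapL (@swapD _ j k) ?swapL ?swapR //; lia.
  case: (e =P j) => [->|ej]; first by rewrite swapL (@swapD _ i k) ?(@swapD _ i j) ?swapL //; lia.
  case: (e =P k) => [->|ek]; first by rewrite !swapR (@swapD _ j k) //; lia.
  by rewrite !swapD.
case: (e =P i) => [->|ei].
  by rewrite swapL (@swapD _ j k) ?swapL ?(@swapD _ i k) //; lia.
case: (e =P j) => [->|ej]; first by rewrite swapL swapR (@swapD _ i j) ?swapL //; lia.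
case: (e =P k) => [->|ek]; first by rewrite (@swapD (swap v i k) i j) ?swapR //; lia.
by rewrite !swapD.
Qed.

Lemma swap3b (v : Sinf) i j k : (i < j < k)%N ->
  swap (swap v j k) i j = swap (swap v i k) j k /\
  swap (swap v j k) i j = swap (swap v i j) i k.
Proof.
move=> H; split; apply/SinfP => e.
  case: (e =P i) => [->|ei].
    by rewrite swapL (@swapD (swap v i k) j k) ?swapL //; lia.
  case: (e =P j) => [->|ej].
    by rewrite swapR swapL (@swapD v j k) ?swapR //; lia.
  case: (e =P k) => [->|ek]; last by rewrite !swapD.
  by rewrite (@swapD (swap v j k) i j) ?swapR ?(@swapD v i k) //; lia.
case: (e =P i) => [->|ei].
  by rewrite !swapL (@swapD v i j) //; lia.
case: (e =P j) => [->|ej].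
  by rewrite swapR (@swapD (swap v i j) i k) ?swapR ?(@swapD v j k) //; lia.
case: (e =P k) => [->|ek]; last by rewrite !swapD.
by rewrite (@swapD (swap v j k) i j) ?swapR ?swapL //; lia.
Qed.

Section Operators.
Variable R : comNzRingType.
Implicit Types (v : Sinf) (phi psi : Sinf -> R).

(** A word in these operators is a saturated chain read from its start: the
    leftmost letter is the first cover. *)
Definition T a b phi v : R := if cov v a b then phi (swap v a b) else 0.

Lemma T_ext a b phi psi v : (forall w, phi w = psi w) -> T a b phi v = T a b psi v.
Proof. by move=> E; rewrite /T E. Qed.

Lemma TD a b phi psi v : T a b (fun w => phi w + psi w) v = T a b phi v + T a b psi v.
Proof. by rewrite /T; case: cov => //; rewrite addr0. Qed.

Lemma TB a b phi psi v : T a b (fun w => phi w - psi w) v = T a b phi v - T a b psi v.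
Proof. by rewrite /T; case: cov => //; rewrite subr0. Qed.

(** A cover raises the value at [a], so that it cannot be repeated. *)
Lemma T_sq a b phi v : T a b (T a b phi) v = 0.
Proof.
rewrite /T; case: ifP => // /covP[_ vab _]; case: ifP => // /covP[_].
by rewrite swapL swapR; lia.
Qed.

Lemma T_comm a b c d phi v : uniq [:: a; b; c; d] ->
  T a b (T c d phi) v = T c d (T a b phi) v.
Proof.
move=> U; have := cov_comm v U; rewrite /T swap_comm //.
by case: (cov v a b); case: (cov v c d) => //=; case: cov => //; case: cov.
Qed.

(** Three positions i < j < k: a chain (i, j), (j, k) has exactly one partner with
    the same endpoint, (j, k), (i, k) or (i, k), (i, j), according to the order of
    the values at [j] and [k]. *)
Lemma T3a i j k phi v : (i < j < k)%N ->
  T i j (T j k phi) v = T j k (T i k phi) v + T i k (T i j phi) v.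
Proof.
move=> H; have [ij jk] : (i < j)%N /\ (j < k)%N by apply/andP.
have [e1 e2] := swap3a v H.
rewrite /T -e1 -e2.
have D a b : (forall e, e <> a -> e <> b -> swap v a b e = v e) by move=> e; apply: swapD.
have h1 : cov v i j -> cov (swap v i j) j k -> (v j < v k)%N -> cov v j k /\ cov (swap v j k) i k.
  rewrite !cov_covf; exact: (cov3a1 ij jk (@Sinf_inj v) (D i j) (swapL v i j) (swapR v i j)
   (D j k) (swapL v j k) (swapR v j k) (D i k) (swapL v i k) (swapR v i k)).
have h2 : cov v i j -> cov (swap v i j) j k -> (v k < v j)%N -> cov v i k /\ cov (swap v i k) i j.
  rewrite !cov_covf; exact: (cov3a2 ij jk (@Sinf_inj v) (D i j) (swapL v i j) (swapR v i j)
   (D j k) (swapL v j k) (swapR v j k) (D i k) (swapL v i k) (swapR v i k)).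
have h3 : cov v j k -> cov (swap v j k) i k -> [/\ cov v i j, cov (swap v i j) j k & (v j < v k)%N].
  by move=> /cov_covf a1 /cov_covf a2; have [] := (cov3a3 ij jk (@Sinf_inj v) (D i j) (swapL v i j) (swapR v i j)
   (D j k) (swapL v j k) (swapR v j k) (D i k) (swapL v i k) (swapR v i k)) a1 a2; split=> //; apply/cov_covf.
have h4 : cov v i k -> cov (swap v i k) i j -> [/\ cov v i j, cov (swap v i j) j k & (v k < v j)%N].
  by move=> /cov_covf a1 /cov_covf a2; have [] := (cov3a4 ij jk (@Sinf_inj v) (D i j) (swapL v i j) (swapR v i j)
   (D j k) (swapL v j k) (swapR v j k) (D i k) (swapL v i k) (swapR v i k)) a1 a2; split=> //; apply/cov_covf.
have njk : v j <> v k by apply: Sinf_neq; lia.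
case: (boolP (cov v j k && cov (swap v j k) i k)) => [/andP[a1 a2]|na].
  have [b1 b2 b3] := h3 a1 a2; rewrite a1 a2 b1 b2.
  case: (boolP (cov v i k && cov (swap v i k) i j)) => [/andP[c1 c2]|].
    by have [_ _] := h4 c1 c2; lia.
  by case: cov => //=; [case: cov => //|]; rewrite addr0.
case: (boolP (cov v i k && cov (swap v i k) i j)) => [/andP[c1 c2]|nc].
  have [b1 b2 b3] := h4 c1 c2; rewrite c1 c2 b1 b2.
  by move: na; case: cov => //=; [case: cov => //|]; rewrite add0r.
have -> : (if cov v j k then if cov (swap v j k) i k then phi (swap (swap v i j) j k) else 0 else 0) = 0.
  by move: na; case: cov => //=; case: cov.
have -> : (if cov v i k then if cov (swap v i k) i j then phi (swap (swap v i j) j k) else 0 else 0) = 0.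
  by move: nc; case: cov => //=; case: cov.
rewrite addr0; case: ifP => // b1; case: ifP => // b2.
case: (ltngtP (v j) (v k)) => //.
  by move/(h1 b1 b2) => [a1 a2]; rewrite a1 a2 in na.
by move/(h2 b1 b2) => [a1 a2]; rewrite a1 a2 in nc.
Qed.

Lemma T3b i j k phi v : (i < j < k)%N ->
  T j k (T i j phi) v = T i k (T j k phi) v + T i j (T i k phi) v.
Proof.
move=> H; have [ij jk] : (i < j)%N /\ (j < k)%N by apply/andP.
have [e1 e2] := swap3b v H.
rewrite /T -e1 -e2.
have D a b : (forall e, e <> a -> e <> b -> swap v a b e = v e) by move=> e; apply: swapD.
have h1 : cov v j k -> cov (swap v j k) i j -> (v j < v i)%N -> cov v i k /\ cov (swap v i k) j k.
  rewrite !cov_covf; exact: (cov3b1 ij jk (@Sinf_inj v) (D i j) (swapL v i j) (swapR v i j)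
   (D j k) (swapL v j k) (swapR v j k) (D i k) (swapL v i k) (swapR v i k)).
have h2 : cov v j k -> cov (swap v j k) i j -> (v i < v j)%N -> cov v i j /\ cov (swap v i j) i k.
  rewrite !cov_covf; exact: (cov3b2 ij jk (@Sinf_inj v) (D i j) (swapL v i j) (swapR v i j)
   (D j k) (swapL v j k) (swapR v j k) (D i k) (swapL v i k) (swapR v i k)).
have h3 : cov v i k -> cov (swap v i k) j k -> [/\ cov v j k, cov (swap v j k) i j & (v j < v i)%N].
  by move=> /cov_covf a1 /cov_covf a2; have [] := (cov3b3 ij jk (@Sinf_inj v) (D i j) (swapL v i j) (swapR v i j)
   (D j k) (swapL v j k) (swapR v j k) (D i k) (swapL v i k) (swapR v i k)) a1 a2; split=> //; apply/cov_covf.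
have h4 : cov v i j -> cov (swap v i j) i k -> [/\ cov v j k, cov (swap v j k) i j & (v i < v j)%N].
  by move=> /cov_covf a1 /cov_covf a2; have [] := (cov3b4 ij jk (@Sinf_inj v) (D i j) (swapL v i j) (swapR v i j)
   (D j k) (swapL v j k) (swapR v j k) (D i k) (swapL v i k) (swapR v i k)) a1 a2; split=> //; apply/cov_covf.
have nij : v i <> v j by apply: Sinf_neq; lia.
case: (boolP (cov v i k && cov (swap v i k) j k)) => [/andP[a1 a2]|na].
  have [b1 b2 b3] := h3 a1 a2; rewrite a1 a2 b1 b2.
  case: (boolP (cov v i j && cov (swap v i j) i k)) => [/andP[c1 c2]|].
    by have [_ _] := h4 c1 c2; lia.
  by case: cov => //=; [case: cov => //|]; rewrite addr0.
case: (boolP (cov v i j && cov (swap v i j) i k)) => [/andP[c1 c2]|nc].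
  have [b1 b2 b3] := h4 c1 c2; rewrite c1 c2 b1 b2.
  by move: na; case: cov => //=; [case: cov => //|]; rewrite add0r.
have -> : (if cov v i k then if cov (swap v i k) j k then phi (swap (swap v j k) i j) else 0 else 0) = 0.
  by move: na; case: cov => //=; case: cov.
have -> : (if cov v i j then if cov (swap v i j) i k then phi (swap (swap v j k) i j) else 0 else 0) = 0.
  by move: nc; case: cov => //=; case: cov.
rewrite addr0; case: ifP => // b1; case: ifP => // b2.
case: (ltngtP (v j) (v i)) => //; [| |lia].
  by move/(h1 b1 b2) => [a1 a2]; rewrite a1 a2 in na.
by move/(h2 b1 b2) => [a1 a2]; rewrite a1 a2 in nc.
Qed.

(** The nil-Coxeter part of the isobaric operator: [v] goes to [v s_i] at a
    descent, to 0 elsewhere. *)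
Definition Nd i phi v : R := if (v i.+1 < v i)%N then phi (swap v i i.+1) else 0.

(** The descent operator conjugates [T a b] into the operator of the pair moved
    by s_i; the only exception is the pair (i, i+1) itself, see [Nd_TT]. *)
Lemma Nd_T i a b phi v : (a < b)%N -> ~ (a = i /\ b = i.+1) ->
  Nd i (T a b phi) v = T (transp i i.+1 a) (transp i i.+1 b) (Nd i phi) v.
Proof.
move=> ab nab; rewrite /Nd /T.
set s := transp i i.+1.
have -> : swap (swap v i i.+1) a b = swap (swap v (s a) (s b)) i i.+1.
  apply/SinfP => e; rewrite !swapE; congr (v _).
  rewrite -/s -/s.
  case: (e =P a) => [->|ea]; first by rewrite !transpL.
  case: (e =P b) => [->|eb]; first by rewrite !transpR.
  rewrite (transpD ea eb) transpD //.
    by move/(transp_inj (a := i) (b := i.+1)).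
  by move/(transp_inj (a := i) (b := i.+1)).
have D e : e <> i -> e <> i.+1 -> swap v i i.+1 e = v e by apply: swapD.
have gi := swapL v i i.+1; have gj := swapR v i i.+1.
have vI := @Sinf_inj v.
have main : (v i.+1 < v i)%N && cov (swap v i i.+1) a b =
    cov v (s a) (s b) && (swap v (s a) (s b) i.+1 < swap v (s a) (s b) i)%N.
  case: (a =P i) => [ai|ai].
    subst a; have ib : (i.+1 < b)%N by lia.
    rewrite /s transpL transpD; [|lia..].
    rewrite swapL (@swapD _ _ _ i); [|lia..].
    by apply/idP/idP => /andP; rewrite !cov_covf => /(covN_ib vI D gi gj ib) H; apply/andP; rewrite !cov_covf.
  case: (a =P i.+1) => [aj|aj].
    subst a; rewrite /s transpR transpD; [|lia..].
    rewrite swapL (@swapD _ _ _ i.+1); [|lia..].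
    by apply/idP/idP => /andP; rewrite !cov_covf => /(covN_jb vI D gi gj ab) H; apply/andP; rewrite !cov_covf.
  case: (b =P i) => [bi|bi].
    subst b; rewrite /s transpL transpD; [|lia..].
    rewrite swapR (@swapD _ _ _ i); [|lia..].
    apply/idP/idP => /andP; rewrite !cov_covf.
      by move=> /(covN_ai D gi gj ab) [h1 [h2 h3]]; apply/andP; rewrite !cov_covf.
    move=> [h1 h2]; apply/andP; rewrite !cov_covf; apply/(covN_ai D gi gj ab); split=> //.
    split=> //; case: h1 => _ _ /(_ i); have := @Sinf_neq v i i.+1; lia.
  case: (b =P i.+1) => [bj|bj].
    subst b; have ai' : (a < i)%N by lia.
    rewrite /s transpR transpD; [|lia..].
    rewrite swapR (@swapD _ _ _ i.+1); [|lia..].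
    by apply/idP/idP => /andP; rewrite !cov_covf => /(covN_aj vI D gi gj ai') H; apply/andP; rewrite !cov_covf.
  rewrite /s !transpD; [|lia..]. rewrite !(@swapD _ a b); [|lia..].
  by rewrite andbC; congr (_ && _); apply/idP/idP; rewrite !cov_covf => /(covN_disj D gi gj ai bi aj bj).
move: main; case: (v i.+1 < v i)%N => /=; case: cov => //=; try (by case: cov => //= <-).
all: by move=> <-.
Qed.

(** Exactly one of [v] and [v s_i] has a descent at [i]. *)
Lemma Nd_TT i phi v : Nd i (T i i.+1 phi) v + T i i.+1 (Nd i phi) v = phi v.
Proof.
rewrite /Nd /T; have c (w : Sinf) : cov w i i.+1 = (w i < w i.+1)%N.
  by apply/idP/idP => [/covP[]//|h]; apply/covP; split=> // *; lia.
rewrite !c !swapL !swapR swapK; have := @Sinf_neq v i i.+1.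
case: ltngtP => //; rewrite ?addr0 ?add0r //; lia.
Qed.

End Operators.

(** * The transition operators *)

Section Alcove.
Variable R : comNzRingType.
Implicit Types (v : Sinf) (phi psi : Sinf -> R).

Definition Rm a b phi v : R := phi v - T a b phi v.
Definition Rp a b phi v : R := phi v + T a b phi v.

Lemma T_Rm a b c d phi v : T a b (Rm c d phi) v = T a b phi v - T a b (T c d phi) v.
Proof. exact: TB. Qed.

Lemma T_Rp a b c d phi v : T a b (Rp c d phi) v = T a b phi v + T a b (T c d phi) v.
Proof. exact: TD. Qed.

Lemma T_commE a b c d phi : uniq [:: a; b; c; d] ->
  T a b (T c d phi) = T c d (T a b phi).
Proof. by move=> U; apply: functional_extensionality => v; apply: T_comm. Qed.

Lemma T_sqE a b phi : T a b (T a b phi) = (fun=> 0).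
Proof. by apply: functional_extensionality => v; apply: T_sq. Qed.

Lemma T0 a b v : T a b (fun=> 0 : R) v = 0.
Proof. by rewrite /T; case: cov. Qed.

Lemma RmRp a b phi : Rm a b (Rp a b phi) = phi.
Proof.
apply: functional_extensionality => v; rewrite /Rm T_Rp T_sq /Rp; ring.
Qed.

Lemma Rp_Rp a b c d phi : uniq [:: a; b; c; d] -> Rp a b (Rp c d phi) = Rp c d (Rp a b phi).
Proof.
move=> U; apply: functional_extensionality => v.
by rewrite /Rp -!/(Rp _ _ _) !T_Rp T_comm //; ring.
Qed.

Lemma Rp_Rm a b c d phi : uniq [:: a; b; c; d] -> Rp a b (Rm c d phi) = Rm c d (Rp a b phi).
Proof.
move=> U; apply: functional_extensionality => v.
by rewrite /Rp /Rm -!/(Rp _ _ _) -!/(Rm _ _ _) !T_Rp !T_Rm T_comm //; ring.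
Qed.

Lemma RmE a b phi v : Rm a b phi v = phi v - T a b phi v.
Proof. by []. Qed.

Lemma RpE a b phi v : Rp a b phi v = phi v + T a b phi v.
Proof. by []. Qed.

Lemma TT_Rm a b c d e f phi v : T a b (T c d (Rm e f phi)) v
   = T a b (T c d phi) v - T a b (T c d (T e f phi)) v.
Proof. by rewrite -TB; apply: T_ext => x; rewrite T_Rm. Qed.

Lemma TT_Rp a b c d e f phi v : T a b (T c d (Rp e f phi)) v
   = T a b (T c d phi) v + T a b (T c d (T e f phi)) v.
Proof. by rewrite -TD; apply: T_ext => x; rewrite T_Rp. Qed.

Definition Rexp := (RmE, RpE, T_Rm, T_Rp, TT_Rm, TT_Rp).

(** The Yang-Baxter relations, formal consequences of the quadratic and
    three-term relations. *)
Lemma YB_m j i k phi : (j < i < k)%N ->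
  Rp i k (Rm j i (Rm j k phi)) = Rm j k (Rm j i (Rp i k phi)).
Proof.
move=> H; apply: functional_extensionality => v.
rewrite !Rexp.
have a1 psi w : T j i (T i k psi) w = T i k (T j k psi) w + T j k (T j i psi) w by apply: T3a.
have a2 psi w : T i k (T j i psi) w = T j k (T i k psi) w + T j i (T j k psi) w by apply: T3b.
have d1 : T i k (T j i (T j k phi)) v = T j k (T i k (T j k phi)) v.
  by rewrite a2 [T j k (T j k phi)]T_sqE T0 addr0.
have d2 : T j k (T j i (T i k phi)) v = T j k (T i k (T j k phi)) v.
  by rewrite (T_ext _ _ _ (a1 phi)) TD T_sq addr0.
rewrite d1 d2 a2 a1; ring.
Qed.

Lemma YB_p i j k phi : (i < j < k)%N ->
  Rp i j (Rp i k (Rp j k phi)) = Rp j k (Rp i k (Rp i j phi)).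
Proof.
move=> H; apply: functional_extensionality => v.
rewrite !Rexp.
have a1 psi w : T i j (T j k psi) w = T j k (T i k psi) w + T i k (T i j psi) w by apply: T3a.
have a2 psi w : T j k (T i j psi) w = T i k (T j k psi) w + T i j (T i k psi) w by apply: T3b.
have d1 : T i j (T i k (T j k phi)) v = T j k (T i j (T j k phi)) v.
  by rewrite a2 [T j k (T j k phi)]T_sqE T0 add0r.
have d2 : T j k (T i k (T i j phi)) v = T j k (T i j (T j k phi)) v.
  by rewrite (T_ext _ _ _ (a1 phi)) TD T_sq add0r.
rewrite d1 d2 (a2 phi) (a1 phi); ring.
Qed.

(** The isobaric operator, transported to functions of the permutation: the
    function [groth] satisfies [isobaric i (groth w) = cpi i groth w], see
    [groth_pi]. *)
Definition cpi i phi v : R := Rp i i.+1 (Nd i phi) v.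

Lemma cpiE i phi v : cpi i phi v = if (v i.+1 < v i)%N then phi (swap v i i.+1) else phi v.
Proof.
rewrite /cpi /Rp /Nd /T; have c (w : Sinf) : cov w i i.+1 = (w i < w i.+1)%N.
  by apply/idP/idP => [/covP[]//|h]; apply/covP; split=> // *; lia.
rewrite !c swapL swapR swapK; have := @Sinf_neq v i i.+1.
case: ltngtP => //; rewrite ?addr0 ?add0r //; lia.
Qed.

Lemma NdB i phi psi v : Nd i (fun w => phi w - psi w) v = Nd i phi v - Nd i psi v.
Proof. by rewrite /Nd; case: ifP; rewrite // subr0. Qed.

Lemma NdD i phi psi v : Nd i (fun w => phi w + psi w) v = Nd i phi v + Nd i psi v.
Proof. by rewrite /Nd; case: ifP; rewrite // addr0. Qed.

Lemma Nd_TE i a b phi : (a < b)%N -> ~ (a = i /\ b = i.+1) ->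
  Nd i (T a b phi) = T (transp i i.+1 a) (transp i i.+1 b) (Nd i phi).
Proof. by move=> *; apply: functional_extensionality => v; apply: Nd_T. Qed.

Lemma Nd_Rm i a b phi : (a < b)%N -> ~ (a = i /\ b = i.+1) ->
  Nd i (Rm a b phi) = Rm (transp i i.+1 a) (transp i i.+1 b) (Nd i phi).
Proof.
by move=> *; apply: functional_extensionality => v; rewrite /Rm NdB Nd_TE.
Qed.

Lemma Nd_Rp i a b phi : (a < b)%N -> ~ (a = i /\ b = i.+1) ->
  Nd i (Rp a b phi) = Rp (transp i i.+1 a) (transp i i.+1 b) (Nd i phi).
Proof.
by move=> *; apply: functional_extensionality => v; rewrite /Rp NdD Nd_TE.
Qed.

(** [Lop l s] and [Dop l s] are the two halves of the transition operator: the
    covers whose right end is [l], and those whose left end is [l]. *)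
Definition Lop l (s : seq nat) phi := foldr (fun a => Rp a l) phi s.
Definition Dop l (s : seq nat) phi := foldr (fun b => Rm l b) phi s.

Lemma Lop_cat l s1 s2 phi : Lop l (s1 ++ s2) phi = Lop l s1 (Lop l s2 phi).
Proof. exact: foldr_cat. Qed.

Lemma Dop_cat l s1 s2 phi : Dop l (s1 ++ s2) phi = Dop l s1 (Dop l s2 phi).
Proof. exact: foldr_cat. Qed.

Definition dwn a n := rev (iota a n).

Lemma dwnD a m n : dwn a (m + n) = dwn (a + m) n ++ dwn a m.
Proof. by rewrite /dwn iotaD rev_cat. Qed.

Lemma mem_dwn a n x : (x \in dwn a n) = (a <= x < a + n)%N.
Proof. by rewrite mem_rev mem_iota. Qed.

Lemma Nd_Lop i l s phi : all (fun a => (a < l)%N && ~~ ((a == i) && (l == i.+1))) s ->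
  Nd i (Lop l s phi) = Lop (transp i i.+1 l) (map (transp i i.+1) s) (Nd i phi).
Proof.
elim: s => //= a s IH /andP[/andP[al /andP ne] /IH <-].
by rewrite Nd_Rp // => -[e1 e2]; apply: ne; rewrite e1 e2.
Qed.

Lemma Nd_Dop i l s phi : all (fun b => (l < b)%N && ~~ ((l == i) && (b == i.+1))) s ->
  Nd i (Dop l s phi) = Dop (transp i i.+1 l) (map (transp i i.+1) s) (Nd i phi).
Proof.
elim: s => //= a s IH /andP[/andP[al /andP ne] /IH <-].
by rewrite Nd_Rm // => -[e1 e2]; apply: ne; rewrite e1 e2.
Qed.

Lemma Rp_Lop i j l s phi : i != j -> all (fun a => [&& a != i, a != j, a != l & (l != i) && (l != j)]) s ->
  Rp i j (Lop l s phi) = Lop l s (Rp i j phi).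
Proof.
move=> ij; elim: s => //= a s IH /andP[H /IH <-].
by rewrite Rp_Rp //= !inE; lia.
Qed.

Lemma Rp_Dop i j l s phi : i != j -> all (fun a => [&& a != i, a != j, a != l & (l != i) && (l != j)]) s ->
  Rp i j (Dop l s phi) = Dop l s (Rp i j phi).
Proof.
move=> ij; elim: s => //= a s IH /andP[H /IH <-].
by rewrite Rp_Rm //= !inE; lia.
Qed.

Lemma map_transp_id i s : all (fun a => (a != i) && (a != i.+1)) s ->
  map (transp i i.+1) s = s.
Proof.
by elim: s => //= a s IH /andP[/andP[/eqP ai /eqP aj] /IH ->]; rewrite transpD.
Qed.

Variable N : nat.

(** On [groth], this is multiplication by [1 - Xv l]: see [groth_transition]. *)
Definition Aop l phi := Lop l (dwn 0 l) (Dop l (dwn l.+1 (N - l.+1)) phi).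

Lemma dwn_split a n i : (a <= i)%N -> (i.+1 < a + n)%N ->
  dwn a n = dwn i.+2 (a + n - i.+2) ++ [:: i.+1; i] ++ dwn a (i - a).
Proof.
move=> ai ian; have {1}-> : n = (i - a + (2 + (a + n - i.+2)))%N by lia.
rewrite dwnD dwnD -catA.
have -> : (a + (i - a))%N = i by lia.
have -> : (i + 2)%N = i.+2 by lia.
by [].
Qed.

(** For [i] and [i.+1] on the same side of [j], the factors of [Aop j] with
    indices [i] and [i.+1] are exchanged by the descent operator, and put back in
    order by the Yang-Baxter relation with the factor of the pair (i, i+1). *)
Lemma cpi_Aop_lt i j phi : (j < i)%N -> (i.+1 < N)%N ->
  cpi i (Aop j phi) = Aop j (cpi i phi).
Proof.
move=> ji iN; apply: functional_extensionality => v; rewrite /cpi /Aop.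
rewrite (@dwn_split j.+1 (N - j.+1) i) //; last by lia.
set s1 := dwn i.+2 _; set s2 := dwn j.+1 _.
have h1 : all (fun a => [&& (i.+1 < a)%N & (j < a)%N]) s1.
  by apply/allP => x; rewrite mem_dwn; lia.
have h2 : all (fun a => [&& (a < i)%N & (j < a)%N]) s2.
  by apply/allP => x; rewrite mem_dwn; lia.
have h3 : all (fun a => (a < j)%N) (dwn 0 j).
  by apply/allP => x; rewrite mem_dwn; lia.
rewrite Nd_Lop; last by apply: sub_all h3 => x; lia.
rewrite (map_transp_id (s := dwn 0 j)); last by apply: sub_all h3 => x; lia.
rewrite transpD; [|lia..].
rewrite !Dop_cat Nd_Dop; last by apply: sub_all h1 => x; lia.
rewrite (map_transp_id (s := s1)); last by apply: sub_all h1 => x; lia.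
rewrite transpD; [|lia..].
rewrite [Nd i _]Nd_Dop; last by rewrite /=; lia.
rewrite /= transpL transpR transpD; [|lia..].
rewrite Nd_Dop; last by apply: sub_all h2 => x; lia.
rewrite (map_transp_id (s := s2)); last by apply: sub_all h2 => x; lia.
rewrite transpD; [|lia..].
rewrite -[LHS]/(Rp i i.+1 _ v) Rp_Lop; [|lia|by apply: sub_all h3 => x; lia].
rewrite Rp_Dop; [|lia|by apply: sub_all h1 => x; lia].
rewrite YB_m; last by lia.
by rewrite Rp_Dop; [|lia|by apply: sub_all h2 => x; lia].
Qed.

Lemma cpi_Aop_gt i j phi : (i.+1 < j)%N -> (j < N)%N ->
  cpi i (Aop j phi) = Aop j (cpi i phi).
Proof.
move=> ij jN; apply: functional_extensionality => v; rewrite /cpi /Aop.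
rewrite (@dwn_split 0 j i) //.
set s1 := dwn i.+2 _; set s2 := dwn 0 _; set s3 := dwn j.+1 _.
have h1 : all (fun a => [&& (i.+1 < a)%N & (a < j)%N]) s1.
  by apply/allP => x; rewrite mem_dwn; lia.
have h2 : all (fun a => (a < i)%N) s2.
  by apply/allP => x; rewrite mem_dwn; lia.
have h3 : all (fun a => (j < a)%N) s3.
  by apply/allP => x; rewrite mem_dwn; lia.
rewrite !Lop_cat Nd_Lop; last by apply: sub_all h1 => x; lia.
rewrite (map_transp_id (s := s1)); last by apply: sub_all h1 => x; lia.
rewrite transpD; [|lia..].
rewrite [Nd i _]Nd_Lop; last by rewrite /=; lia.
rewrite /= transpL transpR transpD; [|lia..].
rewrite Nd_Lop; last by apply: sub_all h2 => x; lia.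
rewrite (map_transp_id (s := s2)); last by apply: sub_all h2 => x; lia.
rewrite transpD; [|lia..].
rewrite Nd_Dop; last by apply: sub_all h3 => x; lia.
rewrite (map_transp_id (s := s3)); last by apply: sub_all h3 => x; lia.
rewrite transpD; [|lia..].
rewrite -[LHS]/(Rp i i.+1 _ v) Rp_Lop; [|lia|by apply: sub_all h1 => x; lia].
rewrite YB_p; last by lia.
rewrite Rp_Lop; [|lia|by apply: sub_all h2 => x; lia].
by rewrite Rp_Dop; [|lia|by apply: sub_all h3 => x; lia].
Qed.

Lemma Aop_split i phi : (i.+1 < N)%N ->
  Aop i phi = Lop i (dwn 0 i) (Dop i (dwn i.+2 (N - i.+2)) (Rm i i.+1 phi)) /\
  Aop i.+1 phi = Rp i i.+1 (Lop i.+1 (dwn 0 i) (Dop i.+1 (dwn i.+2 (N - i.+2)) phi)).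
Proof.
move=> iN; rewrite /Aop; split.
  have -> : (N - i.+1 = 1 + (N - i.+2))%N by lia.
  by rewrite dwnD Dop_cat addn1.
have e : dwn 0 i.+1 = i :: dwn 0 i by rewrite -addn1 dwnD.
by rewrite {1}e.
Qed.

(** The common part of [Aop i] and [Aop i.+1], without the factor of the pair
    (i, i+1): the descent operator exchanges its two versions. *)
Lemma Nd_half i phi : (i.+1 < N)%N ->
  Nd i (Lop i (dwn 0 i) (Dop i (dwn i.+2 (N - i.+2)) phi)) =
    Lop i.+1 (dwn 0 i) (Dop i.+1 (dwn i.+2 (N - i.+2)) (Nd i phi)) /\
  Nd i (Lop i.+1 (dwn 0 i) (Dop i.+1 (dwn i.+2 (N - i.+2)) phi)) =
    Lop i (dwn 0 i) (Dop i (dwn i.+2 (N - i.+2)) (Nd i phi)).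
Proof.
move=> iN; set s1 := dwn 0 i; set s2 := dwn _ _.
have h1 : all (fun a => (a < i)%N) s1 by apply/allP => x; rewrite mem_dwn; lia.
have h2 : all (fun a => (i.+1 < a)%N) s2 by apply/allP => x; rewrite mem_dwn; lia.
have e1 : map (transp i i.+1) s1 = s1.
  by apply: map_transp_id; apply: sub_all h1 => x; lia.
have e2 : map (transp i i.+1) s2 = s2.
  by apply: map_transp_id; apply: sub_all h2 => x; lia.
split.
  rewrite Nd_Lop; last by apply: sub_all h1 => x; lia.
  rewrite Nd_Dop; last by apply: sub_all h2 => x; lia.
  by rewrite e1 e2 transpL.
rewrite Nd_Lop; last by apply: sub_all h1 => x; lia.
rewrite Nd_Dop; last by apply: sub_all h2 => x; lia.
by rewrite e1 e2 transpR.
Qed.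

Lemma LopB l s phi psi : Lop l s (fun w => phi w - psi w) =
  fun w => Lop l s phi w - Lop l s psi w.
Proof.
elim: s => //= a s ->; apply: functional_extensionality => v.
by rewrite /Rp TB; ring.
Qed.

Lemma DopB l s phi psi : Dop l s (fun w => phi w - psi w) =
  fun w => Dop l s phi w - Dop l s psi w.
Proof.
elim: s => //= a s ->; apply: functional_extensionality => v.
by rewrite /Rm TB; ring.
Qed.

(** The same commutation rules as between the isobaric operator and the
    multiplications by [1 - X i.+1] and [1 - X i]: compare [iso_y] and [iso_yS]. *)
Lemma cpi_Aop_S i phi v : (i.+1 < N)%N ->
  cpi i (Aop i.+1 phi) v = Aop i (cpi i phi) v + Aop i.+1 phi v.
Proof.
move=> iN; have [-> _] := Aop_split (cpi i phi) iN.
have [_ ->] := Aop_split phi iN; rewrite /cpi RmRp.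
have [_ e2] := Nd_half phi iN.
set X := Lop i.+1 _ _ in e2 *; rewrite -e2.
rewrite !Rexp.
have h w : Nd i (Rp i i.+1 X) w = X w + Nd i X w - T i i.+1 (Nd i X) w.
  by rewrite /Rp NdD -(Nd_TT i X w); ring.
by rewrite h (T_ext _ _ _ h) TB TD T_sq; ring.
Qed.

Lemma cpi_Aop i phi v : (i.+1 < N)%N ->
  cpi i (Aop i phi) v = Aop i.+1 (cpi i phi) v - Aop i.+1 phi v.
Proof.
move=> iN; have [-> _] := Aop_split phi iN.
have [_ ->] := Aop_split (cpi i phi) iN.
have [_ ->] := Aop_split phi iN; rewrite /cpi.
have [e1 _] := Nd_half (Rm i i.+1 phi) iN; rewrite e1.
have h : Nd i (Rm i i.+1 phi) = fun w => Rp i i.+1 (Nd i phi) w - phi w.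
  apply: functional_extensionality => w; rewrite /Rm NdB /Rp.
  by rewrite -[X in _ = _ - X](Nd_TT i phi w); ring.
by rewrite h DopB LopB !Rexp TB; ring.
Qed.

End Alcove.

(** * The simple transpositions on polynomials *)

Lemma renameD t (f g : poly_inf) : rename t (f + g) = rename t f + rename t g.
Proof. exact: (@rmorphD poly_inf poly_inf (rename t)). Qed.

Lemma renameM t (f g : poly_inf) : rename t (f * g) = rename t f * rename t g.
Proof. exact: (@rmorphM poly_inf poly_inf (rename t)). Qed.

Lemma renameC t c : rename t c%:MP = c%:MP.
Proof. by rewrite /rename mmapC. Qed.

Lemma rename_comp s t f : rename s (rename t f) = rename (s \o t) f.
Proof.
elim/poly_inf_ind: f => [c|j|f g ef eg|f g ef eg].
- by rewrite !renameC.
- by rewrite !renameX.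
- rewrite (renameD t f g) (renameD s (rename t f)) [RHS]renameD; exact: congr2.
- rewrite (renameM t f g) (renameM s (rename t f)) [RHS]renameM; exact: congr2.
Qed.

Lemma eq_rename s t f : s =1 t -> rename s f = rename t f.
Proof.
move=> st; elim/poly_inf_ind: f => [c|j|f g ef eg|f g ef eg].
- by rewrite !renameC.
- by rewrite !renameX st.
- rewrite [LHS]renameD [RHS]renameD; exact: congr2.
- rewrite [LHS]renameM [RHS]renameM; exact: congr2.
Qed.

Lemma rename_id t f : t =1 id -> rename t f = f.
Proof.
move=> st; elim/poly_inf_ind: f => [c|j|f g ef eg|f g ef eg].
- by rewrite !renameC.
- by rewrite !renameX st.
- rewrite [LHS]renameD; exact: congr2.
- rewrite [LHS]renameM; exact: congr2.
Qed.

Lemma sactK i f : sact i (sact i f) = f.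
Proof. by rewrite /sact rename_comp; apply: rename_id => e; apply: transpK. Qed.

Lemma sact_comm i j f : (i.+1 < j)%N -> sact i (sact j f) = sact j (sact i f).
Proof.
move=> ij; rewrite /sact !rename_comp; apply: eq_rename => e /=.
case: (e =P i) => [->|ei]; first by rewrite (@transpD j) ?transpL ?transpD //; lia.
case: (e =P i.+1) => [->|ei']; first by rewrite (@transpD j) ?transpR ?transpD //; lia.
rewrite (@transpD i i.+1 e) // transpD //.
  by rewrite /transp; case: eqP; [lia|case: eqP; lia].
by rewrite /transp; case: eqP; [lia|case: eqP; lia].
Qed.

Lemma sact_braid i f : sact i (sact i.+1 (sact i f)) = sact i.+1 (sact i (sact i.+1 f)).
Proof.
have c3 t u w g : rename t (rename u (rename w g)) = rename (t \o (u \o w)) g.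
  by rewrite [rename u _]rename_comp [LHS]rename_comp.
rewrite /sact [LHS]c3 [RHS]c3; apply: eq_rename => e /=.
case: (e =P i) => [->|ei].
  by rewrite transpL (@transpD i.+1 i.+2 i) ?transpL ?(@transpD i i.+1 i.+2) ?transpL //; lia.
case: (e =P i.+1) => [->|ei'].
  rewrite (transpR i i.+1) (transpL i.+1 i.+2) (@transpD i.+1 i.+2 i); [|lia..].
  by rewrite (@transpD i i.+1 i.+2) ?transpL ?transpR //; lia.
case: (e =P i.+2) => [->|ei''].
  rewrite (@transpD i i.+1 i.+2); [|lia..].
  by rewrite !transpR (@transpD i.+1 i.+2 i) //; lia.
by rewrite !transpD.
Qed.

Lemma sactD i f g : sact i (f + g) = sact i f + sact i g.
Proof. exact: renameD. Qed.

Lemma sactM i f g : sact i (f * g) = sact i f * sact i g.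
Proof. exact: renameM. Qed.

Lemma sact1 i : sact i 1 = 1.
Proof. exact: (@rmorph1 poly_inf poly_inf (rename _)). Qed.

Lemma sactN i f : sact i (- f) = - sact i f.
Proof. exact: (@rmorphN poly_inf poly_inf (rename _)). Qed.

Lemma sactX i j : sact i (Xv j) = Xv (transp i i.+1 j).
Proof. exact: renameX. Qed.

Lemma sactXB i a b : sact i (Xv a - Xv b) =
  Xv (transp i i.+1 a) - Xv (transp i i.+1 b).
Proof.
apply: etrans (sactD _ _ _) _; apply: congr2; first exact: sactX.
by apply: etrans (sactN _ _) _; congr (- _); apply: sactX.
Qed.

Lemma sact1B i b : sact i (1 - Xv b) = 1 - Xv (transp i i.+1 b).
Proof.
apply: etrans (sactD _ _ _) _; apply: congr2; first exact: sact1.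
by apply: etrans (sactN _ _) _; congr (- _); apply: sactX.
Qed.

(** [divdiff_uniq] carried to the pair (i, i+2) by the transposition s_(i+1). *)
Lemma cancel2 i (g h : poly_inf) :
  (Xv i - Xv i.+2) * g = (Xv i - Xv i.+2) * h -> g = h.
Proof.
move=> /(congr1 (sact i.+1)).
rewrite [LHS]sactM [RHS]sactM sactXB transpR transpD; [|lia..].
by move=> /divdiff_uniq /(congr1 (sact i.+1)); rewrite [LHS]sactK [RHS]sactK.
Qed.

Lemma isobaricE i f : (Xv i - Xv i.+1) * isobaric i f =
  (1 - Xv i.+1) * f - (1 - Xv i) * sact i f.
Proof.
rewrite /isobaric [LHS]divdiffP; congr (_ - _).
by rewrite [LHS]sactM sact1B transpR.
Qed.

(** * Grothendieck polynomials are well defined *)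

Lemma dec_w0 (w : Sinf) n : (sbound w <= n)%N ->
  (forall i, (i.+1 < n)%N -> (w i.+1 < w i)%N) -> w = w0 n.
Proof.
move=> wn wd; apply/SinfP => i; rewrite mkSE /rev_fun; case: ltnP => ni; last first.
  exact: sboundP (leq_trans wn ni).
have up j : (j < n)%N -> (w j + j < n)%N.
  elim: j => [|j IH] jn; first by rewrite addn0; apply: Sinf_lt.
  by have := IH (ltnW jn); have := wd _ jn; lia.
have lo m : (m < n)%N -> (m <= w (n.-1 - m))%N.
  elim: m => [|m IH] mn //; have := IH (ltnW mn).
  by have := wd (n.-1 - m.+1)%N; rewrite (_ : (n.-1 - m.+1).+1 = n.-1 - m)%N; lia.
have := up i ni; have := lo (n.-1 - i)%N; rewrite (_ : n.-1 - (n.-1 - i) = i)%N; lia.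
Qed.

Lemma asc_or_w0 (w : Sinf) n : (sbound w <= n)%N ->
  w = w0 n \/ exists2 i, (i.+1 < n)%N & (w i < w i.+1)%N.
Proof.
move=> wn; case: (classic (exists2 i, (i.+1 < n)%N & (w i < w i.+1)%N)); first by right.
move=> na; left; apply: dec_w0 => // i iN.
case: (ltngtP (w i.+1) (w i)) => // [wi|/Sinf_inj]; last by lia.
by case: na; exists i.
Qed.

Lemma len_swap_asc (w : Sinf) i : (w i < w i.+1)%N -> len (swap w i i.+1) = (len w).+1.
Proof.
move=> wi; have /covP : [/\ (i < i.+1)%N, (w i < w i.+1)%N &
  forall c, (i < c < i.+1)%N -> (w c < w i)%N || (w i.+1 < w c)%N] by split=> // c; lia.
by case/andP => _ /eqP.
Qed.

Lemma len_bound (w : Sinf) n : (sbound w <= n)%N -> (len w <= n * n)%N.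
Proof.
move=> wn; rewrite (len_lenn wn) /lenn.
apply: (@leq_trans (\sum_(j < n) n)); last by rewrite sum_nat_const card_ord.
apply: leq_sum => j _; apply: (@leq_trans (\sum_(i < n) 1)).
  by apply: leq_sum => i _; apply: leq_b1.
by rewrite sum1_card card_ord.
Qed.

(** The relations between the isobaric operators depend on a few properties of
    the action of the transpositions only. Working in an abstract ring keeps the
    terms small for the decision procedures. *)
Section Isobaric.
Variables (P : comNzRingType) (X : nat -> P) (s iso : nat -> P -> P).
Hypotheses (sD : forall i f g, s i (f + g) = s i f + s i g)
  (sN : forall i f, s i (- f) = - s i f)
  (sM : forall i f g, s i (f * g) = s i f * s i g)
  (s1 : forall i, s i 1 = 1)
  (sX : forall i j, s i (X j) = X (transp i i.+1 j))
  (sK : forall i f, s i (s i f) = f)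
  (s_comm : forall i j f, (i.+1 < j)%N -> s i (s j f) = s j (s i f))
  (s_braid : forall i f, s i (s i.+1 (s i f)) = s i.+1 (s i (s i.+1 f)))
  (can1 : forall i g h, (X i - X i.+1) * g = (X i - X i.+1) * h -> g = h)
  (can2 : forall i g h, (X i - X i.+2) * g = (X i - X i.+2) * h -> g = h)
  (isoE : forall i f, (X i - X i.+1) * iso i f =
     (1 - X i.+1) * f - (1 - X i) * s i f).

Lemma sXL i : s i (X i) = X i.+1. Proof. by rewrite sX transpL. Qed.
Lemma sXR i : s i (X i.+1) = X i. Proof. by rewrite sX transpR. Qed.
Lemma sXD i j : j <> i -> j <> i.+1 -> s i (X j) = X j.
Proof. by move=> *; rewrite sX transpD. Qed.

Lemma iso_eq i f g :
  (X i - X i.+1) * g = (1 - X i.+1) * f - (1 - X i) * s i f -> iso i f = g.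
Proof. by move=> e; apply: (@can1 i); rewrite e isoE. Qed.

Lemma s_iso i f : s i (iso i f) = iso i f.
Proof.
apply/esym/iso_eq; have := congr1 (s i) (isoE i f).
rewrite !(sM, sD, sN, s1, sXL, sXR, sK) => e.
by rewrite -opprB mulNr e; ring.
Qed.

Lemma iso_sym i f : s i f = f -> iso i f = f.
Proof. by move=> e; apply: iso_eq; rewrite e; ring. Qed.

Lemma iso_idem i f : iso i (iso i f) = iso i f.
Proof. exact/iso_sym/s_iso. Qed.

Lemma iso_far i j f : (i.+1 < j)%N -> iso i (iso j f) = iso j (iso i f).
Proof.
move=> ij; apply: iso_eq; apply: (@can1 j).
have e1 := isoE i f; have e2 := isoE j f.
have e3 := isoE j (iso i f).
have e4 := congr1 (s j) e1; have e5 := congr1 (s i) e2.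
move: e4 e5; rewrite !(sM, sD, sN, s1) ![s j (X i)]sXD ?[s j (X i.+1)]sXD; [|lia..].
rewrite ![s i (X j)]sXD ?[s i (X j.+1)]sXD; [|lia..]; rewrite (s_comm f ij).
move=> e4 e5.
rewrite mulrCA e3.
transitivity ((1 - X j.+1) * ((X i - X i.+1) * iso i f) - (1 - X j) * ((X i - X i.+1) * s j (iso i f))).
  by ring.
rewrite e1 e4.
transitivity ((1 - X i.+1) * ((X j - X j.+1) * iso j f) - (1 - X i) * ((X j - X j.+1) * s i (iso j f))); last by ring.
by rewrite e2 e5; ring.
Qed.

(** Both sides, multiplied by (a - b)(b - c)(a - c), are the antisymmetrization of
    (1 - b) (1 - c)^2 f over the permutations of the three variables
    a = x_i, b = x_(i+1), c = x_(i+2). The auxiliary equations express the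
    intermediate divided differences through the six images of [f]. *)
Lemma iso_braid i f : iso i (iso i.+1 (iso i f)) = iso i.+1 (iso i (iso i.+1 f)).
Proof.
apply: (@can1 i); apply: (@can1 i.+1); apply: (@can2 i).
pose a := X i; pose b := X i.+1; pose c := X i.+2.
have sa1 : s i a = b by apply: sXL.
have sb1 : s i b = a by apply: sXR.
have sc1 : s i c = c by apply: sXD; lia.
have sa2 : s i.+1 a = a by apply: sXD; lia.
have sb2 : s i.+1 b = c by apply: sXL.
have sc2 : s i.+1 c = b by apply: sXR.
pose S1 := s i; pose S2 := s i.+1; pose f1 := S1 f; pose f2 := S2 f.
pose f12 := S1 f2; pose f21 := S2 f1; pose f121 := S1 f21.
have f212 : S2 f12 = f121 by rewrite /f12 /f121 /S1 /S2 -s_braid.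
have p1 : (a - b) * iso i f = (1 - b) * f - (1 - a) * f1 by apply: isoE.
pose PP := iso i f; pose Q := S2 PP.
have q1 : (a - c) * Q = (1 - c) * f2 - (1 - a) * f21.
  by have := congr1 S2 p1; rewrite /S2 !(sM, sD, sN, s1) sa2 sb2.
pose M := iso i.+1 PP.
have m1 : (b - c) * M = (1 - c) * PP - (1 - b) * Q by apply: isoE.
pose Q1 := S1 Q; pose M1 := S1 M.
have q2 : (b - c) * Q1 = (1 - c) * f12 - (1 - b) * f121.
  by have := congr1 S1 q1; rewrite /S1 !(sM, sD, sN, s1) sa1 sc1.
have m2 : (a - c) * M1 = (1 - c) * PP - (1 - a) * Q1.
  have := congr1 S1 m1; rewrite /S1 !(sM, sD, sN, s1) sb1 sc1 => ->.
  by rewrite s_iso.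
have l1 : (a - b) * iso i M = (1 - b) * M - (1 - a) * M1 by apply: isoE.
have p1' : (b - c) * iso i.+1 f = (1 - c) * f - (1 - b) * f2 by apply: isoE.
pose PP' := iso i.+1 f; pose Q' := S1 PP'.
have q1' : (a - c) * Q' = (1 - c) * f1 - (1 - a) * f12.
  by have := congr1 S1 p1'; rewrite /S1 !(sM, sD, sN, s1) sb1 sc1.
pose M' := iso i PP'.
have m1' : (a - b) * M' = (1 - b) * PP' - (1 - a) * Q' by apply: isoE.
pose Q1' := S2 Q'; pose M1' := S2 M'.
have q2' : (a - b) * Q1' = (1 - b) * f21 - (1 - a) * f121.
  by have := congr1 S2 q1'; rewrite /S2 !(sM, sD, sN, s1) sa2 sc2 -/S2 f212.
have m2' : (a - c) * M1' = (1 - c) * PP' - (1 - a) * Q1'.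
  have := congr1 S2 m1'; rewrite /S2 !(sM, sD, sN, s1) sa2 sb2 => ->.
  by rewrite s_iso.
have l1' : (b - c) * iso i.+1 M' = (1 - c) * M' - (1 - b) * M1' by apply: isoE.
rewrite -/PP -/PP' -/M -/M' -/a -/b -/c.
rewrite {1}/a in l1 *.
transitivity ((1 - c) ^+ 2 * ((1 - b) * f - (1 - a) * f1) -
  (1 - b) ^+ 2 * ((1 - c) * f2 - (1 - a) * f21) + (1 - a) ^+ 2 * ((1 - c) * f12 - (1 - b) * f121)).
  transitivity ((1 - b) * (a - c) * ((1 - c) * PP - (1 - b) * Q) -
     (1 - a) * (b - c) * ((1 - c) * PP - (1 - a) * Q1)).
    by rewrite -m1 -m2; transitivity ((a - c) * (b - c) * ((a - b) * iso i M));
      [ring | rewrite l1; ring].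
  by rewrite -p1 -q1 -q2 -/PP; ring.
transitivity ((1 - c) * (a - c) * ((1 - b) * PP' - (1 - a) * Q') -
     (1 - b) * (a - b) * ((1 - c) * PP' - (1 - a) * Q1')); last first.
  by rewrite -m1' -m2'; transitivity ((a - c) * (a - b) * ((b - c) * iso i.+1 M'));
      [rewrite l1'; ring | ring].
transitivity ((1 - a) ^+ 2 * ((1 - b) * f21 - (1 - a) * f121) * 0 +
   (1 - b) * (1 - c) * (1 - a) * 0 + (
   (1 - b) ^+ 2 * 0 + ((1-c) * (1 - b) * (a - c) - (1 - b) * (1 - c) * (a - b)) * PP'
   - (1 - c) * (1 - a) * ((1 - c) * f1 - (1 - a) * f12)
   + (1 - b) * (1 - a) * ((1 - b) * f21 - (1 - a) * f121))).
  transitivity ((1 - b) * (1 - c) * ((b - c) * PP') - (1 - c) * (1 - a) * ((1 - c) * f1 - (1 - a) * f12)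
   + (1 - b) * (1 - a) * ((1 - b) * f21 - (1 - a) * f121)); last by ring.
  by rewrite p1'; ring.
by rewrite -q1' -q2'; ring.
Qed.

Lemma iso_yD i j f : j <> i -> j <> i.+1 -> iso i ((1 - X j) * f) = (1 - X j) * iso i f.
Proof.
move=> ji jS; apply: iso_eq; rewrite mulrCA isoE !(sM, sD, sN, s1) sXD //; ring.
Qed.

Lemma iso_yS i f : iso i ((1 - X i) * f) = (1 - X i.+1) * iso i f - (1 - X i.+1) * f.
Proof.
apply: iso_eq; rewrite mulrBr mulrCA isoE !(sM, sD, sN, s1) sXL; ring.
Qed.

Lemma iso_y i f : iso i ((1 - X i.+1) * f) = (1 - X i) * iso i f + (1 - X i.+1) * f.
Proof.
apply: iso_eq; rewrite mulrDr mulrCA isoE !(sM, sD, sN, s1) sXR; ring.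
Qed.

(** Used for monomials: where the exponent of x_i exceeds that of x_(i+1) by one,
    the isobaric operator lowers it by one. *)
Lemma iso_Xsym i f : s i f = f -> iso i (X i * f) = f.
Proof.
by move=> e; apply: iso_eq; rewrite sM sXL e; ring.
Qed.

Definition mon n (c : nat -> nat) : P := \prod_(l < n) X l ^+ c l.

Lemma s_prod i (I : Type) (r : seq I) (F : I -> P) : s i (\prod_(k <- r) F k) = \prod_(k <- r) s i (F k).
Proof.
elim: r => [|x r IH]; first by rewrite !big_nil s1.
by rewrite !big_cons sM IH.
Qed.

Lemma s_exp i f m : s i (f ^+ m) = s i f ^+ m.
Proof. by elim: m => [|m IH]; rewrite ?expr0 ?s1 // !exprS sM IH. Qed.

Lemma mon_sym i n c : (i.+1 < n)%N -> c i = c i.+1 -> s i (mon n c) = mon n c.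
Proof.
move=> iN ci; rewrite /mon s_prod; have iN' := ltnW iN.
rewrite (bigD1 (Ordinal iN)) //= (bigD1 (Ordinal iN')) /=; last by rewrite -(inj_eq val_inj) /=; lia.
rewrite [in RHS](bigD1 (Ordinal iN)) //= [in RHS](bigD1 (Ordinal iN')) /=; last by rewrite -(inj_eq val_inj) /=; lia.
rewrite !s_exp sXL sXR ci !mulrA [_ * X i.+1 ^+ _]mulrC; congr (_ * _).
apply: eq_bigr => k; rewrite -!(inj_eq val_inj) /= => /andP[k1 k2].
by rewrite s_exp sXD //; lia.
Qed.

Lemma mon_ext n c d : (forall i, (i < n)%N -> c i = d i) -> mon n c = mon n d.
Proof. by move=> e; apply: eq_bigr => i _; rewrite e. Qed.

Lemma mon_X i n c : (i < n)%N -> mon n (fun j => c j + (j == i))%N = X i * mon n c.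
Proof.
move=> iN; rewrite /mon (bigD1 (Ordinal iN)) //= [in RHS](bigD1 (Ordinal iN)) //=.
rewrite eqxx addn1 exprS -!mulrA; congr (_ * (_ * _)).
by apply: eq_bigr => k; rewrite -(inj_eq val_inj) /= => /negPf ->; rewrite addn0.
Qed.

Lemma iso_mon i n c d : (i.+1 < n)%N -> c i = c i.+1 ->
  (forall j, (j < n)%N -> d j = c j + (j == i))%N -> iso i (mon n d) = mon n c.
Proof.
move=> iN ci dc; rewrite (mon_ext dc) mon_X; last exact: ltnW.
by rewrite iso_Xsym // mon_sym.
Qed.

(** The recursive definition of the polynomials, confined to permutations of the
    first [n] positions and started from the longest element of that group only;
    [is_groth] allows the start from the longest element of any group. *)
Inductive ig n : Sinf -> P -> Prop :=
| ig_w0 : ig n (w0 n) (mon n (fun i => n.-1 - i)%N)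
| ig_step (w : Sinf) f i : (i.+1 < n)%N -> ig n w f -> (w i.+1 < w i)%N ->
    ig n (swap w i i.+1) (iso i f).

Lemma ig_inv n (w : Sinf) f : ig n w f -> (w = w0 n /\ f = mon n (fun i => n.-1 - i)%N) \/
  exists i g, [/\ (i.+1 < n)%N, (w i < w i.+1)%N, ig n (swap w i i.+1) g & f = iso i g].
Proof.
case=> [|u g i iN ug ui]; [by left|right].
by exists i, g; rewrite swapL swapR swapK.
Qed.

Lemma ig_bound n w f : ig n w f -> (sbound w <= n)%N.
Proof.
elim=> [|u g i iN _ un _]; last by apply: sbound_swap => //; apply: ltnW.
by apply: sbound_le => i; rewrite mkSE /rev_fun ltnNge => ->.
Qed.

Lemma ig_step' n (w : Sinf) f i : (i.+1 < n)%N -> (w i < w i.+1)%N ->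
  ig n (swap w i i.+1) f -> ig n w (iso i f).
Proof.
move=> iN wi h; rewrite -(swapK w i i.+1); apply: ig_step => //.
by rewrite swapL swapR.
Qed.

Lemma ig_ex n (w : Sinf) : (sbound w <= n)%N -> exists f, ig n w f.
Proof.
move: {2}(n * n - len w)%N (leqnn (n * n - len w)) => m.
elim: m w => [|m IH] w wm wn.
  have [->|[i iN wi]] := asc_or_w0 wn; first by eexists; apply: ig_w0.
  by have := len_swap_asc wi; have := len_bound (sbound_swap wn (ltnW iN) iN); lia.
have [->|[i iN wi]] := asc_or_w0 wn; first by eexists; apply: ig_w0.
have := len_swap_asc wi; have := len_bound (sbound_swap wn (ltnW iN) iN).
move=> h1 h2; have [||f] := IH (swap w i i.+1); first by lia.
  by apply: sbound_swap => //; apply: ltnW.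
by exists (iso i f); apply: ig_step'.
Qed.

(** Two ascents of [w] are compared by a common element above both: the
    polynomial there gives both values, by the commutation relation if the
    ascents are far apart and by the braid relation if they are adjacent. *)
Lemma ig_uniq n w f f' : ig n w f -> ig n w f' -> f = f'.
Proof.
move=> wf; have wn := ig_bound wf; move: wf.
move: {2}(n * n - len w)%N (leqnn (n * n - len w)) => m.
elim: m w f f' wn => [|m IH] w f f' wn wm.
  have w0asc i : (i.+1 < n)%N -> (w i < w i.+1)%N -> False.
    move=> iN wi; have := len_swap_asc wi; have := len_bound (sbound_swap wn (ltnW iN) iN).
    by lia.
  move=> /ig_inv[[_ ->]|[i [g [iN wi _ _]]]]; last by case: (w0asc _ iN wi).
  move=> /ig_inv[[_ ->]|[i [g [iN wi _ _]]]]; last by case: (w0asc _ iN wi).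
  by [].
have sb i : (i.+1 < n)%N -> (sbound (swap w i i.+1) <= n)%N.
  by move=> iN; apply: sbound_swap => //; apply: ltnW.
have IH1 i g g' : (i.+1 < n)%N -> (w i < w i.+1)%N ->
    ig n (swap w i i.+1) g -> ig n (swap w i i.+1) g' -> g = g'.
  move=> iN wi; apply: IH; first exact: sb.
  by have := len_swap_asc wi; have := len_bound (sb i iN); lia.
move=> /ig_inv[[e ->]|[i [g [iN wi ug ->]]]].
  move=> /ig_inv[[_ ->]//|[i [g [iN wi _ _]]]].
  by move: wi; rewrite e !mkSE /rev_fun; do ! case: ifP; lia.
move=> /ig_inv[[e _]|[j [g' [jN wj ug' ->]]]].
  by move: wi; rewrite e !mkSE /rev_fun; do ! case: ifP; lia.
wlog ij : i j g g' iN wi ug jN wj ug' / (i <= j)%N.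
  by move=> H; case: (leqP i j) => ij; [apply: H|apply/esym/H => //; apply: ltnW].
case: (i =P j) => [e|nij].
  by subst j; congr (iso i _); apply: IH1 ug ug'.
case: (ltngtP i.+1 j) => [ij'||e]; [|lia|].
  (* the exchanges at [i] and [j] commute, and [z] lies above both *)
  pose z := swap (swap w i i.+1) j j.+1.
  have ez : z = swap (swap w j j.+1) i i.+1 by apply: swap_comm; rewrite /= !inE; lia.
  have [h zh] : exists h, ig n z h by apply: ig_ex; apply: sbound_swap => //; [exact: sb|lia].
  have -> : g = iso j h.
    apply: IH1 ug _ => //; apply: ig_step' => //.
    by rewrite !swapD //; lia.
  have -> : g' = iso i h.
    apply: IH1 ug' _ => //; apply: ig_step' => //; last by rewrite -ez.
    by rewrite !swapD //; lia.
  exact: iso_far.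
subst j; pose z := swap (swap (swap w i i.+1) i.+1 i.+2) i i.+1.
have ez : z = swap (swap (swap w i.+1 i.+2) i i.+1) i.+1 i.+2.
  have H : (i < i.+1 < i.+2)%N by lia.
  have [e1 e2] := swap3a w H; have [e3 e4] := swap3b w H.
  by rewrite /z e2 e3 !swapK.
have [h zh] : exists h, ig n z h.
  by apply: ig_ex; do 3 (apply: sbound_swap; rewrite ?(ltnW iN) //).
have -> : g = iso i.+1 (iso i h).
  apply: IH1 ug _ => //; apply: ig_step' => //.
    by rewrite swapR swapD //; lia.
  apply: ig_step' => //.
  by rewrite swapL (@swapD _ i.+1 i.+2) ?swapL ?(@swapD w i i.+1 i.+2) //; lia.
have -> : g' = iso i (iso i.+1 h).
  apply: IH1 ug' _ => //; apply: ig_step' => //.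
    by rewrite swapL swapD //; lia.
  apply: ig_step' => //; last by rewrite -ez.
  by rewrite swapR (@swapD _ i i.+1 i.+2) ?swapR ?(@swapD w i.+1 i.+2 i) //; lia.
exact: iso_braid.
Qed.

(** Moving the largest value of the longest element to the right, one adjacent
    exchange at a time, lowers the exponents of the leading monomial one after
    the other. Taken to the last position, it proves independence of [n]
    ([ig_w0S]). *)
Lemma ig_slide n m : (m <= n)%N -> exists2 u : Sinf,
  ig n.+1 u (mon n.+1 (fun i => if i < m then n.-1 - i else n - i)%N) &
  forall i, u i = (if i < m then n.-1 - i else if i == m then n else if i <= n then n - i else i)%N.
Proof.
elim: m => [|m IH] mn.
  exists (w0 n.+1); first exact: ig_w0.
  by move=> i; rewrite mkSE /rev_fun /= ltnS; case: eqP => // ->; rewrite leq0n subn0.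
have [u ug uE] := IH (ltnW mn).
exists (swap u m m.+1).
  rewrite (_ : mon _ _ = iso m (mon n.+1 (fun i => if (i < m)%N then n.-1 - i else n - i)%N)).
    by apply: ig_step => //; rewrite !uE; do ! case: ifP; lia.
  apply/esym/iso_mon => [||j jn]; first by lia.
    by rewrite ltnSn ltnn; lia.
  by case: (j =P m) => ?; do ! case: ifP; lia.
move=> i; case: (i =P m) => [->|im].
  by rewrite swapL !uE; do ! case: ifP; lia.
case: (i =P m.+1) => [->|im'].
  by rewrite swapR !uE; do ! case: ifP; lia.
by rewrite swapD // !uE; do ! case: ifP; lia.
Qed.

(** The same motion, skipping the position [j]: the second largest value moves
    from the position after [j] on, and the largest one stays at [j]. *)
Lemma ig_slide2 n j m : (j < m <= n)%N -> exists2 u : Sinf,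
  ig n.+1 u (mon n.+1 (fun i => if i == j then n - i else if i < m then n.-1 - i else n - i)%N) &
  forall i, u i = (if i == j then n else if i < m then n.-1 - i
     else if i == m then n.-1 - j else if i <= n then n - i else i)%N.
Proof.
elim: m => [|m IH] // /andP[jm mn].
case: (j =P m) => [e|jm'].
  have [|u ug uE] := @ig_slide n j; first by lia.
  subst m; exists u.
    rewrite (_ : mon _ _ = mon n.+1 (fun i => if i < j then n.-1 - i else n - i)%N) //.
    by apply: mon_ext => i iN; do ! case: ifP; lia.
  by move=> i; rewrite uE; do ! case: ifP; lia.
have [|u ug uE] := IH; first by lia.
exists (swap u m m.+1).
  rewrite (_ : mon _ _ = iso m (mon n.+1 (fun i => if i == j then n - i else if (i < m)%N then n.-1 - i else n - i)%N)).
    by apply: ig_step => //; rewrite !uE; do ! case: ifP; lia.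
  apply/esym/iso_mon => [||i iN]; first by lia.
    by do ! case: ifP; lia.
  by do ! case: ifP; lia.
move=> i; case: (i =P m) => [->|im].
  by rewrite swapL !uE; do ! case: ifP; lia.
case: (i =P m.+1) => [->|im''].
  by rewrite swapR !uE; do ! case: ifP; lia.
by rewrite swapD // !uE; do ! case: ifP; lia.
Qed.

Lemma ig_w0S n : ig n.+1 (w0 n) (mon n (fun i => n.-1 - i)%N).
Proof.
have [u ug uE] := @ig_slide n n (leqnn n).
have -> : w0 n = u.
  apply/SinfP => i; rewrite uE mkSE /rev_fun; do ! case: ifP; lia.
rewrite (_ : mon _ _ = mon n.+1 (fun i => if i < n then n.-1 - i else n - i)%N) //.
rewrite /mon big_ord_recr /= ltnn subnn expr0 mulr1.
by apply: eq_bigr => i _; rewrite ltn_ord.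
Qed.

Lemma ig_S n w f : ig n w f -> ig n.+1 w f.
Proof.
elim=> [|u g i iN _ un ui]; first exact: ig_w0S.
by apply: ig_step => //; lia.
Qed.

Lemma ig_le n m w f : (n <= m)%N -> ig n w f -> ig m w f.
Proof. by move=> /subnK <-; elim: (m - n)%N => // d IH /IH; apply: ig_S. Qed.

(** The only permutation above the longest element that occurs in the transition
    formula: this is where multiplication by [X j] comes from. *)
Lemma ig_w0_swap n j : (j < n)%N ->
  ig n.+1 (swap (w0 n) j n) (X j * mon n (fun i => n.-1 - i)%N).
Proof.
move=> jn; have [|u ug uE] := @ig_slide2 n j n; first by lia.
have -> : swap (w0 n) j n = u.
  apply/SinfP => i; rewrite uE.
  case: (i =P j) => [->|ij]; first by rewrite swapL mkSE /rev_fun ltnn.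
  case: (i =P n) => [->|ijn]; first by rewrite swapR mkSE /rev_fun; do ! case: ifP; lia.
  by rewrite swapD // mkSE /rev_fun; do ! case: ifP; lia.
rewrite -(mon_X _ jn).
rewrite (_ : mon n _ = mon n.+1 (fun i => if i == j then n - i else if i < n then n.-1 - i else n - i)%N) //.
rewrite /mon big_ord_recr /= ltnn subnn (_ : (n == j) = false) ?expr0 ?mulr1; last by lia.
by apply: eq_bigr => i _; congr (_ ^+ _); have := ltn_ord i; do ! case: eqP; rewrite ?ltn_ord; lia.
Qed.

End Isobaric.

(** * The transition formula *)

Lemma Lop_nocov (R : comNzRingType) l s (phi : Sinf -> R) v :
  (forall a, a \in s -> ~~ cov v a l) -> Lop l s phi v = phi v.
Proof.
elim: s => //= a s IH h; rewrite /Rp IH; last by move=> x xs; apply: h; rewrite inE xs orbT.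
by rewrite /T (negPf (h a (mem_head _ _))) addr0.
Qed.

Lemma Dop_nocov (R : comNzRingType) l s (phi : Sinf -> R) v :
  (forall a, a \in s -> ~~ cov v l a) -> Dop l s phi v = phi v.
Proof.
elim: s => //= a s IH h; rewrite /Rm IH; last by move=> x xs; apply: h; rewrite inE xs orbT.
by rewrite /T (negPf (h a (mem_head _ _))) subr0.
Qed.

Section Additive.
Variables (R R' : comNzRingType) (h : R -> R').
Hypotheses (hD : forall x y, h (x + y) = h x + h y) (h0 : h 0 = 0) (hN : forall x, h (- x) = - h x).

Lemma T_add a b phi v : T a b (h \o phi) v = h (T a b phi v).
Proof. by rewrite /T; case: cov. Qed.

Lemma Lop_add l s phi : Lop l s (h \o phi) = h \o Lop l s phi.
Proof.
elim: s => //= a s ->; apply: functional_extensionality => v.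
by rewrite /= /Rp hD T_add.
Qed.

Lemma Dop_add l s phi : Dop l s (h \o phi) = h \o Dop l s phi.
Proof.
elim: s => //= a s ->; apply: functional_extensionality => v.
by rewrite /= /Rm hD hN T_add.
Qed.

Lemma Aop_add N j phi v : Aop N j (h \o phi) v = h (Aop N j phi v).
Proof. by rewrite /Aop Dop_add Lop_add. Qed.
End Additive.

(** The transition formula by induction downwards from the longest element. The
    function [G] stands for [groth]; the step from [u] to [u s_i] replaces the
    value at [u s_i] by the isobaric operator, which commutes in the same way
    with [Aop] and with multiplication by [1 - X j]. *)
Section Transition.
Variables (P : comNzRingType) (X : nat -> P) (s iso : nat -> P -> P).
Hypotheses (sD : forall i f g, s i (f + g) = s i f + s i g)
  (sN : forall i f, s i (- f) = - s i f)
  (sM : forall i f g, s i (f * g) = s i f * s i g)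
  (s1 : forall i, s i 1 = 1)
  (sX : forall i j, s i (X j) = X (transp i i.+1 j))
  (can1 : forall i g h, (X i - X i.+1) * g = (X i - X i.+1) * h -> g = h)
  (isoE : forall i f, (X i - X i.+1) * iso i f =
     (1 - X i.+1) * f - (1 - X i) * s i f).

Lemma iso_D i f g : iso i (f + g) = iso i f + iso i g.
Proof. by apply: (iso_eq can1 isoE); rewrite mulrDr !isoE sD; ring. Qed.

Lemma iso_N i f : iso i (- f) = - iso i f.
Proof. by apply: (iso_eq can1 isoE); rewrite mulrN !isoE sN; ring. Qed.

Lemma iso_0 i : iso i 0 = 0.
Proof. by have := iso_D i 0 0; rewrite addr0 => /eqP; rewrite -subr_eq0 opprD addNKr oppr_eq0 => /eqP. Qed.

Variable G : Sinf -> P.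
Hypotheses (Gpi : forall i w, iso i (G w) = cpi i G w)
  (Gw0 : forall n j, (j < n)%N -> G (swap (w0 n) j n) = X j * G (w0 n)).

Lemma w0_nocov n a b : (b < n)%N -> ~~ cov (w0 n) a b.
Proof.
move=> bn; apply/negP => /covP[ab].
by rewrite !mkSE /rev_fun; do ! case: ifP; lia.
Qed.

Lemma isobaric_transition n j w : (sbound w <= n)%N -> (j < n)%N -> Aop n.+1 j G w = (1 - X j) * G w.
Proof.
move: {2}(n * n - len w)%N (leqnn (n * n - len w)) => m.
elim: m j w => [|m IH] j w wm wn jn; have [->|[i iN wi]] := asc_or_w0 wn.
1,3: rewrite /Aop Lop_nocov; last by move=> a _; apply: w0_nocov.
1,2: have -> : (n.+1 - j.+1 = (n - j.+1) + 1)%N by lia.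
1,2: rewrite dwnD subnKC //= /Rm /T Dop_nocov;
  last by move=> a; rewrite mem_dwn => ?; apply: w0_nocov; lia.
1,2: have -> : cov (w0 n) j n.
1,3: apply/covP; split=> //; rewrite ?mkSE /rev_fun ?ltnn;
  [by do ! case: ifP; lia | move=> c cI; rewrite mkSE /rev_fun; do ! case: ifP; lia].
1,2: rewrite Dop_nocov ?Gw0 //; [ring|].
1,2: move=> a; rewrite mem_dwn => aI; apply/negP => /covP[_ ].
1,2: rewrite swapL swapD; [|lia..].
1,2: by rewrite !mkSE /rev_fun; do ! case: ifP; lia.
  by have := len_swap_asc wi; have := len_bound (sbound_swap wn (ltnW iN) iN); lia.
have un := sbound_swap wn (ltnW iN) iN.
have wE : w = swap (swap w i i.+1) i i.+1 by rewrite swapK.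
have ui : (swap w i i.+1 i.+1 < swap w i i.+1 i)%N by rewrite swapL swapR.
have um : (n * n - len (swap w i i.+1) <= m)%N.
  by have := len_swap_asc wi; have := len_bound un; lia.
move: (swap w i i.+1) un wE ui um => u un wE ui um; rewrite wE.
have IHu k : (k < n)%N -> Aop n.+1 k G u = (1 - X k) * G u by move=> kn; apply: IH.
have E (phi : Sinf -> P) : phi (swap u i i.+1) = cpi i phi u by rewrite cpiE ui.
rewrite (E (Aop n.+1 j G)) (E G) -Gpi.
have cE : cpi i G = iso i \o G by apply: functional_extensionality => x; rewrite /= Gpi.
have Ac k : (k < n)%N -> Aop n.+1 k (cpi i G) u = iso i ((1 - X k) * G u).
  move=> kn; rewrite cE (Aop_add (h := iso i)) ?IHu //; [exact: iso_D|exact: iso_0|exact: iso_N].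
have y1 := iso_yD sD sN sM s1 sX can1 isoE.
have y2 := iso_yS sD sN sM s1 sX can1 isoE.
have y3 := iso_y sD sN sM s1 sX can1 isoE.
case: (j =P i) => [->|ji].
  rewrite cpi_Aop; last by lia.
  rewrite Ac // IHu // y3; ring.
case: (j =P i.+1) => [->|ji'].
  rewrite cpi_Aop_S; last by lia.
  rewrite Ac ?IHu ?y2 //; [ring|lia].
have [ji2|ji2] : (j < i)%N \/ (i.+1 < j)%N by lia.
  by rewrite cpi_Aop_lt ?Ac ?y1 //; lia.
by rewrite cpi_Aop_gt ?Ac ?y1 //; lia.
Qed.
End Transition.

(** The window [n] makes the graph finite and the induction possible; [groth]
    itself has no window, and the next lemmas remove it. *)
Definition igp := ig Xv isobaric.

Lemma igp_is_groth n w f : igp n w f -> is_groth w f.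
Proof.
elim=> [|u g i _ _ IH ui]; first exact: is_groth_w0.
apply: is_groth_step => //.
have := @len_swap_asc (swap u i i.+1) i; rewrite swapK swapL swapR => -> //.
Qed.

Lemma is_groth_igp w f : is_groth w f -> exists n, igp n w f.
Proof.
elim=> [n|u g i _ [n ug] h]; first by exists n; apply: ig_w0.
have un := ig_bound ug.
have ui : (u i.+1 < u i)%N.
  case: (ltngtP (u i.+1) (u i)) => //; last by move/Sinf_inj; lia.
  by move/len_swap_asc; lia.
have iN : (i.+1 < n)%N.
  rewrite ltnNge; apply/negP => ni; move: ui.
  rewrite (sboundP (leq_trans un ni)); case: (ltngtP n i.+1) => [h1||h1]; [|lia|].
    by rewrite (sboundP (leq_trans un _)); lia.
  by have := @Sinf_lt u i n un; lia.
by exists n; apply: ig_step.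
Qed.

Lemma igp_uniq n w f f' : igp n w f -> igp n w f' -> f = f'.
Proof.
apply: (ig_uniq sactD sactN sactM sact1 sactX sactK sact_comm sact_braid divdiff_uniq cancel2 isobaricE).
Qed.

Lemma igp_le n m w f : (n <= m)%N -> igp n w f -> igp m w f.
Proof. apply: (ig_le sactM sact1 sactX divdiff_uniq isobaricE). Qed.

Lemma groth_igp n w : (sbound w <= n)%N -> igp n w (groth w).
Proof.
move=> wn; have [f wf] := ig_ex Xv isobaric wn.
have fg := igp_is_groth wf.
have [m wg] := is_groth_igp (epsilon_spec (inhabits 0) (is_groth w) (ex_intro _ f fg)).
have -> : groth w = f; last exact: wf.
by apply: (@igp_uniq (maxn n m) w); [apply: igp_le wg | apply: igp_le wf]; lia.
Qed.

Lemma groth_igE n w f : igp n w f -> groth w = f.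
Proof. by move=> h; exact: (igp_uniq (groth_igp (ig_bound h)) h). Qed.

Lemma groth_w0 n : groth (w0 n) = mon Xv n (fun i => n.-1 - i)%N.
Proof. by apply: (@groth_igE n); apply: ig_w0. Qed.

Lemma groth_w0_swap n j : (j < n)%N -> groth (swap (w0 n) j n) = Xv j * groth (w0 n).
Proof.
move=> jn; rewrite groth_w0; apply: (@groth_igE n.+1).
exact: (ig_w0_swap sactM sact1 sactX divdiff_uniq isobaricE).
Qed.

Lemma groth_desc i (w : Sinf) : (w i.+1 < w i)%N -> groth (swap w i i.+1) = isobaric i (groth w).
Proof.
move=> wi; apply: (@groth_igE (maxn (sbound w) i.+2)); apply: ig_step => //; first by lia.
by apply: groth_igp; apply: leq_maxl.
Qed.

Lemma groth_pi i w : isobaric i (groth w) = cpi i (groth : Sinf -> poly_inf) w.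
Proof.
rewrite cpiE; case: ifP => [/groth_desc //|wi].
have wi' : (w i < w i.+1)%N.
  by case: ltngtP wi => // /Sinf_inj; lia.
rewrite -(swapK w i i.+1) groth_desc; last by rewrite swapL swapR.
exact: (iso_idem sactD sactN sactM sact1 sactX sactK divdiff_uniq isobaricE).
Qed.

Lemma groth_transition n j w : (sbound w <= n)%N -> (j < n)%N ->
  Aop n.+1 j groth w = (1 - Xv j) * groth w :> poly_inf.
Proof.
apply: (isobaric_transition sactD sactN sactM sact1 sactX divdiff_uniq isobaricE groth_pi groth_w0_swap).
Qed.

(** * Chains and groups of covers *)

(** Chains as lists of pairs; [kend] is the endpoint. The covers with the same
    left position form a group, which is recorded by the word of its right
    positions. *)
Fixpoint kch (u : Sinf) (g : seq (nat * nat)) : bool :=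
  if g is e :: g' then cov u e.1 e.2 && kch (swap u e.1 e.2) g' else true.

Fixpoint kend (u : Sinf) (g : seq (nat * nat)) : Sinf :=
  if g is e :: g' then kend (swap u e.1 e.2) g' else u.

Definition grp (a : nat) (g : seq nat) : seq (nat * nat) := [seq (a, b) | b <- g].

(** A chain with non-decreasing left positions [j], [j.+1], ... is the list [M] of
    the words of its groups; a word may be empty. *)
Fixpoint pairs (j : nat) (M : seq (seq nat)) : seq (nat * nat) :=
  if M is g :: M' then grp j g ++ pairs j.+1 M' else [::].

(** A cover whose right position is already in [B] cannot be marked, and a cover
    followed by a larger right position in its group cannot be left unmarked: if
    both hold, then no marking of the chain is admissible. *)
Fixpoint feasible (B g : seq nat) : bool :=
  if g is x :: g' then
    (if g' is y :: _ then ~~ ((x \in B) && (x < y)%N) else true) && feasible B g'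
  else true.

Fixpoint feasible_groups (B : seq nat) (M : seq (seq nat)) : bool :=
  if M is g :: M' then feasible B g && feasible_groups (g ++ B) M' else true.

(** [lia] without the hypotheses that are not about numbers: in long contexts
    these make its preprocessing very slow. *)
Ltac slia :=
  repeat match goal with
  | H : is_true (all _ _) |- _ => clear H
  | H : is_true (uniq _) |- _ => clear H
  | H : is_true (kch _ _) |- _ => clear H
  | H : is_true (cov _ _ _) |- _ => clear H
  | H : is_true (feasible _ _) |- _ => clear H
  | H : is_true (feasible_groups _ _) |- _ => clear H
  | H : is_true (_ \in _) |- _ => clear H
  | H : is_true (~~ (_ \in _)) |- _ => clear H
  | H : @eq (seq _) _ _ |- _ => clear H
  | H : is_true (if _ then _ else _) |- _ => clear H
  | H : forall _ : nat, _ |- _ => clear H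
  | H : forall _ : Equality.sort _, _ |- _ => clear H
  | H : {subset _ <= _} |- _ => clear H
  end; lia.

Lemma kch_cat (u : Sinf) g1 g2 : kch u (g1 ++ g2) = kch u g1 && kch (kend u g1) g2.
Proof. by elim: g1 u => //= e g1 IH u; rewrite IH andbA. Qed.

Lemma pairs_cat j M1 M2 : pairs j (M1 ++ M2) = pairs j M1 ++ pairs (j + size M1) M2.
Proof.
elim: M1 j => [|g M1 IH] j /=; first by rewrite addn0.
by rewrite IH catA addSnnS.
Qed.

Lemma mem_pairs j M a b : (a, b) \in pairs j M -> (j <= a < j + size M)%N /\ b \in flatten M.
Proof.
elim: M j => //= g M IH j; rewrite mem_cat => /orP[/mapP[x xg [-> ->]]|/IH].
  by rewrite mem_cat xg; split=> //; lia.
by rewrite mem_cat => -[? ->]; rewrite orbT; split=> //; lia.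
Qed.

Lemma flatten_pairs j M : map snd (pairs j M) = flatten M.
Proof. by elim: M j => //= g M IH j; rewrite map_cat IH -map_comp map_id. Qed.

(** * Chains that do not exist *)

Lemma kend_fix (u : Sinf) g y : (forall e, e \in g -> e.1 <> y /\ e.2 <> y) -> kend u g y = u y.
Proof.
elim: g u => //= e g IH u h; rewrite IH; last by move=> x xg; apply: h; rewrite inE xg orbT.
by have [h1 h2] := h e (mem_head _ _); rewrite swapD //; apply/nesym.
Qed.

Lemma kend_grp_fix (u : Sinf) a g y : y <> a -> y \notin g -> kend u (grp a g) y = u y.
Proof.
move=> ya yg; apply: kend_fix => e /mapP[b bg ->] /=; split; first exact/nesym.
by move=> e2; move: yg; rewrite -e2 bg.
Qed.

(** If no cover uses [i] on the right or [x] on the left, then the value at [i]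
    only grows and the value at [x] only decreases; so the pair (i, x), in the
    wrong order at the start, stays in the wrong order. *)
Lemma rep_pair (u : Sinf) g i x : (forall e, e \in g -> e.2 <> i /\ e.1 <> x) -> (u x < u i)%N ->
  kch u g -> (i, x) \notin g.
Proof.
elim: g u => //= -[a b] g IH u h ux /andP[/= cv kg]; rewrite inE negb_or.
have hg e : e \in g -> e.2 <> i /\ e.1 <> x by move=> eg; apply: h; rewrite inE eg orbT.
have /= [bi ax] := h _ (mem_head _ _).
have /covP [ab uab _] := cv.
apply/andP; split; first by apply/negP => /eqP[e1 e2]; subst; move: uab ux; lia.
apply: IH kg => //=.
case: (i =P a) => [ia|ia].
  subst a; rewrite swapL; case: (x =P b) => [->|xb]; first by rewrite swapR.
  by rewrite swapD //; [lia|move=> e; lia].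
case: (x =P b) => [xb|xb].
  by subst b; rewrite swapR swapD //; [lia|lia].
by rewrite !swapD //; lia.
Qed.

Lemma kch_grp_uniq (u : Sinf) a g : kch u (grp a g) -> (forall x, x \in g -> (a < x)%N) -> uniq g.
Proof.
elim: g u => //= b g IH u /andP[cv kg] h.
have hg x : x \in g -> (a < x)%N by move=> xg; apply: h; rewrite inE xg orbT.
rewrite (IH _ kg hg) andbT; apply/negP => bg.
have /covP [ab uab _] := cv.
have : (a, b) \notin grp a g.
  apply: rep_pair kg => [e /mapP[x /hg xa ->] /=|]; first by split; lia.
  by rewrite swapL swapR.
by rewrite map_f.
Qed.

(** The positions i < e < x, where [x] has been used by a position [m] between
    [i] and [e], and [e] has not been used since. The cover (m, x) leaves behind a
    position between [i] and [e] whose value lies between those of [x] and [e]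
    (the property [Q]), and such a position subsists; so after (i, x), which
    brings the value of [x] to [i], the pair (i, e) is no cover. *)
Section ReuseThenNew.
Variables (i x e : nat).
Hypothesis (ie : (i < e)%N) (ex : (e < x)%N).

Let Q (u : Sinf) := exists2 y, (i < y < e)%N & (u x < u y < u e)%N.

Lemma Q_step (u : Sinf) a b : (i < a < e)%N -> b <> x -> b <> e -> cov u a b -> Q u -> Q (swap u a b).
Proof.
move=> ae bx be /covP[ab uab H] [y yI yv].
have ux : swap u a b x = u x by rewrite swapD //; lia.
have ue : swap u a b e = u e by rewrite swapD //; lia.
case: (y =P a) => [ya|ya].
  subst y; case: (ltngtP b e) => // bE.
    by exists b; [lia|rewrite ux ue swapR; lia].
  by have := H e; exists a; [lia|rewrite ux ue swapL; have := @Sinf_neq u b e; lia].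
case: (y =P b) => [yb|yb].
  by subst y; exists a; [lia|rewrite ux ue swapL; lia].
by exists y; [lia|rewrite ux ue swapD //; lia].
Qed.

Lemma Q_kch (u : Sinf) g : (forall f, f \in g -> [/\ (i < f.1 < e)%N, f.2 <> x & f.2 <> e]) ->
  kch u g -> Q u -> Q (kend u g).
Proof.
elim: g u => //= -[a b] g IH u h /andP[/= cv kg] Qu.
have /= [h1 h2 h3] := h _ (mem_head _ _).
by apply: IH => //; [move=> f fg; apply: h; rewrite inE fg orbT | apply: Q_step].
Qed.

(** Within the group of [i], the position can be lost only if the value at [i]
    passes that of [x], which rules out (i, x) as well. *)
Lemma Q_grp (u : Sinf) g : x \notin g -> e \notin g -> kch u (grp i g) ->
  Q u \/ (u x < u i)%N -> Q (kend u (grp i g)) \/ (kend u (grp i g) x < kend u (grp i g) i)%N.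
Proof.
elim: g u => //= b g IH u; rewrite !inE !negb_or => /andP[xb xg] /andP[eb eg] /andP[cv kg] Qu.
apply: IH => //; have /covP[ib uib H] := cv; have [xb' eb'] : x <> b /\ e <> b by lia.
have ux : swap u i b x = u x by rewrite swapD //; lia.
have ue : swap u i b e = u e by rewrite swapD //; lia.
rewrite ux swapL; case: Qu => [[y yI yv]|?]; last by right; lia.
case: (y =P b) => [yb|yb]; first by right; subst y; lia.
by left; exists y => //; rewrite ux ue swapD //; lia.
Qed.

Lemma reuse_then_new_false (u : Sinf) g1 m g2 z1 :
  kch u (g1 ++ (m, x) :: g2 ++ grp i z1 ++ [:: (i, x); (i, e)]) -> (i < m < e)%N ->
  (forall f, f \in g2 -> [/\ (i < f.1 < e)%N, f.2 <> x & f.2 <> e]) ->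
  x \notin z1 -> e \notin z1 -> False.
Proof.
rewrite kch_cat => /andP[_] /=; move: (kend u g1) => {}u /andP[cv].
rewrite kch_cat => /andP[kg2] + me hg2 xz ez.
have /covP[mx umx H] := cv; set u1 := swap u m x in kg2 *.
set u2 := kend u1 g2; rewrite kch_cat => /andP[kz].
set u3 := kend u2 _ => /= /andP[c1 /andP[c2 _]].
have u2x : u2 x = u1 x by apply: kend_fix => -[a b] /hg2[/= ? ? ?]; split=> //; lia.
have u2e : u2 e = u1 e by apply: kend_fix => -[a b] /hg2[/= ? ? ?]; split=> //; lia.
have u3x : u3 x = u2 x by apply: kend_grp_fix => //; lia.
have u3e : u3 e = u2 e by apply: kend_grp_fix => //; lia.
have /covP[_ v1 _] := c1; have /covP[_] := c2.
rewrite swapL swapD; [|lia..] => v2 H2.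
have u1x : u1 x = u m by rewrite /u1 swapR.
have u1e : u1 e = u e by rewrite /u1 swapD //; lia.
have Q1 : Q u1.
  exists m => //; rewrite /u1 swapL -/u1 u1x u1e.
  by have := H e; have := @Sinf_neq u e x; lia.
have Q2 : Q u2 by apply: Q_kch kg2 Q1.
have [[y yI yv]|] := Q_grp xz ez kz (or_introl Q2); last by rewrite -/u3; lia.
move: yv; rewrite -/u3 => yv.
by have := H2 y; rewrite swapD; lia.
Qed.
End ReuseThenNew.

Definition head_le (g : seq nat) z := if g is y :: _ then (y <= z)%N else true.

(** The obstruction to a later cover (_, c): a position [z] on the way, whose
    value is below that of [c], with no value in between at the positions before
    [z]. The last two conditions carry the obstruction through the group of [j]:
    as long as the value at [j] is below that at [z], a cover (j, z) might remove
    the obstruction, and [z] has to be a used position; when it lies between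
    those at [z] and [c], the next right position must not be beyond [z]. *)
Definition blocked (B : seq nat) j c (u : Sinf) z g : Prop :=
  [/\ (j < z < c)%N, (u z < u c)%N,
    forall y, (j < y < z)%N -> (u y < u z)%N || (u c < u y)%N,
    (u j < u z)%N -> z \in B &
    (u z < u j < u c)%N -> head_le g z].

Lemma blocked_end B j c (u : Sinf) z g : blocked B j c u z (c :: g) -> cov u j c -> False.
Proof.
move=> [zI uz _ _ H] /covP[_ ujc H2]; have := H2 z.
case: (ltngtP (u z) (u j)) => [h|h|/Sinf_inj]; [|slia|slia].
by have /= := H; slia.
Qed.

(** A cover (j, b) either leaves [z] an obstruction, or moves it to [b]. Feasibility
    is needed when the value of [z] is taken: the word must then descend. *)
Lemma blocked_step B j c (u : Sinf) z b g : blocked B j c u z (b :: g) -> b <> c -> (j < b)%N ->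
  cov u j b -> (u c < u j)%N \/ feasible B (b :: g) ->
  exists2 z', z' = z \/ z' = b & blocked B j c (swap u j b) z' g.
Proof.
move=> [zI uz H zB hd] bc jb /covP[_ ujb C] lgb.
have uc : swap u j b c = u c by rewrite swapD; slia.
have uj : swap u j b j = u b by rewrite swapL.
have ub : swap u j b b = u j by rewrite swapR.
have oth y : y <> j -> y <> b -> swap u j b y = u y by move=> *; rewrite swapD.
have nbc := @Sinf_neq u b c bc.
have njz : u j <> u z by apply: Sinf_neq; slia.
have njc : u j <> u c by apply: Sinf_neq; slia.
have [h|h] : (u c < u j)%N \/ (u j < u c)%N by slia.
  (* the group is already above the value at c *)
  have zb : z <> b by move=> e; subst b; slia.
  exists z; first by left.
  have uz' : swap u j b z = u z by apply: oth; slia.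
  split=> //; rewrite ?uz' ?uc ?uj //; [|slia|slia].
  move=> y yI; case: (y =P b) => [->|yb]; first by rewrite ub; slia.
  by rewrite oth //; [apply: H|slia].
have {}lgb : feasible B (b :: g) by case: lgb => //; slia.
have [h2|h2] : (u z < u j)%N \/ (u j < u z)%N by slia.
  (* the value of z has just been taken *)
  have /= bz : (b < z)%N.
    have /= := hd; have : b <> z by move=> e; subst b; slia.
    by slia.
  have ucb : (u c < u b)%N by have := H b; slia.
  exists b; first by right.
  split; rewrite ?ub ?uc ?uj; [slia|slia| |slia|slia].
  move=> y yI; rewrite oth; [|slia..].
  by have := C y; slia.
case: (z =P b) => [e|zb].
  subst b; exists z; first by left.
  split; rewrite ?ub ?uc ?uj; [slia|slia| |slia|].
    move=> y yI; rewrite oth; [|slia..].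
    by have := C y; have := H y; slia.
  move=> _; have zB' := zB h2; move: lgb => /=; rewrite zB' /=.
  by case: g {hd} => //= y g; rewrite -leqNgt => /andP[].
have nbz : u b <> u z by apply: Sinf_neq; slia.
have [h3|h3] : (u b < u z)%N \/ (u z < u b)%N by slia.
  exists z; first by left.
  have uz' : swap u j b z = u z by apply: oth; slia.
  split; rewrite ?uz' ?uc ?uj //; [|by move=> _; apply: zB|slia].
  move=> y yI; case: (y =P b) => [->|yb]; first by rewrite ub; slia.
  by rewrite oth //; [apply: H|slia].
have bz : (b < z)%N by have := C z; slia.
have ucb : (u c < u b)%N by have := H b; slia.
exists b; first by right.
split; rewrite ?ub ?uc ?uj; [slia|slia| |slia|slia].
move=> y yI; rewrite oth; [|slia..].
by have := C y; slia.
Qed.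

Lemma feasible_behead B x g : feasible B (x :: g) -> feasible B g.
Proof. by case/andP. Qed.

(** The obstruction subsists through all groups up to the first cover whose right
    position is [c], here the last cover of the chain; but then it is in the way. *)
Lemma blocked_false M g (u : Sinf) z B Bn j c W :
  blocked B j c u z g -> z \in Bn -> {subset g <= Bn} ->
  (u c < u j)%N \/ feasible B g -> feasible_groups Bn M -> (j + size M < z)%N ->
  all (fun x => j + size M < x)%N (g ++ flatten M) ->
  g ++ flatten M = rcons W c -> c \notin W ->
  kch u (grp j g ++ pairs j.+1 M) -> False.
Proof.
elim: M g u z B Bn j W => [|g' M IHM] g;
  elim: g => [|b g IHg] u z B Bn j W Bk zB gB lgB mlgB jz allW e cW; first by case: W e {cW}.
2: move=> /= kg; have [zI uz H zB' hd] := Bk.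
2: have /= /andP[lg' mlg'] := mlgB.
2: have jj : (j.+1 + size M = j + size (g' :: M))%N by rewrite /= addnS.
2: have Bk' : blocked Bn j.+1 c u z g' by split=> //; [move: jz; rewrite /=; slia
     |move=> y yI; apply: H; slia|have := H j.+1; move: jz => /=; slia].
2: by apply: (IHM g' u z Bn (g' ++ Bn) j.+1 W Bk'); rewrite ?jj //;
     [rewrite mem_cat zB orbT|move=> x xg; rewrite mem_cat xg|right].
all: case: W e cW => [|b' W] /=;
  first by move=> [e _] _ /andP[cv _]; subst b; apply: blocked_end Bk cv.
all: move=> [<- e]; rewrite inE negb_or => /andP[/eqP cb cW] /andP[cv kg].
all: have /covP[jb ujb _] := cv.
all: have [||z' z'E Bk'] := blocked_step Bk _ jb cv; [by move=> h; apply: cb|by []|].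
all: have gBn : {subset g <= Bn} by move=> x xg; apply: gB; rewrite inE xg orbT.
all: move: allW => /= /andP[jb' allW].
all: apply: (IHg _ z' B Bn _ W Bk') => //.
1,4: by case: z'E => -> //; apply: gB; rewrite mem_head.
2,4: by case: z'E => ->.
all: case: lgB => [h|h]; [left|right; exact: feasible_behead h].
all: have [zI _ _ _ _] := Bk.
all: by rewrite swapL swapD; [slia|slia|move=> h'; apply: cb].
Qed.

(** A position between [i] and all right positions of the group of [i] is jumped
    over by each of its covers. *)
Lemma grp_side (u : Sinf) i m g : (i < m)%N -> all (fun x => m < x)%N g -> kch u (grp i g) ->
  (kend u (grp i g) m < kend u (grp i g) i)%N = (u m < u i)%N.
Proof.
move=> im; elim: g u => //= b g IH u /andP[mb allg] /andP[cv kg].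
rewrite IH // swapL swapD; [|slia..].
have /covP[ib uib /(_ m)] := cv; have := @Sinf_neq u m i; have := @Sinf_neq u m b.
by slia.
Qed.

Lemma grp_between (u : Sinf) i g x : uniq g -> all (fun x => i < x)%N g -> kch u (grp i g) ->
  x \in g -> (u i <= kend u (grp i g) x < kend u (grp i g) i)%N.
Proof.
elim: g u => //= b g IH u /andP[bg ug] /andP[ib allg] /andP[cv kg].
have /covP[_ uib _] := cv.
have mono (w : Sinf) g' : kch w (grp i g') -> (w i <= kend w (grp i g') i)%N.
  elim: g' w => //= b' g' IH' w /andP[/covP[_ h _] /IH']; rewrite swapL; slia.
rewrite inE => /orP[/eqP->|xg]; last first.
  by have := IH _ ug allg kg xg; rewrite swapL; slia.
rewrite kend_grp_fix ?swapR //; last by slia.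
by have := mono _ _ kg; rewrite swapL; slia.
Qed.

(** Suppose that no left position from [j] to [L] has a value between that at [c]
    and the bound [f], while all positions of [rho] have such values.
    A left position can then use an element of [rho] only if its value has passed,
    or passes, that at [c]; but a cover which passes the value at [c] without
    using [c] creates an obstruction to the final cover, whose right position is
    [c]. *)
Lemma noncross M (g : seq nat) (u : Sinf) f (rho Bn : seq nat) j c W L : (j + size M = L)%N ->
  (forall m, (j <= m <= L)%N -> (u m < u c)%N || (f < u m)%N) ->
  (forall x, x \in rho -> [/\ (u c < u x)%N, (u x < f)%N & (L < x)%N]) ->
  {subset g <= Bn} -> feasible_groups Bn M ->
  all (fun x => L < x)%N (g ++ flatten M) -> (L < c)%N ->
  g ++ flatten M = rcons W c -> c \notin W ->
  kch u (grp j g ++ pairs j.+1 M) -> forall x, x \in rho -> x \notin W.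
Proof.
elim: M g u Bn j W L => [|g' M IHM] g;
  elim: g => [|b g IHg] u Bn j W L jL K1 K2 gB mlgB allW jc e cW kg x xr; first by case: W e {cW}.
2: have /= /andP[lg' mlg'] := mlgB.
2: have jj : (j.+1 + size M = L)%N by rewrite -jL /= addnS.
2: by apply: (IHM g' u (g' ++ Bn) j.+1 W L) => //;
     [move=> m mI; apply: K1; slia|move=> y yg; rewrite mem_cat yg].
all: have jL' : (j <= L)%N by slia.
all: case: W e cW => [|b' W] //=.
all: move=> [eb e]; subst b'; rewrite !inE !negb_or => /andP[/eqP cb cW].
all: move: kg => /andP[cv kg]; have /covP[/= jb ujb H] := cv.
all: move: allW => /= /andP[jb' allW].
all: have gBn : {subset g <= Bn} by move=> y yg; apply: gB; rewrite inE yg orbT.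
all: have Kj := K1 j; have nbc : u b <> u c by apply: Sinf_neq => h; apply: cb.
all: have uc : swap u j b c = u c by rewrite swapD //; slia.
all: have uj : swap u j b j = u b by rewrite swapL.
all: have ub : swap u j b b = u j by rewrite swapR.
all: have oth y : y <> j -> y <> b -> swap u j b y = u y by move=> *; rewrite swapD.
all: case: (boolP ((u j < u c)%N && (u c < u b)%N)) => [/andP[h1 h2]|h].
(* if the group jumps over the value of c, then b blocks the way back to c *)
1,3: exfalso; apply: (@blocked_false _ g (swap u j b) b [::] Bn j c W _ _ gBn _ mlgB) => //;
       rewrite ?jL //; [|by apply: gB; rewrite mem_head|by left; rewrite uc uj].
1,2: split; rewrite ?uc ?uj ?ub; [by have := H c; slia|slia| |slia|slia].
1,2: by move=> y yI; rewrite oth; [have := H y; slia|slia|slia].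
all: have bx : b <> x by move=> e'; subst b; have [] := K2 x xr; slia.
all: apply/andP; split; first by apply/eqP => e'; apply: bx.
all: apply: (IHg (swap u j b) Bn j W L) => // [m mI|y yr].
1,3: by rewrite uc; case: (m =P j) => [->|mj];
       [rewrite uj; slia|rewrite oth; [apply: K1|slia|slia]].
all: have [k1 k2 k3] := K2 y yr; rewrite uc oth //; first by slia.
all: by move=> e'; subst y; slia.
Qed.

(** Here [l], in the role of [c], lies between the left and the right positions,
    and every cover jumps over it: no cover can pass its value at all. *)
Lemma noncross_mid g (u : Sinf) f (rho : seq nat) i l :
  (forall m, (i < m < l)%N -> (u m < u l)%N || (f < u m)%N) ->
  (forall x, x \in rho -> [/\ (u l < u x)%N, (u x < f)%N & (l < x)%N]) ->
  (forall e, e \in g -> (i < e.1 < l)%N /\ (l < e.2)%N) ->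
  kch u g -> forall e, e \in g -> e.2 \notin rho.
Proof.
elim: g u => //= -[j b] g IH u K1 K2 hg /andP[/= cv kg] e.
have /covP[jb ujb H] := cv.
have /= [jI bI] := hg _ (mem_head _ _).
have Kj := K1 j jI; have Hl := H l; have nl : u b <> u l by apply: Sinf_neq; slia.
have br : b \notin rho by apply/negP => /K2[]; slia.
rewrite inE => /orP[/eqP->//|]; apply: IH kg _ => [m mI|x xr|e' eg].
- rewrite (@swapD _ _ _ l); [|slia..].
  case: (m =P j) => [->|mj]; first by rewrite swapL; slia.
  by rewrite swapD; [apply: K1|slia|slia].
- have [k1 k2 k3] := K2 x xr; rewrite !swapD //; try slia.
  by move=> e2; rewrite -e2 xr in br.
- by apply: hg; rewrite inE eg orbT.
Qed.

(** If the group of [i] goes up from [b] to [c], then [b] holds the value just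
    below that of [c] and obstructs the return to [c]. *)
Lemma ascent_then_return_false (u : Sinf) i g0 b c (rho : seq nat) M W (Bn : seq nat) : (b < c)%N ->
  {subset [:: b, c & rho] <= Bn} -> feasible_groups Bn M ->
  all (fun x => i + size M < x)%N ([:: b, c & rho] ++ flatten M) ->
  flatten M = rcons W c -> c \notin W ->
  kch u (grp i (g0 ++ [:: b, c & rho]) ++ pairs i.+1 M) -> False.
Proof.
move=> bc sB mlgM allW e cW; rewrite /grp map_cat -catA kch_cat => /andP[_].
move: (kend u _) => {}u /= /andP[cv1 /andP[cv2 kg]].
have crho : c \notin rho.
  move: kg; rewrite kch_cat => /andP[kg _].
  have : uniq (c :: rho); last by case/andP.
  apply: (@kch_grp_uniq (swap u i b) i); first by rewrite /= cv2.
  move=> x; rewrite inE => /orP[xr|xr]; have /allP/(_ x) := allW;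
    by rewrite /= !inE mem_cat xr ?orbT => /(_ isT); slia.
have /covP[ib uib H1] := cv1; have /covP[ic uic H2] := cv2.
move: uic; rewrite swapL swapD; [|slia..]; move=> uic.
set w := swap (swap u i b) i c in kg.
have wb : w b = u i by rewrite /w swapD ?swapR //; slia.
have wc : w c = u b by rewrite /w swapR swapL.
have wi : w i = u c by rewrite /w swapL swapD //; slia.
have oth y : y <> i -> y <> b -> y <> c -> w y = u y by move=> *; rewrite /w !swapD.
clearbody w.
move: allW; rewrite all_cat => /andP[/= /and3P[sb sc srho] sM].
apply: (@blocked_false M rho w b [::] Bn i c (rho ++ W)) => //.
- split; rewrite ?wb ?wc ?wi; [slia|slia| |slia|slia].
  move=> y yI; rewrite oth; [|slia..].
  exact: H1.
- by apply: sB; rewrite mem_head.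
- by move=> x xr; apply: sB; rewrite !inE xr !orbT.
- by left; rewrite wi wc.
- by rewrite all_cat srho.
- by rewrite e rcons_cat.
- by rewrite mem_cat negb_or crho.
Qed.

(** The elements [rho] that follow [c] in the group of [i] take values between
    those of [c] and [i]; [noncross] keeps the later groups away from them until
    [c] is used again. *)
Lemma later_avoids_group (u : Sinf) i g0 c rho M W Bn x :
  feasible_groups Bn M ->
  all (fun x => i + size M < x)%N ((c :: rho) ++ flatten M) ->
  flatten M = rcons W c -> c \notin W ->
  kch u (grp i (g0 ++ c :: rho) ++ pairs i.+1 M) -> x \in rho -> x \notin W.
Proof.
move=> mlgM allW e cW; rewrite /grp map_cat -catA kch_cat => /andP[_].
move: (kend u _) => {}u /= /andP[cv kg] xr.
have allc : all (fun x => i < x)%N (c :: rho).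
  by apply/allP => y yr; have /allP/(_ y) := allW; rewrite mem_cat yr => /(_ isT); slia.
move: kg; rewrite kch_cat -/(grp i rho) => /andP[kr kM].
have /= /andP[crho urho] : uniq (c :: rho).
  by apply: (@kch_grp_uniq u i); [rewrite /= cv | apply/allP].
move: allc => /= /andP[ic allr].
have /covP[_ uic H] := cv.
set w := swap u i c in kr kM.
have wc : w c = u i by rewrite /w swapR.
have wi : w i = u c by rewrite /w swapL.
have oth y : y <> i -> y <> c -> w y = u y by move=> *; rewrite /w swapD.
clearbody w.
have btw y : y \in rho -> (w i <= kend w (grp i rho) y < kend w (grp i rho) i)%N by apply: grp_between.
have fx y : y <> i -> y \notin rho -> kend w (grp i rho) y = w y by apply: kend_grp_fix.
have sd m : (i < m)%N -> all (fun x => m < x)%N rho ->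
  (kend w (grp i rho) m < kend w (grp i rho) i)%N = (w m < w i)%N by move=> im am; apply: grp_side.
move: (kend w (grp i rho)) kM btw fx sd => w' kM btw fx sd.
have wc' : w' c = u i by rewrite fx //; slia.
case: M e mlgM allW kM => [|g M] e mlgM allW kM; first by case: W e {cW}.
have ss : (i + size (g :: M) = i.+1 + size M)%N by rewrite /= addnS.
move: allW; rewrite ss /= all_cat => /and3P[sc srho sM].
apply: (@noncross M g w' (w' i) rho (g ++ Bn) i.+1 c W _ erefl) => //.
- move=> m mI; rewrite wc'.
  have am : all (fun x => m < x)%N rho by apply: sub_all srho => y; slia.
  have mr : m \notin rho by apply/negP => /(allP am); rewrite ltnn.
  have im : (i < m)%N by slia.
  have mi : m <> i by slia.
  have wm : w m = u m by rewrite oth //; slia.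
  have wm' : w' m = u m by rewrite fx.
  have := sd m im am; rewrite wm' wm wi.
  have := H m; have := @Sinf_neq w' m i mi; rewrite wm'.
  by move: mI sc im; clear; slia.
- move=> y yr; have := btw y yr; have := allP srho _ yr => /=.
  by rewrite wc' wi; move: uic; clear; split; slia.
- by move=> y yg; rewrite mem_cat yg.
- by case/andP: mlgM.
Qed.

Lemma mid_avoids_group (u : Sinf) i l g0 rho g : (i < l)%N -> all (fun x => l < x)%N rho ->
  (forall e, e \in g -> (i < e.1 < l)%N /\ (l < e.2)%N) ->
  kch u (grp i (g0 ++ l :: rho) ++ g) -> forall e, e \in g -> e.2 \notin rho.
Proof.
move=> il allr hg; rewrite /grp map_cat -catA kch_cat => /andP[_].
move: (kend u _) => {}u /= /andP[cv kg].
move: kg; rewrite kch_cat -/(grp i rho) => /andP[kr kM].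
have allc : all (fun x => i < x)%N (l :: rho).
  by rewrite /= il; apply: sub_all allr => y; slia.
have /= /andP[crho urho] : uniq (l :: rho).
  by apply: (@kch_grp_uniq u i); [rewrite /= cv | apply/allP].
have /covP[_ uic H] := cv.
set w := swap u i l in kr kM.
have wc : w l = u i by rewrite /w swapR.
have wi : w i = u l by rewrite /w swapL.
have oth y : y <> i -> y <> l -> w y = u y by move=> *; rewrite /w swapD.
clearbody w.
have allr' : all (fun x => i < x)%N rho by case/andP: allc.
have btw y : y \in rho -> (w i <= kend w (grp i rho) y < kend w (grp i rho) i)%N by apply: grp_between.
have fx y : y <> i -> y \notin rho -> kend w (grp i rho) y = w y by apply: kend_grp_fix.
have sd m : (i < m)%N -> all (fun x => m < x)%N rho ->
  (kend w (grp i rho) m < kend w (grp i rho) i)%N = (w m < w i)%N by move=> im am; apply: grp_side.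
move: (kend w (grp i rho)) kM btw fx sd => w' kM btw fx sd.
have wc' : w' l = u i by rewrite fx //; slia.
apply: (@noncross_mid g w' (w' i) rho i l) => // [m mI|y yr].
  rewrite wc'.
  have am : all (fun x => m < x)%N rho by apply: sub_all allr => y; slia.
  have mr : m \notin rho by apply/negP => /(allP am); rewrite ltnn.
  have im : (i < m)%N by slia.
  have mi : m <> i by slia.
  have wm : w m = u m by rewrite oth //; slia.
  have wm' : w' m = u m by rewrite fx.
  have := sd m im am; rewrite wm' wm wi.
  have := H m; have := @Sinf_neq w' m i mi; rewrite wm'.
  by move: mI im; clear; slia.
have := btw y yr; have := allP allr _ yr => /=.
by rewrite wc' wi; move: uic; clear; split; slia.
Qed.

(** * Sums over words *)

Section Words.
Variable S : seq nat.

Fixpoint words (n : nat) : seq (seq nat) :=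
  if n is m.+1 then [::] :: [seq x :: w | x <- S, w <- words m] else [:: [::]].

Lemma mem_words n w : (w \in words n) = (size w <= n)%N && all (mem S) w.
Proof.
elim: n w => [|n IH] w; first by rewrite inE; case: w.
rewrite inE; case: w => // x w; rewrite /= ltnS.
apply/allpairsP/idP => [[[y z] /= [yS zw [-> ->]]]|/and3P[wn xS wS]].
  by move: zw; rewrite IH yS => /andP[-> ->].
by exists (x, w); split; rewrite //= IH wn.
Qed.

Definition U := [seq w <- words (size S) | uniq w].

Lemma mem_U w : (w \in U) = uniq w && all (mem S) w.
Proof.
rewrite mem_filter mem_words; case: (boolP (uniq w)) => //= uw.
case: (boolP (all _ _)) => [/allP wS|]; rewrite ?andbF // andbT.
exact: uniq_leq_size.
Qed.

Hypothesis uS : uniq S.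

Lemma words_uniq n : uniq (words n).
Proof.
elim: n => //= n IH; apply/andP; split; first by apply/negP => /allpairsP[[x w] /= [_ _]].
by apply: allpairs_uniq => // -[x w] [y z] _ _ [-> ->].
Qed.

Lemma U_uniq : uniq U.
Proof. exact/filter_uniq/words_uniq. Qed.

(** A word and one of its positions amount to a factorization with a middle letter. *)
Lemma sum_split3 (R : nmodType) (F : seq nat -> nat -> seq nat -> R) :
  \sum_(w <- U) \sum_(r <- iota 0 (size w)) F (take r w) (nth 0%N w r) (drop r.+1 w) =
  \sum_(a <- U) \sum_(c <- S) \sum_(b <- U | uniq (a ++ c :: b)) F a c b.
Proof.
pose G (p : seq nat * nat * seq nat) := F p.1.1 p.1.2 p.2.
pose L1 := [seq (take r w, nth 0%N w r, drop r.+1 w) | w <- U, r <- iota 0 (size w)].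
pose L2 := [seq (x, b) | x <- [seq (a, c) | a <- U, c <- S], b <- U].
pose P (p : seq nat * nat * seq nat) := uniq (p.1.1 ++ p.1.2 :: p.2).
transitivity (\sum_(p <- L1) G p); first by rewrite big_allpairs_dep.
transitivity (\sum_(p <- L2 | P p) G p); last first.
  rewrite big_mkcond big_allpairs_dep big_allpairs_dep /=.
  by apply: eq_bigr => a _; apply: eq_bigr => c _; rewrite [RHS]big_mkcond.
rewrite -[RHS]big_filter; apply: perm_big; apply: uniq_perm.
- apply: allpairs_uniq_dep => [|w _|]; [exact: U_uniq|exact: iota_uniq|].
  move=> [w r] [w' r'] /= /allpairsPdep [x [y [xU yr [e1 e2]]]] /allpairsPdep [x' [y' [xU' yr' [e1' e2']]]].
  subst x y x' y'; move: yr yr'; rewrite !mem_iota !add0n => /= rw rw' [e1 e2 e3].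
  have er : r = r' by have := congr1 size e1; rewrite !size_take rw rw'.
  subst r'; congr existT; rewrite -(cat_take_drop r w) -(cat_take_drop r w') e1.
  by rewrite (drop_nth 0%N rw) (drop_nth 0%N rw') e2 e3.
- apply: filter_uniq; apply: allpairs_uniq; [|exact: U_uniq|by move=> [? ?] [? ?] _ _ [-> ->]].
  by apply: allpairs_uniq; [exact: U_uniq|exact: uS|by move=> [? ?] [? ?] _ _ [-> ->]].
move=> [[a c] b]; rewrite mem_filter /P /=.
apply/allpairsPdep/andP => [[w [r [wU]]]|[uab]].
  rewrite mem_iota add0n => /= rw [-> -> ->].
  rewrite -drop_nth // cat_take_drop.
  move: (wU); rewrite mem_U => /andP[uw wS]; split=> //.
  apply/allpairsP; exists ((take r w, nth 0%N w r), drop r.+1 w); split=> //=.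
    apply/allpairsP; exists (take r w, nth 0%N w r); split=> //=.
      rewrite mem_U take_uniq //=; apply/allP => x /mem_take; exact: (allP wS).
    by apply: (allP wS); apply: mem_nth.
  rewrite mem_U drop_uniq //=; apply/allP => x /mem_drop; exact: (allP wS).
move=> /allpairsP [[[a' c'] b'] /= [/allpairsP[[a'' c''] /= [aU cS [e1 e2]]] bU [e3 e4 e5]]].
subst; exists (a'' ++ c'' :: b'), (size a''); split.
- move: aU bU; rewrite !mem_U uab all_cat /= => /andP[_ ->] /andP[_ ->].
  by rewrite andbT.
- by rewrite mem_iota size_cat /=; lia.
- rewrite take_size_cat // nth_cat ltnn subnn /=.
  by rewrite drop_cat ltnNge leqnSn /= subSnn /= ?drop0.
Qed.

Lemma sum_rcons (R : nmodType) (F : seq nat -> R) :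
  \sum_(w <- U | w != [::]) F w = \sum_(a <- U) \sum_(c <- S | uniq (rcons a c)) F (rcons a c).
Proof.
pose L2 := [seq rcons a c | a <- U, c <- S].
transitivity (\sum_(p <- L2 | uniq p) F p); last first.
  rewrite big_mkcond big_allpairs_dep /=.
  by apply: eq_bigr => a _; rewrite [RHS]big_mkcond.
rewrite -[LHS]big_filter -[RHS]big_filter; apply: perm_big; apply: uniq_perm.
- exact/filter_uniq/U_uniq.
- apply: filter_uniq; apply: allpairs_uniq; [exact: U_uniq|exact: uS|].
  by move=> [a c] [a' c'] _ _ /rcons_inj [-> ->].
move=> w; rewrite [LHS]mem_filter [RHS]mem_filter mem_U; case: (lastP w) => [|a c] /=.
  by apply/esym/negP => /allpairsP[[[|x a] c] /= [_ _]].
have -> : rcons a c != [::] by case: (a).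
case: (boolP (uniq _)) => //= uac.
apply/idP/allpairsP => [h|[[a' c'] /= [aU cS /rcons_inj [-> ->]]]].
  move: h uac; rewrite all_rcons rcons_uniq => /andP[cS aS] /andP[_ ua].
  by exists (a, c); split=> //=; rewrite mem_U ua.
by move: aU; rewrite mem_U all_rcons => /andP[_ ->]; rewrite andbT.
Qed.

End Words.

Section WordOps.
Variables (R : comNzRingType) (t : R).
Implicit Types (phi : Sinf -> R) (v : Sinf).

Definition opw (g : seq (nat * nat)) phi : Sinf -> R :=
  foldr (fun e f => T e.1 e.2 f) phi g.

Lemma opw_cat g1 g2 phi : opw (g1 ++ g2) phi = opw g1 (opw g2 phi).
Proof. exact: foldr_cat. Qed.

Lemma opwE g phi v : opw g phi v = if kch v g then phi (kend v g) else 0.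
Proof. by elim: g v => //= e g IH v; rewrite /T IH; case: cov. Qed.

Lemma opw_nkch g phi v : ~~ kch v g -> opw g phi v = 0.
Proof. by rewrite opwE => /negPf ->. Qed.

Lemma opw_comm1 g a b phi : (forall e, e \in g -> uniq [:: a; b; e.1; e.2]) ->
  opw g (T a b phi) = T a b (opw g phi).
Proof.
elim: g => //= e g IH h; rewrite IH; last by move=> f fg; apply: h; rewrite inE fg orbT.
by apply/esym/T_commE/h/mem_head.
Qed.

Lemma opw_comm g i r phi :
  (forall e x, e \in g -> x \in r -> uniq [:: i; x; e.1; e.2]) ->
  opw (g ++ grp i r) phi = opw (grp i r ++ g) phi.
Proof.
rewrite !opw_cat; elim: r => //= x r IH h.
rewrite opw_comm1 ?IH // => [e y eg yr|e eg]; first by apply: h; rewrite // inE yr orbT.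
by apply: h; rewrite // mem_head.
Qed.

Lemma opw_ext g phi psi : phi =1 psi -> opw g phi =1 opw g psi.
Proof. by move=> E v; rewrite !opwE; case: kch. Qed.

Lemma opwD g phi psi v : opw g (fun w => phi w + psi w) v = opw g phi v + opw g psi v.
Proof. by rewrite !opwE; case: kch; rewrite ?addr0. Qed.

Lemma opwB g phi psi v : opw g (fun w => phi w - psi w) v = opw g phi v - opw g psi v.
Proof. by rewrite !opwE; case: kch; rewrite ?subr0. Qed.

Lemma opwZ g a phi v : opw g (fun w => a * phi w) v = a * opw g phi v.
Proof. by rewrite !opwE; case: kch; rewrite ?mulr0. Qed.

Lemma opw_sum (I : Type) (s : seq I) (P : pred I) (F : I -> Sinf -> R) g v :
  opw g (fun w => \sum_(x <- s | P x) F x w) v = \sum_(x <- s | P x) opw g (F x) v.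
Proof.
by rewrite opwE; case: ifP => k; [|rewrite big1 //]; [apply: eq_bigr|]; move=> x _; rewrite opwE k.
Qed.

Lemma opw_rcons i w x phi : opw (grp i (rcons w x)) phi = opw (grp i w) (T i x phi).
Proof. by rewrite -cats1 /grp map_cat opw_cat. Qed.

(** Moving T_(i,l) to the left through T_(l,w): by the three-term relation it
    either passes a letter T_(l,x), which becomes T_(i,x), or stops there, the
    letter being kept, and turns into T_(i,x) itself. The letters after the
    stopping point end up in the group of [i]. *)
Lemma opw_push i l w phi v : uniq w -> (i < l)%N -> all (fun x => l < x)%N w ->
  opw (grp l w ++ [:: (i, l)]) phi v = opw ((i, l) :: grp i w) phi v +
   \sum_(r <- iota 0 (size w)) opw (grp i (drop r w) ++ grp l (take r.+1 w)) phi v.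
Proof.
move=> + il; elim/last_ind: w phi v => [|w x IH] phi v; first by rewrite /= big_nil addr0.
rewrite rcons_uniq all_rcons => /andP[xw uw] /andP[lx lw].
rewrite size_rcons -addn1 iotaD big_cat big_seq1 add0n /=.
rewrite opw_cat opw_rcons.
have -> : T l x (opw [:: (i, l)] phi) = fun u => T i l (T i x phi) u + T i x (T l x phi) u.
  apply: functional_extensionality => u.
  by rewrite /= T3b 1?addrC ?il // [RHS]addrC.
have E : opw (grp l w) (T i l (T i x phi)) v = opw (grp l w ++ [:: (i, l)]) (T i x phi) v.
  by rewrite opw_cat.
rewrite (opwD (grp l w)) E IH // -addrA; congr (_ + _).
  by rewrite -[RHS]/(T i l (opw (grp i (rcons w x)) phi) v) opw_rcons.
have comm (s : seq nat) psi : {subset s <= w} ->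
    opw (grp l s) (T i x psi) = T i x (opw (grp l s) psi).
  move=> sw; apply: opw_comm1 => e /mapP[y ys ->] /=.
  have yx : y != x by apply: contraNneq xw => <-; apply: sw.
  by have := allP lw y (sw _ ys); rewrite /= !inE; lia.
congr (_ + _); last first.
  rewrite drop_rcons // drop_size take_oversize ?size_rcons // comm //.
  by rewrite -[RHS]/(T i x (opw (grp l (rcons w x)) phi) v) opw_rcons.
rewrite [LHS]big_seq [RHS]big_seq; apply: eq_bigr => r; rewrite mem_iota add0n => /= rw.
rewrite drop_rcons; last exact: ltnW.
have -> : take r.+1 (rcons w x) = take r.+1 w by rewrite -cats1 takel_cat.
rewrite opw_cat comm; last by move=> y /mem_take.
by rewrite [in RHS]opw_cat opw_rcons.
Qed.

(** The contribution of a mark: a right position that has been used by an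
    earlier group must not be marked. *)
Definition h (B : seq nat) x : R := if x \in B then 0 else t.

(** The weight of the word of a group, when [B] has been used by the earlier
    groups: each letter contributes [h], for a mark, and -1, for no mark, if
    [chain_P3] allows it. The contribution [lam] of the last letter is left free. *)
Fixpoint ww (lam : nat -> R) (B : seq nat) (g : seq nat) : R :=
  if g is x :: g' then
    (if g' is y :: _ then h B x - (y < x)%N%:R else lam x) * ww lam B g'
  else 1.

(** The last cover of a group may always be left unmarked, since the left
    position then increases. *)
Definition gw B g := ww (fun x => h B x - 1) B g.

(** The factors of a word [g] that is followed by the letter [c], without that of [c]. *)
Fixpoint wpre B g c : R :=
  if g is x :: g' then (h B x - (head c g' < x)%N%:R) * wpre B g' c else 1.

Fixpoint mwt B (M : seq (seq nat)) : R :=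
  if M is g :: M' then gw B g * mwt (g ++ B) M' else 1.

Lemma ww_cat lam B a c b : ww lam B (a ++ c :: b) = wpre B a c * ww lam B (c :: b).
Proof.
elim: a => [|x a IH]; first by rewrite mul1r.
rewrite cat_cons -[LHS]/(_ * ww lam B (a ++ c :: b)) IH /= -mulrA.
by case: a {IH}.
Qed.

Lemma ww_rcons lam B a c : ww lam B (rcons a c) = wpre B a c * lam c.
Proof. by rewrite -cats1 ww_cat /= mulr1. Qed.

Lemma ww_ext lam lam' B B' g : (forall x, x \in g -> (x \in B) = (x \in B')) ->
  (forall x, x \in g -> lam x = lam' x) -> ww lam B g = ww lam' B' g.
Proof.
elim: g => //= x g IH hB hl; rewrite IH; [|by move=> y yg; apply: hB; rewrite inE yg orbT|
  by move=> y yg; apply: hl; rewrite inE yg orbT].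
by rewrite /h hB ?hl ?mem_head.
Qed.

Lemma gw_ext B B' g : (forall x, x \in g -> (x \in B) = (x \in B')) -> gw B g = gw B' g.
Proof. by move=> hB; apply: ww_ext => // x xg; rewrite /h hB. Qed.

Lemma wpre_ext B B' g c : (forall x, x \in g -> (x \in B) = (x \in B')) ->
  wpre B g c = wpre B' g c.
Proof.
elim: g => //= x g IH hB; rewrite IH; last by move=> y yg; apply: hB; rewrite inE yg orbT.
by rewrite /h hB ?mem_head.
Qed.

Lemma mwt_ext B B' M : (forall x, x \in flatten M -> (x \in B) = (x \in B')) ->
  mwt B M = mwt B' M.
Proof.
elim: M B B' => //= g M IH B B' hB; rewrite (@gw_ext B B'); last first.
  by move=> x xg; apply: hB; rewrite mem_cat xg.
by congr (_ * _); apply: IH => x xM; rewrite !mem_cat hB // mem_cat xM orbT.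
Qed.

(** A letter that can be neither marked nor unmarked contributes 0. *)
Lemma ww_infeasible lam B g : ~~ feasible B g -> ww lam B g = 0.
Proof.
elim: g => //= x g IH; rewrite negb_and => /orP[|/IH ->]; last by rewrite mulr0.
case: g {IH} => // y g; rewrite negbK => /andP[xB xy].
by rewrite /h xB ltnNge (ltnW xy) /= subrr mul0r.
Qed.

Lemma wpre_infeasible B g c : ~~ feasible B (rcons g c) -> wpre B g c = 0.
Proof. by move=> H; have := @ww_infeasible (fun=> 1) B _ H; rewrite ww_rcons mulr1. Qed.

Lemma mwt_infeasible B M : ~~ feasible_groups B M -> mwt B M = 0.
Proof.
elim: M B => //= g M IH B; rewrite negb_and => /orP[H|/IH ->]; last by rewrite mulr0.
by rewrite /gw ww_infeasible ?mul0r.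
Qed.

Lemma gw_cat B a c b : gw B (a ++ c :: b) = wpre B a c * gw B (c :: b).
Proof. exact: ww_cat. Qed.

(** Before a smaller letter as at the end of the word, the last letter of [a] may be
    left unmarked. *)
Lemma gw_wpre B a c : (c < last c.+1 a)%N -> wpre B a c = gw B a.
Proof.
elim: a => // x [|y a] IH H; first by rewrite /gw /= (_ : (c < x)%N = true).
exact: congr2 _ (IH H).
Qed.

End WordOps.

(** * The core identity *)

Lemma exsplit (F z : seq nat) d : has (mem F) z -> last d z \notin F ->
  exists z1 x e z2, [/\ z = z1 ++ [:: x, e & z2], x \in F & e \notin F].
Proof.
elim: z d => //= x z IH d; case: (boolP (x \in F)) => /= xF.
  case: z IH => [|e z] IH; first by rewrite /= xF.
  move=> _ lz; case: (boolP (e \in F)) => eF; last by exists [::], x, e, z.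
  have [|//|z1 [x' [e' [z2 [-> h1 h2]]]]] := IH x; first by rewrite /= eF.
  by exists (x :: z1), x', e', z2.
move=> hz lz; have [z1 [x' [e' [z2 [-> h1 h2]]]]] := IH _ hz lz.
by exists (x :: z1), x', e', z2.
Qed.

Lemma exsplit_last (g : seq (nat * nat)) x : x \in map snd g ->
  exists g1 m g2, g = g1 ++ (m, x) :: g2 /\ x \notin map snd g2.
Proof.
elim: g => //= -[a b] g IH; case: (boolP (x \in map snd g)) => xg.
  by move=> _; have [g1 [m [g2 [-> h]]]] := IH xg; exists ((a, b) :: g1), m, g2.
rewrite inE (negPf xg) orbF => /eqP /= e; subst b.
by exists [::], a, g.
Qed.

Lemma feasible_sub B1 B2 g : {subset B1 <= B2} -> feasible B2 g -> feasible B1 g.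
Proof.
move=> s; elim: g => //= x g IH /andP[h /IH ->]; rewrite andbT.
case: g h {IH} => // y g; apply: contra => /andP[xB ->]; rewrite andbT; exact: s.
Qed.

Lemma feasible_catr B g1 g2 : feasible B (g1 ++ g2) -> feasible B g2.
Proof. by elim: g1 => //= x g1 IH /andP[_ /IH]. Qed.

Lemma feasible_groups_rcons B M g : feasible_groups B (rcons M g) = feasible_groups B M && feasible (flatten M ++ B) g.
Proof.
elim: M B => [|g' M IH] B; rewrite /= ?andbT // IH -andbA.
congr (_ && (_ && _)); apply/idP/idP; apply: feasible_sub => x; rewrite !mem_cat.
  by case: (x \in g'); rewrite ?orbT.
by case: (x \in g'); rewrite ?orbT.
Qed.

(** A feasible word of the group of [i] which reuses a letter of the groups
    between, but ends with a new one, somewhere descends from a used letter to a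
    new one; the case treated above. *)
Lemma reuse_then_new_nonchain (v : Sinf) i mu g0 z : let l := (i.+1 + size mu)%N in
  uniq z -> all (fun x => l < x)%N (behead z) -> has (mem (flatten mu)) z ->
  last 0%N z \notin flatten mu -> feasible (flatten mu) z ->
  ~~ kch v (g0 ++ pairs i.+1 mu ++ grp i z).
Proof.
move=> l uz bz hz lz lgz; apply/negP.
rewrite kch_cat => /andP[_]; move: (kend v g0) => u.
have [z1 [x [e [z2 [ez xF eF]]]]] := exsplit hz lz.
have ex : (e < x)%N.
  move: lgz; rewrite ez => /feasible_catr /= /andP[+ _]; rewrite xF /= -leqNgt leq_eqVlt.
  case/orP => // /eqP e2; move: uz; rewrite ez cat_uniq /= inE e2 eqxx /=.
  by rewrite !andbF.
have le : (l < e)%N.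
  apply: (allP bz); rewrite ez; case: (z1) => [|y z1'] /=; first by rewrite inE eqxx.
  by rewrite mem_cat !inE eqxx !orbT.
have xp : x \in map snd (pairs i.+1 mu) by rewrite flatten_pairs.
have [g1 [m [g2 [ep xg2]]]] := exsplit_last xp.
have pI f : f \in pairs i.+1 mu -> (i < f.1 < l)%N /\ f.2 \in flatten mu.
  by case: f => a b /mem_pairs.
rewrite ez ep /grp map_cat /=.
rewrite -catA cat_cons => k.
apply: (@reuse_then_new_false i x e _ ex u g1 m g2 z1).
- by rewrite /l in le; slia.
- move: k; rewrite -[(i, x) :: _]cat1s -[(i, e) :: _]cat1s.
  have -> : g1 ++ (m, x) :: g2 ++ [seq (i, b) | b <- z1] ++ [:: (i, x)] ++ [:: (i, e)] ++ [seq (i, b) | b <- z2] =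
    (g1 ++ (m, x) :: g2 ++ grp i z1 ++ [:: (i, x); (i, e)]) ++ [seq (i, b) | b <- z2].
    by rewrite -!catA /= -!catA.
  by rewrite [X in is_true X -> _]kch_cat => /andP[].
- have [] := pI (m, x); first by rewrite ep mem_cat inE eqxx orbT.
  by move=> /= ? _; slia.
- move=> f fg; have [|h1 h2] := pI f; first by rewrite ep mem_cat inE fg !orbT.
  split; [by slia| |].
    by move=> e2; move: xg2; rewrite -e2 map_f.
  by move=> e2; move: eF; rewrite -e2 h2.
- by move: uz; rewrite ez cat_uniq /= => /and3P[_ /norP[]].
- by move: uz; rewrite ez cat_uniq /= => /and3P[_ /norP[_ /norP[]]].
Qed.

(** The terms with given groups [mu] at the positions between [i] and [l]. When
    T_(i,l) is moved to the left through the group of [l], two kinds of terms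
    arise: those where it arrives in front of the word, and those where it stops
    at a letter [c]. The former combine with the group of [i] into words that
    contain [l] ([core_term_pushed]); the latter cancel against the terms with
    weight [wK], where [c] belongs to the group of [i] ([core_term_cut]). In both
    cases the bijection between the terms is the obvious one, and the terms
    where it would not preserve the weights vanish by the results on chains. *)
Section Core.
Variables (R : comNzRingType) (t : R) (psi : Sinf -> R) (v : Sinf).
Variables (S : seq nat) (i n : nat).
Let l := (i.+1 + n)%N.
Hypotheses (uS : uniq S) (lS : all (fun x => l < x)%N S).

Local Notation op g := (opw g psi v).
Local Notation hh := (h t).
Local Notation U := (U S).

(** The two weights of the group of [l] in the identity: the last letter is new
    with respect to the groups in between for [wL], and it was used by the group
    of [i], but not in between, for [wK]. *)
Definition wL (F B : seq nat) w := ww t (fun c => if c \in F then 0 else hh B c - 1) B w.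
Definition wK (g F B : seq nat) w : R :=
  if w is [::] then 0 else ww t (fun c => ((c \in g) && (c \notin F))%:R) B w.

Variables (B : seq nat) (mu : seq (seq nat)).
Hypotheses (smu : size mu = n) (muS : {subset flatten mu <= S}).
Let F := flatten mu.

Let il : (i < l)%N. Proof. by rewrite /l; slia. Qed.

Let pI f : f \in pairs i.+1 mu -> (i < f.1 < l)%N /\ f.2 \in F.
Proof. by case: f => a b /mem_pairs; rewrite smu. Qed.

Let Sl x : x \in S -> (l < x)%N. Proof. exact: (allP lS). Qed.

Lemma ww_last0 lam B' x w : lam (last x w) = 0 -> ww t lam B' (x :: w) = 0.
Proof.
elim: w x => [|y w IH] x /= e; first by rewrite e mul0r.
by have := IH y e; rewrite /= => ->; rewrite mulr0.
Qed.

Lemma wL_neq0 B' w : {subset F <= B'} -> wL F B' w != 0 -> w != [::] ->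
  last 0%N w \notin F /\ feasible F w.
Proof.
move=> FB w0 wn; split.
  case: w w0 wn => // x w w0 _; apply: contra w0 => /= h; apply/eqP.
  by apply: ww_last0; rewrite h.
apply: (feasible_sub FB); apply: contraR w0 => h; apply/eqP; exact: ww_infeasible.
Qed.

(** Groups without common letters commute. *)
Lemma op_comm g0 r g1 : {subset r <= l :: S} -> ~~ has (mem F) r ->
  op (g0 ++ pairs i.+1 mu ++ grp i r ++ g1) = op (g0 ++ grp i r ++ pairs i.+1 mu ++ g1).
Proof.
move=> rS nF; rewrite !opw_cat; congr (opw g0 _ v).
move: (opw g1 psi) => X; rewrite -!opw_cat; apply: opw_comm => -[a b] x eg xr; have /= [aI bF] := pI eg.
have xF : x \notin F by apply: contra nF => xF; apply/hasP; exists x.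
have bl := Sl (muS bF).
have xl : (l <= x)%N by have := rS x xr; rewrite inE => /orP[/eqP->//|/Sl/ltnW].
have xb : x != b by apply: contraNneq xF => ->.
by rewrite /= !inE; move: il aI bl xl xb; clear; slia.
Qed.

Lemma core_term_pushed g w : g \in U -> w \in U ->
  gw t B g * mwt t (g ++ B) mu * wL F (F ++ g ++ B) w *
    op (grp i g ++ pairs i.+1 mu ++ (i, l) :: grp i w) =
  (uniq (g ++ w))%:R * gw t B g * gw t B w * mwt t (g ++ w ++ B) mu *
    op (grp i (g ++ l :: w) ++ pairs i.+1 mu).
Proof.
rewrite !mem_U => /andP[ug gS] /andP[uw wS].
have wSl : all (fun x => l < x)%N w by apply/allP => x /(allP wS) /Sl.
case: (boolP (uniq (g ++ w))) => [ugw|]; last first.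
  rewrite cat_uniq ug uw /= andbT negbK => /hasP[x xw xg].
  rewrite opw_nkch ?mulr0 ?mul0r //; apply/negP => k.
  have [g1 [m [g2 [eg _]]]] : exists g1 m g2, grp i g = g1 ++ (m, x) :: g2 /\ x \notin map snd g2.
    by apply: exsplit_last; rewrite -map_comp map_id.
  have mi : m = i.
    have : (m, x) \in grp i g by rewrite eg mem_cat mem_head orbT.
    by case/mapP => y _ [].
  subst m; move: k; rewrite eg -catA kch_cat => /andP[_ /= /andP[cv k]].
  have xl := allP wSl x xw.
  suff : (i, x) \notin g2 ++ pairs i.+1 mu ++ (i, l) :: grp i w.
    by rewrite !mem_cat inE [(i, x) \in grp i w]map_f ?orbT.
  have /covP[_ uix _] := cv.
  apply: rep_pair k => [[a b]|]; last by rewrite swapR swapL.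
  rewrite !mem_cat inE => /or4P[bg|/pI[/= aI bF]|/eqP[-> ->]|/mapP[y yw [-> ->]]] /=.
  - have : (a, b) \in grp i g by rewrite eg mem_cat inE bg !orbT.
    by case/mapP => y /(allP gS) /Sl yl [-> ->]; move: yl il xl; clear; split; slia.
  - by have bl := Sl (muS bF); move: bl aI il xl; clear; split; slia.
  - by move: il xl; clear; split; slia.
  - by have yl := allP wSl y yw; move: yl il xl; clear; split; slia.
case: (boolP (has (mem F) w)) => hF.
  have wn : w != [::] by case: (w) hF.
  rewrite [in RHS]opw_nkch; last first.
    apply/negP => k; have /hasP[x xw xF] := hF.
    have /mapP[e ep xe] : x \in map snd (pairs i.+1 mu) by rewrite flatten_pairs.
    have hg f : f \in pairs i.+1 mu -> (i < f.1 < l)%N /\ (l < f.2)%N.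
      by move=> /pI[aI /muS /Sl bl].
    by have := mid_avoids_group il wSl hg k ep; rewrite -xe xw.
  rewrite mulr0; case: (eqVneq (wL F (F ++ g ++ B) w) 0) => [->|w0]; first by rewrite mulr0 mul0r.
  have [|lF lgF] := wL_neq0 _ w0 wn; first by move=> x xF; rewrite mem_cat xF.
  rewrite opw_nkch ?mulr0 //; have := @reuse_then_new_nonchain v i mu (grp i g) (l :: w); rewrite /= smu; apply=> //.
  - by rewrite uw andbT; apply/negP => /(allP wSl); rewrite ltnn.
  - by rewrite hF orbT.
  - by case: (w) wn lF.
  - rewrite lgF andbT; case: (w) => // y w'; rewrite negb_and; apply/orP; left.
    by apply/negP => /muS /Sl; rewrite ltnn.
have -> : op (grp i g ++ pairs i.+1 mu ++ (i, l) :: grp i w) = op (grp i (g ++ l :: w) ++ pairs i.+1 mu).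
  have := @op_comm (grp i g) (l :: w) [::]; rewrite /= !cats0 /grp map_cat /= -catA => -> //.
    by move=> x; rewrite !inE => /orP[->//|/(allP wS) /= ->]; rewrite orbT.
  rewrite negb_or hF andbT; apply/negP => /muS /Sl; rewrite ltnn //.
congr (_ * _); rewrite mul1r -!mulrA; congr (_ * _); rewrite mulrC; congr (_ * _).
  apply: ww_ext => x xw.
    have xF : x \notin F by apply: contra hF => xF; apply/hasP; exists x.
    have xg : x \notin g.
      by move: ugw; rewrite cat_uniq => /and3P[_ /hasPn /(_ x xw)].
    by rewrite !mem_cat (negPf xF) (negPf xg).
  have xF : x \notin F by apply: contra hF => xF; apply/hasP; exists x.
  have xg : x \notin g.
    by move: ugw; rewrite cat_uniq => /and3P[_ /hasPn /(_ x xw)].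
  by rewrite (negPf xF) /h !mem_cat (negPf xF) (negPf xg).
apply: mwt_ext => x xF; rewrite !mem_cat.
have -> // : (x \in w) = false.
by apply/negP => xw; move: hF => /hasPn /(_ x xw); rewrite /= xF.
Qed.

Lemma zero_prod (x m p y o : R) : m * p = 0 -> x * m * (p * y) * o = 0.
Proof. by move=> e; transitivity (m * p * (x * y * o)); [ring | rewrite e mul0r]. Qed.

(** [a] is the part of the group of [l] up to the stopping point, and [c :: r]
    moves to the group of [i], behind [g0]. The two weights agree unless [g0]
    ends with a letter smaller than [c]: excluded by
    [ascent_then_return_false]. *)
Lemma core_term_cut g0 a c r : g0 \in U -> a \in U -> c \in S -> r \in U ->
  (uniq (a ++ c :: r))%:R * (gw t B g0 * mwt t (g0 ++ B) mu * wL F (F ++ g0 ++ B) (a ++ c :: r) *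
    op (grp i g0 ++ pairs i.+1 mu ++ grp i (c :: r) ++ grp l (rcons a c))) =
  (uniq (rcons a c) && uniq (g0 ++ c :: r))%:R *
    (gw t B (g0 ++ c :: r) * mwt t ((g0 ++ c :: r) ++ B) mu *
     (wpre t (F ++ (g0 ++ c :: r) ++ B) a c * (c \notin F)%:R) *
    op (grp i (g0 ++ c :: r) ++ pairs i.+1 mu ++ grp l (rcons a c))).
Proof.
rewrite !mem_U => /andP[ug gS] /andP[ua aS] cS /andP[ur rS].
have crS : {subset c :: r <= S}.
  by move=> x; rewrite inE => /orP[/eqP->//|xr]; apply: (allP rS).
pose M := rcons mu (rcons a c).
have pM : pairs i.+1 M = pairs i.+1 mu ++ grp l (rcons a c).
  by rewrite /M -cats1 pairs_cat smu /= cats0.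
have sM : (i + size M)%N = l by rewrite /M size_rcons smu /l addnS.
have fM : flatten M = rcons (F ++ a) c.
  by rewrite /M -cats1 flatten_cat /= cats0 rcons_cat.
have fMS : {subset flatten M <= S}.
  by move=> x; rewrite fM mem_rcons inE mem_cat => /or3P[/eqP->//|/muS//|/(allP aS)].
pose Bn := (g0 ++ c :: r) ++ B.
have legM : ~~ feasible_groups Bn M -> mwt t Bn mu * wpre t (F ++ Bn) a c = 0.
  rewrite /M feasible_groups_rcons negb_and => /orP[h|h]; first by rewrite mwt_infeasible ?mul0r.
  by rewrite wpre_infeasible ?mulr0.
have all1 : all (fun x => i + size M < x)%N ((c :: r) ++ flatten M).
  by rewrite sM; apply/allP => x; rewrite mem_cat => /orP[/crS/Sl|/fMS/Sl].
case: (boolP (has (mem F) (c :: r))) => hF.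
  (* some new element of the group i was used in the middle: both sides vanish *)
  transitivity (0 : R).
    case: (boolP (uniq (a ++ c :: r))) => [uacr|]; last by rewrite mul0r.
    case: (eqVneq (wL F (F ++ g0 ++ B) (a ++ c :: r)) 0) => [->|w0]; first by rewrite !(mulr0, mul0r).
    have [||lF lgF] := wL_neq0 _ w0; first by move=> x xF; rewrite mem_cat xF.
      by case: (a).
    rewrite opw_nkch ?mulr0 //; apply/negP => k.
    have := @reuse_then_new_nonchain v i mu (grp i g0) (c :: r); rewrite smu => h.
    have /negP : ~~ kch v (grp i g0 ++ pairs i.+1 mu ++ grp i (c :: r)).
      apply: h => //.
      - by move: uacr; rewrite cat_uniq => /and3P[].
      - by apply/allP => x /(allP rS) /Sl.
      - by move: lF; rewrite last_cat.
      - exact: feasible_catr lgF.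
    by apply; move: k; rewrite !catA [X in is_true X -> _]kch_cat => /andP[].
  case: (boolP (uniq (rcons a c))) => [uac|]; last by rewrite mul0r.
  case: (boolP (c \in F)) => [|cF]; first by rewrite !(mulr0, mul0r).
  move: hF; rewrite /= (negPf cF) /= => /hasP[x xr xF].
  case: (boolP (feasible_groups Bn M)) => lM; last first.
    rewrite -[gw _ _ _ * _ * _]mulrA [mwt _ _ _ * _]mulrA legM //.
    by rewrite !(mulr0, mul0r).
  rewrite opw_nkch ?mulr0 //; apply/negP; rewrite -pM => k.
  have cW : c \notin F ++ a.
    by move: uac; rewrite rcons_uniq mem_cat negb_or cF => /andP[].
  have {}xF : x \in F by exact: xF.
  by have := later_avoids_group lM all1 fM cW k xr; rewrite mem_cat xF.
have nF x : x \in c :: r -> x \notin F.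
  by move=> xr; apply: contra hF => xF; apply/hasP; exists x.
have cF := nF c (mem_head _ _).
rewrite op_comm //; last by move=> x xr; rewrite inE crS ?orbT.
have -> : grp i g0 ++ grp i (c :: r) ++ pairs i.+1 mu ++ grp l (rcons a c) =
   grp i (g0 ++ c :: r) ++ pairs i.+1 M.
  by rewrite pM /grp map_cat -catA.
rewrite -pM; case: (boolP (kch v (grp i (g0 ++ c :: r) ++ pairs i.+1 M))) => k; last first.
  by rewrite opw_nkch // !mulr0.
have ugr : uniq (g0 ++ c :: r).
  move: (k); rewrite kch_cat => /andP[k1 _]; apply: kch_grp_uniq k1 _ => x.
  rewrite mem_cat => /orP[/(allP gS)|/crS]; move/Sl; move: il; clear; slia.
have uac : uniq (rcons a c).
  move: (k); rewrite pM !kch_cat => /and3P[_ _ k1]; apply: kch_grp_uniq k1 _ => x.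
  by rewrite mem_rcons inE => /orP[/eqP->|/(allP aS)/Sl//]; apply: Sl.
have ca : c \notin a by move: uac; rewrite rcons_uniq => /andP[].
have cW : c \notin F ++ a by rewrite mem_cat negb_or cF.
rewrite uac ugr cF mul1r mulr1.
have mwtE : mwt t (g0 ++ B) mu = mwt t Bn mu.
  apply: mwt_ext => x xF; rewrite /Bn !mem_cat.
  have -> : (x \in c :: r) = false; last by rewrite orbF.
  by apply/negP => /nF; rewrite xF.
case: (boolP (uniq (a ++ c :: r))) => [uacr|nu]; last first.
  rewrite mul0r; case: (boolP (feasible_groups Bn M)) => lM; last first.
    by rewrite -[gw _ _ _ * _ * _]mulrA legM // mulr0 mul0r.
  case/negP: nu; rewrite cat_uniq ua /=.
  have /= -> : uniq (c :: r) by move: ugr; rewrite cat_uniq => /and3P[].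
  rewrite andbT; apply/norP; split=> //; apply/hasPn => x xr /=.
  by have := later_avoids_group lM all1 fM cW k xr; rewrite mem_cat negb_or => /andP[].
have disj x : x \in a -> x \notin c :: r.
  by move=> xa; move: uacr; rewrite cat_uniq => /and3P[_ /hasPn h _]; apply/negP => /h /=; rewrite xa.
have wLE : wL F (F ++ g0 ++ B) (a ++ c :: r) = wpre t (F ++ Bn) a c * gw t B (c :: r).
  rewrite /wL ww_cat; congr (_ * _).
    apply: wpre_ext => x xa; rewrite /Bn !mem_cat.
    by have /negPf -> := disj x xa; rewrite orbF.
  have hx x : x \in c :: r -> (x \in F = false) /\ (x \in g0 = false).
    move=> xr; split; first by apply/negbTE/nF.
    by move: ugr; rewrite cat_uniq => /and3P[_ /hasPn h _]; apply/negbTE; apply: h.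
  apply: ww_ext => x xr; have [xF xg] := hx x xr; first by rewrite !mem_cat xF xg.
  by rewrite xF /h !mem_cat xF xg.
rewrite mul1r mwtE wLE.
case: (boolP (feasible_groups Bn M)) => lM; last first.
  by rewrite -[gw _ _ (_ ++ _) * _ * _]mulrA legM // mulr0 mul0r zero_prod ?legM.
have -> : gw t B (g0 ++ c :: r) = gw t B g0 * gw t B (c :: r); last by ring.
rewrite gw_cat gw_wpre //.
move: k lM ugr gS; rewrite /Bn; case: (lastP g0) => [|g00 b] k lM ugb gS //=.
rewrite last_rcons; case: (ltngtP c b) => // cb; last first.
  by move: ugb; rewrite cb cat_uniq /= mem_rcons inE eqxx /= andbF.
exfalso; apply: (@ascent_then_return_false v i g00 b c r M (F ++ a) ((rcons g00 b ++ c :: r) ++ B)) => //.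
- by move=> x; rewrite !inE !mem_cat mem_rcons !inE => /or3P[->|->|->]; rewrite ?orbT.
- have bS : b \in S by apply: (allP gS); rewrite mem_rcons mem_head.
  by move: all1; rewrite sM /= => ->; rewrite andbT; apply: Sl.
- by rewrite -cats1 -catA in k.
Qed.

End Core.

Section CoreSum.
Variables (R : comNzRingType) (t : R).
Implicit Types (S B g : seq nat) (M mu : seq (seq nat)) (psi : Sinf -> R) (v : Sinf).

Fixpoint Ms S n : seq (seq (seq nat)) :=
  if n is m.+1 then [seq g :: M | g <- U S, M <- Ms S m] else [:: [::]].

Lemma mem_Ms S n M : M \in Ms S n -> size M = n /\ {subset flatten M <= S}.
Proof.
elim: n M => [|n IH] M; first by rewrite inE => /eqP ->.
case/allpairsP => -[g M'] /= [gU /IH[sM MS] ->] /=; split; first by rewrite sM.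
move=> x; rewrite mem_cat => /orP[xg|/MS//].
by move: gU; rewrite mem_U => /andP[_ /allP]; apply.
Qed.

Lemma sum_mem_split S (uS : uniq S) (Y : seq nat -> R) c : c \in S ->
  \sum_(g <- U S) (c \in g)%:R * Y g =
  \sum_(a <- U S) \sum_(b <- U S | uniq (a ++ c :: b)) Y (a ++ c :: b).
Proof.
move=> cS.
transitivity (\sum_(g <- U S) \sum_(r <- iota 0 (size g))
   (nth 0%N g r == c)%:R * Y (take r g ++ nth 0%N g r :: drop r.+1 g)).
  rewrite [LHS]big_seq [RHS]big_seq; apply: eq_bigr => g; rewrite mem_U => /andP[ug _].
  rewrite big_seq (eq_bigr (fun r => (nth 0%N g r == c)%:R * Y g)); last first.
    move=> r; rewrite mem_iota add0n => /= rg.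
    by rewrite -drop_nth // cat_take_drop.
  rewrite -big_seq -mulr_suml; congr (_ * _).
  case: (boolP (c \in g)) => cg.
    rewrite (bigD1_seq (index c g)) ?iota_uniq //=; last by rewrite mem_iota index_mem.
    rewrite nth_index // eqxx big_seq_cond big1 ?addr0 // => r.
    rewrite mem_iota add0n => /andP[/= rg rc].
    by case: eqP => // e; move: rc; rewrite -e index_uniq // eqxx.
  rewrite big_seq big1 // => r; rewrite mem_iota add0n => /= rg.
  by case: eqP => // e; move: cg; rewrite -e mem_nth.
rewrite (sum_split3 uS (fun a c' b => (c' == c)%:R * Y (a ++ c' :: b))).
apply: eq_bigr => a _; rewrite (bigD1_seq c) //= eqxx.
rewrite [X in _ + X]big1 ?addr0.
  by apply: eq_bigr => b _; rewrite mul1r.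
by move=> c' /negPf ->; rewrite big1 // => b _; rewrite mul0r.
Qed.

Section FixMu.
Variables (psi : Sinf -> R) (v : Sinf) (S B : seq nat) (i n : nat) (mu : seq (seq nat)).
Let l := (i.+1 + n)%N.
Hypotheses (uS : uniq S) (lS : all (fun x => l < x)%N S) (muM : mu \in Ms S n).
Let F := flatten mu.
Local Notation op g := (opw g psi v).
Local Notation U := (U S).

Lemma op_push p w : w \in U ->
  op (p ++ grp l w ++ [:: (i, l)]) = op (p ++ (i, l) :: grp i w) +
   \sum_(r <- iota 0 (size w)) op (p ++ grp i (drop r w) ++ grp l (take r.+1 w)).
Proof.
rewrite mem_U => /andP[uw wS].
have wl : all (fun x => l < x)%N w by apply/allP => x /(allP wS) /(allP lS).
have il : (i < l)%N by rewrite /l; slia.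
rewrite opw_cat.
have -> : opw (grp l w ++ [:: (i, l)]) psi = fun u => opw ((i, l) :: grp i w) psi u +
   \sum_(r <- iota 0 (size w)) opw (grp i (drop r w) ++ grp l (take r.+1 w)) psi u.
  by apply: functional_extensionality => u; apply: opw_push.
rewrite opwD opw_sum -opw_cat; congr (_ + _).
by apply: eq_bigr => r _; rewrite -opw_cat.
Qed.

Lemma core_middle :
  \sum_(g <- U) gw t B g * mwt t (g ++ B) mu *
    (\sum_(w <- U) wL t F (F ++ g ++ B) w * op (grp i g ++ pairs i.+1 mu ++ grp l w ++ [:: (i, l)])
   - \sum_(w <- U) wK t g F (F ++ g ++ B) w * op (grp i g ++ pairs i.+1 mu ++ grp l w)) =
  \sum_(g <- U) \sum_(w <- U) (uniq (g ++ w))%:R * gw t B g * gw t B w * mwt t (g ++ w ++ B) mu *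
    op (grp i (g ++ l :: w) ++ pairs i.+1 mu).
Proof.
have [smu muS] := mem_Ms muM.
pose bt g w r := gw t B g * mwt t (g ++ B) mu * wL t F (F ++ g ++ B) w *
   op (grp i g ++ pairs i.+1 mu ++ grp i (drop r w) ++ grp l (take r.+1 w)).
pose kt g w := gw t B g * mwt t (g ++ B) mu * wK t g F (F ++ g ++ B) w *
   op (grp i g ++ pairs i.+1 mu ++ grp l w).
transitivity (\sum_(g <- U) \sum_(w <- U) gw t B g * mwt t (g ++ B) mu * wL t F (F ++ g ++ B) w *
    op (grp i g ++ pairs i.+1 mu ++ (i, l) :: grp i w) +
   (\sum_(g <- U) \sum_(w <- U) \sum_(r <- iota 0 (size w)) bt g w r -
    \sum_(g <- U) \sum_(w <- U) kt g w)).
  rewrite -sumrB -big_split /=; apply: eq_bigr => g _.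
  rewrite mulrBr addrA -big_split /= !mulr_sumr; congr (_ - _).
    rewrite [LHS]big_seq [RHS]big_seq; apply: eq_bigr => w wU.
    rewrite !catA -(catA _ (grp l w)) op_push // -!catA mulrA mulrDr mulr_sumr; congr (_ + _).
    by apply: eq_bigr => r _; rewrite /bt -!catA.
  by apply: eq_bigr => w _; rewrite /kt !mulrA.
have -> : \sum_(g <- U) \sum_(w <- U) \sum_(r <- iota 0 (size w)) bt g w r =
    \sum_(g <- U) \sum_(w <- U) kt g w; last first.
  rewrite subrr addr0 [LHS]big_seq [RHS]big_seq; apply: eq_bigr => g gU.
  rewrite [LHS]big_seq [RHS]big_seq; apply: eq_bigr => w wU.
  exact: (core_term_pushed t psi v lS B smu muS gU wU).
pose F1 g a c b := gw t B g * mwt t (g ++ B) mu * wL t F (F ++ g ++ B) (a ++ c :: b) *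
    op (grp i g ++ pairs i.+1 mu ++ grp i (c :: b) ++ grp l (rcons a c)).
transitivity (\sum_(g <- U) \sum_(a <- U) \sum_(c <- S) \sum_(b <- U | uniq (a ++ c :: b)) F1 g a c b).
  apply: eq_bigr => g _; rewrite -(sum_split3 uS (F1 g)).
  apply: eq_bigr => w _; rewrite [LHS]big_seq [RHS]big_seq; apply: eq_bigr => r.
  rewrite mem_iota add0n => /= rw.
  by rewrite /bt /F1 -drop_nth // cat_take_drop -take_nth.
pose Y a c g := gw t B g * mwt t (g ++ B) mu * (wpre t (F ++ g ++ B) a c * (c \notin F)%:R) *
   op (grp i g ++ pairs i.+1 mu ++ grp l (rcons a c)).
transitivity (\sum_(a <- U) \sum_(c <- S | uniq (rcons a c)) \sum_(g <- U) (c \in g)%:R * Y a c g);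
  last first.
  under eq_bigr => a _ do rewrite exchange_big.
  rewrite exchange_big; apply: eq_bigr => g _ /=.
  rewrite [RHS](bigID (fun w => w != [::])) /= [X in _ + X]big1 ?addr0; last first.
    by move=> w /negPn /eqP ->; rewrite /kt /wK /= mulr0 mul0r.
  rewrite [RHS]sum_rcons //; apply: eq_bigr => a _; apply: eq_bigr => c _.
  rewrite /kt /Y; have -> : wK t g F (F ++ g ++ B) (rcons a c) =
      wpre t (F ++ g ++ B) a c * ((c \in g) && (c \notin F))%:R.
    by rewrite -(ww_rcons t (fun x => ((x \in g) && (x \notin F))%:R)); case: (a).
  by rewrite -mulnb natrM; ring.
transitivity (\sum_(a <- U) \sum_(c <- S | uniq (rcons a c)) \sum_(g <- U)
   \sum_(b <- U | uniq (g ++ c :: b)) Y a c (g ++ c :: b)); last first.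
  apply: eq_bigr => a _; rewrite [LHS]big_seq_cond [RHS]big_seq_cond.
  by apply: eq_bigr => c /andP[cS _]; rewrite sum_mem_split.
rewrite exchange_big /= [LHS]big_seq [RHS]big_seq; apply: eq_bigr => a aU.
under eq_bigr => g _ do [under eq_bigr => c _ do rewrite big_mkcond].
rewrite exchange_big /= [RHS]big_mkcond [LHS]big_seq [RHS]big_seq; apply: eq_bigr => c cS.
transitivity (\sum_(g <- U) \sum_(b <- U) (uniq (rcons a c) && uniq (g ++ c :: b))%:R * Y a c (g ++ c :: b)).
  rewrite [LHS]big_seq [RHS]big_seq; apply: eq_bigr => g gU.
  rewrite [LHS]big_seq [RHS]big_seq; apply: eq_bigr => b bU.
  rewrite -(core_term_cut t psi v lS B smu muS gU aU cS bU) /F1.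
  by case: ifP; rewrite ?mul1r ?mul0r.
case: (uniq (rcons a c)) => /=; last first.
  by rewrite big1 // => g _; rewrite big1 // => b _; rewrite mul0r.
apply: eq_bigr => g _; rewrite [RHS]big_mkcond; apply: eq_bigr => b _.
by case: ifP; rewrite ?mul1r ?mul0r.
Qed.

End FixMu.
End CoreSum.

(** * One more right position *)

Lemma sum_U_perm (R : nmodType) S S' (F : seq nat -> R) : uniq S -> uniq S' -> S =i S' ->
  \sum_(g <- U S) F g = \sum_(g <- U S') F g.
Proof.
move=> uS uS' e; apply: perm_big; apply: uniq_perm; [exact: U_uniq|exact: U_uniq|].
by move=> g; rewrite !mem_U; congr (_ && _); apply: eq_all.
Qed.

Lemma sum_U_notin (R : nmodType) S (F : seq nat -> R) l : uniq (l :: S) ->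
  \sum_(g <- U (l :: S) | l \notin g) F g = \sum_(g <- U S) F g.
Proof.
move=> u; have /andP[lS uS] := u.
rewrite -[LHS]big_filter; apply: perm_big; apply: uniq_perm.
- exact/filter_uniq/U_uniq.
- exact: U_uniq.
move=> g; rewrite mem_filter !mem_U; case: (uniq g); rewrite /= ?andbF //.
apply/andP/allP => [[feasible /allP gS] x xg|gS].
  have := gS x xg; rewrite inE => /orP[/eqP e|//]; by rewrite -e xg in feasible.
split; first by apply: contra lS => /gS.
by apply/allP => x xg; rewrite /= inE; apply/orP; right; apply: gS.
Qed.

Lemma sum_U_cons (R : comNzRingType) S (F : seq nat -> R) l : uniq (l :: S) ->
  \sum_(g <- U (l :: S)) F g = \sum_(g <- U S) F g +
   \sum_(a <- U S) \sum_(b <- U S) (uniq (a ++ b))%:R * F (a ++ l :: b).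
Proof.
move=> u; have /andP[lS uS] := u.
rewrite (bigID (fun g => l \notin g)) /= sum_U_notin //; congr (_ + _).
transitivity (\sum_(g <- U (l :: S)) (l \in g)%:R * F g).
  rewrite big_mkcond; apply: eq_bigr => g _; rewrite negbK.
  by case: (l \in g); rewrite ?mul1r ?mul0r.
rewrite (sum_mem_split u) ?mem_head // (bigID (fun g => l \notin g)) /=.
rewrite [X in _ + X]big1 ?addr0; last first.
  move=> a /negPn la; rewrite big1 // => b; rewrite cat_uniq => /and3P[_ /norP[]].
  by rewrite /= la.
rewrite sum_U_notin // [LHS]big_seq [RHS]big_seq; apply: eq_bigr => a; rewrite mem_U => /andP[ua aS].
have la : l \notin a by apply: contra lS => /(allP aS).
rewrite big_mkcond (bigID (fun g => l \notin g)) /= sum_U_notin //.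
rewrite [X in _ + X]big1 ?addr0; last first.
  by move=> b /negPn lb; rewrite cat_uniq /= lb !andbF.
rewrite [LHS]big_seq [RHS]big_seq; apply: eq_bigr => b; rewrite mem_U => /andP[ub bS].
have lb : l \notin b by apply: contra lS => /(allP bS).
by rewrite !cat_uniq /= (negPf la) lb ub /=; case: ifP; rewrite ?mul1r ?mul0r.
Qed.

Section Gm.
Variables (R : comNzRingType) (t : R).
Implicit Types (S B g : seq nat) (M mu : seq (seq nat)) (phi psi : Sinf -> R) (v w : Sinf).

(** The weighted sum over the chains with groups at [i], ..., [i + n - 1], the
    right positions being in [S] and those of [B] being used already; the
    function at the end may depend on the groups. *)
Definition Gm S i n B (Phi : seq (seq nat) -> Sinf -> R) v : R :=
  \sum_(M <- Ms S n) mwt t B M * opw (pairs i M) (Phi M) v.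

Lemma Gm0 S i B Phi v : Gm S i 0 B Phi v = Phi [::] v.
Proof. by rewrite /Gm /= big_seq1 mul1r. Qed.

Lemma GmS S i n B Phi v : Gm S i n.+1 B Phi v =
  \sum_(g <- U S) gw t B g * opw (grp i g) (Gm S i.+1 n (g ++ B) (fun M => Phi (g :: M))) v.
Proof.
rewrite /Gm big_allpairs_dep /=; apply: eq_bigr => g _.
rewrite opw_sum mulr_sumr; apply: eq_bigr => M _.
by rewrite opwZ -opw_cat mulrA.
Qed.

Lemma Gm_ext S i n B Phi Psi v :
  (forall M w, M \in Ms S n -> Phi M w = Psi M w) -> Gm S i n B Phi v = Gm S i n B Psi v.
Proof.
move=> E; rewrite /Gm [LHS]big_seq [RHS]big_seq; apply: eq_bigr => M MM.
by congr (_ * _); apply: opw_ext => w; apply: E.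
Qed.

Lemma GmD S i n B Phi Psi v : Gm S i n B (fun M w => Phi M w + Psi M w) v =
  Gm S i n B Phi v + Gm S i n B Psi v.
Proof. by rewrite /Gm -big_split; apply: eq_bigr => M _; rewrite opwD mulrDr. Qed.

Lemma GmZ S i n B Phi a v : Gm S i n B (fun M w => a * Phi M w) v =
  a * Gm S i n B Phi v.
Proof. by rewrite /Gm mulr_sumr; apply: eq_bigr => M _; rewrite opwZ mulrCA. Qed.

Lemma GmB S i n B Phi Psi v : Gm S i n B (fun M w => Phi M w - Psi M w) v =
  Gm S i n B Phi v - Gm S i n B Psi v.
Proof.
rewrite -[- Gm _ _ _ _ Psi _]mulN1r -GmZ -GmD; apply: Gm_ext => M w _.
by rewrite mulN1r.
Qed.

Lemma Gm_B S i n B B' Phi v : (forall x, x \in S -> (x \in B) = (x \in B')) ->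
  Gm S i n B Phi v = Gm S i n B' Phi v.
Proof.
move=> e; rewrite /Gm [LHS]big_seq [RHS]big_seq; apply: eq_bigr => M /mem_Ms[_ MS].
by congr (_ * _); apply: mwt_ext => x /MS; apply: e.
Qed.

Lemma Gm_T S i j n l B Phi v : (i < j)%N -> (j + n <= l)%N -> all (fun x => l < x)%N S ->
  Gm S j n B (fun M => T i l (Phi M)) v = T i l (Gm S j n B Phi) v.
Proof.
move=> ij jl lS; rewrite /Gm.
rewrite -[RHS]/(opw [:: (i, l)] (fun w => \sum_(M <- Ms S n) mwt t B M * opw (pairs j M) (Phi M) w) v).
rewrite opw_sum [LHS]big_seq [RHS]big_seq; apply: eq_bigr => M /mem_Ms[sM MS].
rewrite opwZ; congr (_ * _); rewrite opw_comm1 // => -[a b] /mem_pairs [aI /MS /(allP lS) bl].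
by rewrite /= !inE; rewrite sM in aI; move: ij jl aI bl; clear; slia.
Qed.

(** A letter [l] smaller than all the others splits the weight of a word: the
    letter before it may be left unmarked, as if it were the last one, and [l]
    itself only if it is the last letter. *)
Lemma gw_mid B a l b : all (fun x => l < x)%N (a ++ b) ->
  gw t B (a ++ l :: b) = gw t B a * (h t B l - (b == [::])%:R) * gw t B b.
Proof.
rewrite all_cat => /andP[la lb]; rewrite gw_cat gw_wpre; last first.
  by case/lastP: a la => [|a x] //=; rewrite all_rcons last_rcons => /andP[].
rewrite -mulrA; congr (_ * _); case: b lb => [|y b] /= lb; first by rewrite /gw /= mulr1.
have ly : (l < y)%N by case/andP: lb.
by rewrite -[gw t B (l :: y :: b)]/((h t B l - (y < l)%N%:R) * gw t B (y :: b)) ltnNge (ltnW ly).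
Qed.

Section Fixed.
Variables (S : seq nat) (l : nat).
Hypotheses (uS : uniq S) (lS : all (fun x => l < x)%N S).

Let lnS : l \notin S.
Proof. by apply/negP => /(allP lS); rewrite ltnn. Qed.

Let ulS : uniq (l :: S). Proof. by rewrite /= lnS. Qed.

Lemma U_gt g : g \in U S -> all (fun x => l < x)%N g.
Proof. by rewrite mem_U => /andP[_ /allP gS]; apply/allP => x /gS /(allP lS). Qed.

Lemma dwnS i n : dwn i n.+1 = dwn i.+1 n ++ [:: i].
Proof. by rewrite -add1n dwnD addn1. Qed.

Lemma Lop_S i n psi : Lop l (dwn i n.+1) psi = Lop l (dwn i.+1 n) (Rp i l psi).
Proof. by rewrite dwnS Lop_cat. Qed.

(** If [l] has been used already, then it can only occur as the unmarked last
    letter of a group, with weight -1; the groups thus contribute the factors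
    1 - T_(i,l), and these cancel the factors 1 + T_(i,l) of [Lop]. *)
Lemma Lcancel n i B psi v : (i + n)%N = l -> l \in B ->
  Gm (l :: S) i n B (fun=> Lop l (dwn i n) psi) v = Gm S i n B (fun=> psi) v.
Proof.
elim: n i B psi v => [|n IH] i B psi v inl lB; first by rewrite !Gm0.
have jnl : (i.+1 + n)%N = l by rewrite -inl addnS.
have il : (i < l)%N by rewrite -inl; slia.
rewrite !GmS sum_U_cons // Lop_S.
pose X g := Gm S i.+1 n (g ++ B) (fun=> Rp i l psi).
have XE g : Gm (l :: S) i.+1 n (g ++ B) (fun=> Lop l (dwn i.+1 n) (Rp i l psi)) = X g.
  by apply: functional_extensionality => w; rewrite /X IH // mem_cat lB orbT.
have XD g w : X g w - T i l (X g) w = Gm S i.+1 n (g ++ B) (fun=> psi) w.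
  rewrite /X -(Gm_T _ _ _ (ltnSn i)) ?jnl // -GmB; apply: Gm_ext => M w' _.
  by rewrite -[LHS]/(Rm i l (Rp i l psi) w') RmRp.
rewrite -big_split [LHS]big_seq [RHS]big_seq; apply: eq_bigr => g gU /=.
rewrite (bigD1_seq [::]) ?U_uniq ?mem_U //= cats0 big1_seq ?addr0; last first.
  move=> b /andP[bn bU]; rewrite gw_mid ?all_cat ?(U_gt gU) ?(U_gt bU) //.
  by rewrite /h lB (negPf bn) subrr !(mulr0, mul0r).
rewrite gw_mid ?all_cat ?(U_gt gU) // /h lB /= sub0r /gw /= !XE.
have ug : uniq g by move: gU; rewrite mem_U => /andP[].
have -> : X (g ++ [:: l]) = X g.
  apply: functional_extensionality => w; apply: Gm_B => x xS.
  rewrite !mem_cat inE; case: (x =P l) => [e|_]; last by rewrite orbF.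
  by move: lnS; rewrite -e xS.
rewrite ug cats1 opw_rcons mulr1 mul1r mulrN1 mulNr -mulrBr; congr (_ * _).
have -> : Gm S i.+1 n (g ++ B) (fun=> psi) = fun w => X g w + (-1) * T i l (X g) w.
  by apply: functional_extensionality => w; rewrite -XD mulN1r.
by rewrite opwD opwZ mulN1r.
Qed.

Definition W lam B psi w : R := \sum_(g <- U S) ww t lam B g * opw (grp l g) psi w.
Definition W0 lam B psi w : R :=
  \sum_(g <- U S) (if g is [::] then 0 else ww t lam B g) * opw (grp l g) psi w.

Lemma sum_nil (F : seq nat -> R) : \sum_(g <- U S) (g == [::])%:R * F g = F [::].
Proof.
rewrite (bigD1_seq [::]) ?U_uniq ?mem_U //= mul1r big1 ?addr0 // => g /negPf ->.
by rewrite mul0r.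
Qed.

(** Letter by letter bookkeeping: with the last letter [c], both sides only
    depend on which of the sets [B], [g] and [F] contain [c]. *)
Lemma W_identity g B F psi i w :
  - ((1 - t) * W (h t (F ++ g ++ B)) (F ++ g ++ B) (T i l psi) w)
  + t * W0 (fun c => ((c \in B) && (c \notin g ++ F))%:R) (F ++ g ++ B) psi w
  - t * W0 (fun c => ((c \in g ++ B) && (c \notin F))%:R) (F ++ g ++ B) (Rp i l psi) w
  = t * ((\sum_(x <- U S) wL t F (F ++ g ++ B) x * opw (grp l x) (T i l psi) w)
     - \sum_(x <- U S) wK t g F (F ++ g ++ B) x * opw (grp l x) psi w) - T i l psi w.
Proof.
rewrite -[T i l psi w in RHS]/((fun x => opw (grp l x) (T i l psi) w) [::]) -sum_nil.
rewrite /W /W0 -sumrB !mulr_sumr -[X in _ = X](@sumrB R _ _ _ _) -sumrN -big_split -sumrB /=.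
apply: eq_bigr => x _; rewrite /Rp opwD.
set y := opw _ (T i l psi) w; set z := opw _ psi w.
case/lastP: x @y @z => [|a c] y z; first by rewrite /wL /wK /=; ring.
have -> : (rcons a c == [::]) = false by case: (a).
have E lam : (if rcons a c is [::] then 0 else ww t lam (F ++ g ++ B) (rcons a c))
  = wpre t (F ++ g ++ B) a c * lam c by rewrite -ww_rcons; case: (a).
rewrite /wK !E /wL !ww_rcons /h !mem_cat.
by case: (c \in F); case: (c \in g); case: (c \in B) => /=; ring.
Qed.

Lemma W_ext lam lam' B B' psi w : (forall x, x \in S -> (x \in B) = (x \in B')) ->
  (forall x, x \in S -> lam x = lam' x) -> W lam B psi w = W lam' B' psi w.
Proof.
move=> hB hl; rewrite /W [LHS]big_seq [RHS]big_seq; apply: eq_bigr => g; rewrite mem_U => /andP[_ /allP gS].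
by congr (_ * _); apply: ww_ext => x /gS; [apply: hB|apply: hl].
Qed.

Lemma W0_ext lam lam' B B' psi w : (forall x, x \in S -> (x \in B) = (x \in B')) ->
  (forall x, x \in S -> lam x = lam' x) -> W0 lam B psi w = W0 lam' B' psi w.
Proof.
move=> hB hl; rewrite /W0 [LHS]big_seq [RHS]big_seq; apply: eq_bigr => g; rewrite mem_U => /andP[_ /allP gS].
congr (_ * _); case: g gS => // x g gS.
by apply: ww_ext => y /gS; [apply: hB|apply: hl].
Qed.

Lemma WB lam B phi psi w : W lam B (fun u => phi u - psi u) w = W lam B phi w - W lam B psi w.
Proof.
rewrite /W -sumrB; apply: eq_bigr => g _; rewrite -mulrBr; congr (_ * _).
by rewrite !opwE; case: kch; rewrite ?subr0.
Qed.

End Fixed.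
End Gm.

(** In what follows the positions from [i] to [l - 1] have groups with right
    positions in [S], all larger than [l], and so has the position [l] itself;
    the aim is to trade the group of [l] for the right position [l]. *)
Section Claim.
Variables (R : comNzRingType) (t : R).
Implicit Types (S B g : seq nat) (M mu : seq (seq nat)) (phi psi : Sinf -> R) (v w : Sinf).
Variables (S : seq nat) (l : nat).
Hypotheses (uS : uniq S) (lS : all (fun x => l < x)%N S).

Lemma core_identity i n B psi v : (i.+1 + n)%N = l ->
  \sum_(g <- U S) gw t B g * opw (grp i g) (Gm t S i.+1 n (g ++ B) (fun M w =>
     \sum_(x <- U S) wL t (flatten M) (flatten M ++ g ++ B) x * opw (grp l x) (T i l psi) w
   - \sum_(x <- U S) wK t g (flatten M) (flatten M ++ g ++ B) x * opw (grp l x) psi w)) v =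
  \sum_(g <- U S) \sum_(x <- U S) (uniq (g ++ x))%:R * gw t B g * gw t B x *
    opw (grp i (g ++ l :: x)) (Gm t S i.+1 n (g ++ x ++ B) (fun=> psi)) v.
Proof.
move=> el; subst l.
transitivity (\sum_(mu <- Ms S n) \sum_(g <- U S) gw t B g * mwt t (g ++ B) mu *
    (\sum_(w <- U S) wL t (flatten mu) (flatten mu ++ g ++ B) w *
        opw (grp i g ++ pairs i.+1 mu ++ grp (i.+1 + n)%N w ++ [:: (i, (i.+1 + n)%N)]) psi v
   - \sum_(w <- U S) wK t g (flatten mu) (flatten mu ++ g ++ B) w *
        opw (grp i g ++ pairs i.+1 mu ++ grp (i.+1 + n)%N w) psi v)).
  rewrite exchange_big; apply: eq_bigr => g _.
  rewrite /Gm opw_sum mulr_sumr; apply: eq_bigr => M _.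
  rewrite opwZ -opw_cat mulrA; congr (_ * _).
  rewrite opwB !opw_sum; congr (_ - _); apply: eq_bigr => x _; rewrite opwZ; congr (_ * _).
    by rewrite -opw_cat -!catA !opw_cat.
  by rewrite -opw_cat -!catA.
transitivity (\sum_(mu <- Ms S n) \sum_(g <- U S) \sum_(w <- U S)
   (uniq (g ++ w))%:R * gw t B g * gw t B w * mwt t (g ++ w ++ B) mu *
    opw (grp i (g ++ (i.+1 + n)%N :: w) ++ pairs i.+1 mu) psi v).
  rewrite [LHS]big_seq [RHS]big_seq; apply: eq_bigr => M MM.
  exact: core_middle.
rewrite exchange_big; apply: eq_bigr => g _; rewrite exchange_big; apply: eq_bigr => x _.
rewrite /Gm opw_sum mulr_sumr; apply: eq_bigr => M _.
by rewrite opwZ -opw_cat !mulrA.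
Qed.

(** The cover (i, l) cannot occur twice. *)
Lemma opw_repeat i g b (X : Sinf -> R) v : (i < l)%N -> all (fun x => l < x)%N (g ++ b) ->
  opw (grp i (g ++ l :: b)) (T i l X) v = 0.
Proof.
move=> il; rewrite all_cat => /andP[feasible lb].
rewrite -[T i l X]/(opw [:: (i, l)] X) -opw_cat opw_nkch //; apply/negP.
rewrite /grp map_cat -catA kch_cat => /andP[_ /= /andP[cv k]].
have /covP[_ uil _] := cv.
suff : (i, l) \notin [seq (i, b) | b <- b] ++ [:: (i, l)] by rewrite mem_cat mem_head orbT.
apply: rep_pair k => [[x y]|]; last by rewrite swapR swapL.
rewrite mem_cat inE => /orP[/mapP[z /(allP lb) zl [-> ->]]|/eqP[-> ->]] /=.
  by move: il zl; clear; split; slia.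
by move: il; clear; split; slia.
Qed.

Local Notation Wl := (W t S l).
Local Notation W0l := (W0 t S l).

(** The group of [l] with last letters that are only marked ([Vsum]), or that may
    be unmarked ([Fsum]); [Ksum] is a defect term in which the last letter is in
    [B] and new for the groups from [i] on. It disappears when [B] is empty. *)
Definition Vsum i n B psi := Gm t S i n B (fun M => Wl (h t (flatten M ++ B)) (flatten M ++ B) psi).
Definition Fsum i n B psi :=
  Gm t S i n B (fun M => Wl (fun c => h t (flatten M ++ B) c - 1) (flatten M ++ B) psi).
Definition Ksum i n B psi := Gm t S i n B (fun M =>
  W0l (fun c => ((c \in B) && (c \notin flatten M))%:R) (flatten M ++ B) psi).

(** Induction on the number of groups. A word of the group of [i] on the right
    either does not contain [l], or it is [g ++ l :: x]; in the latter case [l] is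
    used, and [Lcancel] removes it from the other groups. What has to be shown
    after use of the induction hypothesis is [core_identity]. *)
Lemma add_right_end i n B psi v : (i + n)%N = l -> l \notin B ->
  (1 - t) * Vsum i n B psi v + t * Fsum i n B (Lop l (dwn i n) psi) v + t * Ksum i n B psi v =
  Gm t (l :: S) i n B (fun=> Lop l (dwn i n) psi) v.
Proof.
elim: n i B psi v => [|n IH] i B psi v inl lB.
  rewrite /Vsum /Fsum /Ksum !Gm0 /= /W /W0 !mulr_sumr -!big_split /=.
  rewrite -[RHS](sum_nil uS (fun g => opw (grp l g) psi v)); apply: eq_bigr => g _.
  case/lastP: g => [|a c]; first by rewrite /=; ring.
  have -> : (rcons a c == [::]) = false by case: (a).
  have E lam : (if rcons a c is [::] then 0 else ww t lam B (rcons a c))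
    = wpre t B a c * lam c by rewrite -ww_rcons; case: (a).
  rewrite E !ww_rcons /h andbT.
  by case: (c \in B) => /=; ring.
have jnl : (i.+1 + n)%N = l by rewrite -inl addnS.
have il : (i < l)%N by rewrite -inl; slia.
rewrite Lop_S; set psi' := Rp i l psi; set LL := Lop l (dwn i.+1 n) psi'.
pose Gc g psi := Gm t S i.+1 n (g ++ B) (fun=> psi).
have RE : Gm t (l :: S) i n.+1 B (fun=> LL) v =
  \sum_(g <- U S) gw t B g * opw (grp i g) (Gm t (l :: S) i.+1 n (g ++ B) (fun=> LL)) v +
  \sum_(g <- U S) \sum_(x <- U S) (uniq (g ++ x))%:R * gw t B g * gw t B x * (t - (x == [::])%:R) *
    opw (grp i (g ++ l :: x)) (Gm t S i.+1 n (g ++ x ++ B) (fun=> psi)) v.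
  rewrite GmS sum_U_cons; last by rewrite /= uS andbT; apply/negP => /(allP lS); rewrite ltnn.
  congr (_ + _).
  rewrite [LHS]big_seq [RHS]big_seq; apply: eq_bigr => g gU.
  rewrite [LHS]big_seq [RHS]big_seq; apply: eq_bigr => x xU.
  have lgx : all (fun x => l < x)%N (g ++ x) by rewrite all_cat !(U_gt lS).
  rewrite gw_mid // /h (negPf lB) -!mulrA; congr (_ * (_ * _)).
  rewrite [RHS]mulrCA; congr (_ * (_ * _)).
  have -> : Gm t (l :: S) i.+1 n ((g ++ l :: x) ++ B) (fun=> LL) =
     fun w => Gm t S i.+1 n (g ++ x ++ B) (fun=> psi) w + T i l (Gm t S i.+1 n (g ++ x ++ B) (fun=> psi)) w.
    apply: functional_extensionality => w.
    rewrite /LL Lcancel //; last by rewrite !mem_cat inE eqxx orbT.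
    rewrite -(Gm_T _ _ _ _ (ltnSn i)) ?jnl // -GmD.
    rewrite (@Gm_B _ _ _ _ _ _ (g ++ x ++ B)) // => y yS.
    rewrite !mem_cat inE; case: (y =P l) => [e|]; first by have := allP lS _ yS; rewrite e ltnn.
    by move=> _ /=; rewrite orbA.
  by rewrite opwD opw_repeat // addr0.
rewrite RE.
(* the used positions of the three sums, in the order in which the induction hypothesis has them *)
have BE g M x : x \in S -> (x \in (g ++ flatten M) ++ B) = (x \in flatten M ++ g ++ B).
  by move=> _; rewrite !mem_cat; case: (x \in g); rewrite ?orbT.
have VE : Vsum i n.+1 B psi v = \sum_(g <- U S) gw t B g * opw (grp i g) (Vsum i.+1 n (g ++ B) psi) v.
  rewrite /Vsum GmS; apply: eq_bigr => g _; congr (_ * opw _ _ _).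
  apply: functional_extensionality => w; apply: Gm_ext => M u _; apply: W_ext; first exact: BE.
  by move=> x xS; rewrite /h (BE g M).
have FE : Fsum i n.+1 B LL v = \sum_(g <- U S) gw t B g * opw (grp i g) (Fsum i.+1 n (g ++ B) LL) v.
  rewrite /Fsum GmS; apply: eq_bigr => g _; congr (_ * opw _ _ _).
  apply: functional_extensionality => w; apply: Gm_ext => M u _; apply: W_ext; first exact: BE.
  by move=> x xS; rewrite /h (BE g M).
pose K' g := Gm t S i.+1 n (g ++ B) (fun M =>
  W0l (fun c => ((c \in B) && (c \notin g ++ flatten M))%:R) (flatten M ++ g ++ B) psi).
have KE : Ksum i n.+1 B psi v = \sum_(g <- U S) gw t B g * opw (grp i g) (K' g) v.
  rewrite /Ksum GmS; apply: eq_bigr => g _; congr (_ * opw _ _ _).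
  by apply: functional_extensionality => w; apply: Gm_ext => M u _; apply: W0_ext => //; apply: BE.
rewrite VE FE KE !mulr_sumr -!big_split /=.
pose CO g := Gm t S i.+1 n (g ++ B) (fun M w =>
     \sum_(x <- U S) wL t (flatten M) (flatten M ++ g ++ B) x * opw (grp l x) (T i l psi) w
   - \sum_(x <- U S) wK t g (flatten M) (flatten M ++ g ++ B) x * opw (grp l x) psi w).
have main g w : g \in U S ->
  (1 - t) * Vsum i.+1 n (g ++ B) psi w + t * Fsum i.+1 n (g ++ B) LL w + t * K' g w =
  Gm t (l :: S) i.+1 n (g ++ B) (fun=> LL) w + (t * CO g w + (-1) * T i l (Gc g psi) w).
  move=> gU; have feasible : l \notin g ++ B.
    by rewrite mem_cat negb_or lB andbT; apply/negP => /(allP (U_gt lS gU)); rewrite ltnn.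
  rewrite /LL -IH // -/LL.
  rewrite -(Gm_T _ _ _ _ (ltnSn i)) ?jnl //.
  have -> : t * CO g w + -1 * Gm t S i.+1 n (g ++ B) (fun=> T i l psi) w =
    Gm t S i.+1 n (g ++ B) (fun M u =>
     - ((1 - t) * Wl (h t (flatten M ++ g ++ B)) (flatten M ++ g ++ B) (T i l psi) u)
     + t * W0l (fun c => ((c \in B) && (c \notin g ++ flatten M))%:R) (flatten M ++ g ++ B) psi u
     - t * W0l (fun c => ((c \in g ++ B) && (c \notin flatten M))%:R) (flatten M ++ g ++ B) psi' u) w.
    rewrite -!GmZ -GmD; apply: Gm_ext => M u _.
    by rewrite (W_identity t l uS) mulN1r.
  rewrite !GmB GmD !GmZ.
  have -> : Gm t S i.+1 n (g ++ B) (fun M u =>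
      - ((1 - t) * Wl (h t (flatten M ++ g ++ B)) (flatten M ++ g ++ B) (T i l psi) u)) w =
     - (1 - t) * (Vsum i.+1 n (g ++ B) psi' w - Vsum i.+1 n (g ++ B) psi w).
    rewrite -GmB -GmZ; apply: Gm_ext => M u _; rewrite -mulNr; congr (_ * _).
    rewrite -WB /W; apply: eq_bigr => x _; congr (_ * _); apply: opw_ext => y.
    by rewrite /psi' /Rp addrAC subrr add0r.
  rewrite -/(K' g w) -/(Ksum i.+1 n (g ++ B) psi' w).
  by ring.
transitivity (\sum_(g <- U S) (gw t B g * opw (grp i g) (Gm t (l :: S) i.+1 n (g ++ B) (fun=> LL)) v +
   (t * (gw t B g * opw (grp i g) (CO g) v) - gw t B g * opw (grp i g) (T i l (Gc g psi)) v))).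
  rewrite [LHS]big_seq [RHS]big_seq; apply: eq_bigr => g gU.
  have := @opw_ext _ (grp i g) _ _ (fun w => main g w gU) v.
  rewrite !opwD !opwZ => E.
  transitivity (gw t B g * ((1 - t) * opw (grp i g) (Vsum i.+1 n (g ++ B) psi) v
    + t * opw (grp i g) (Fsum i.+1 n (g ++ B) LL) v + t * opw (grp i g) (K' g) v)); first by ring.
  by rewrite E; ring.
rewrite [LHS]big_split [RHS]big_split /=; congr (_ + _); rewrite sumrB -mulr_sumr core_identity //.
rewrite mulr_sumr -sumrB [LHS]big_seq [RHS]big_seq; apply: eq_bigr => g gU.
have -> : gw t B g * opw (grp i g) (T i l (Gc g psi)) v =
  \sum_(x <- U S) (x == [::])%:R * ((uniq (g ++ x))%:R * gw t B g * gw t B x *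
    opw (grp i (g ++ l :: x)) (Gm t S i.+1 n (g ++ x ++ B) (fun=> psi)) v).
  have ug : uniq g by move: gU; rewrite mem_U => /andP[].
  by rewrite sum_nil // !cats0 cats1 opw_rcons ug /= mulr1 mul1r.
by rewrite mulr_sumr -sumrB; apply: eq_bigr => x _; ring.
Qed.

End Claim.

(** * The recursion on the number of left positions *)

Lemma sum_split2 (R : nmodType) S (uS : uniq S) (F : seq nat -> seq nat -> R) :
  \sum_(w <- U S) \sum_(r <- iota 0 (size w).+1) F (take r w) (drop r w) =
  \sum_(a <- U S) \sum_(b <- U S | uniq (a ++ b)) F a b.
Proof.
pose G (p : seq nat * seq nat) := F p.1 p.2.
pose L1 := [seq (take r w, drop r w) | w <- U S, r <- iota 0 (size w).+1].
pose L2 := [seq (a, b) | a <- U S, b <- U S].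
pose P (p : seq nat * seq nat) := uniq (p.1 ++ p.2).
transitivity (\sum_(p <- L1) G p); first by rewrite big_allpairs_dep.
transitivity (\sum_(p <- L2 | P p) G p); last first.
  rewrite big_mkcond big_allpairs_dep /=.
  by apply: eq_bigr => a _; rewrite [RHS]big_mkcond.
rewrite -[RHS]big_filter; apply: perm_big; apply: uniq_perm.
- apply: allpairs_uniq_dep => [|w _|]; [exact: U_uniq|exact: iota_uniq|].
  move=> [w r] [w' r'].
  case/allpairsPdep => x [y [xU yr [e1 e2]]].
  case/allpairsPdep => x' [y' [xU' yr' [e1' e2']]] /=.
  subst x y x' y'; move: yr yr'; rewrite !mem_iota !add0n /= !ltnS => rw rw' [e1 e2].
  have er : r = r' by have := congr1 size e1; rewrite !size_takel.
  by subst r'; congr existT; rewrite -(cat_take_drop r w) -(cat_take_drop r w') e1 e2.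
- by apply: filter_uniq; apply: allpairs_uniq; [exact: U_uniq|exact: U_uniq|move=> [? ?] [? ?] _ _ [-> ->]].
move=> [a b]; rewrite mem_filter /P.
apply/allpairsPdep/andP => [[w [r [wU]]]|[uab]].
  move=> _ [-> ->]; rewrite cat_take_drop.
  move: (wU); rewrite mem_U => /andP[uw wS]; split=> //.
  apply/allpairsP; exists (take r w, drop r w); split=> //=.
    rewrite mem_U take_uniq //=; apply/allP => x /mem_take; exact: (allP wS).
  rewrite mem_U drop_uniq //=; apply/allP => x /mem_drop; exact: (allP wS).
move=> /allpairsP [[a' b'] /= [aU bU [e3 e4]]].
subst; exists (a' ++ b'), (size a'); split.
- by move: aU bU; rewrite !mem_U uab all_cat => /andP[_ ->] /andP[_ ->].
- by rewrite -[_ :: _]/(iota 0 (size (a' ++ b')).+1) mem_iota size_cat /=; lia.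
- by rewrite take_size_cat // drop_size_cat.
Qed.

Section Decreasing.
Variables (R : comNzRingType) (t : R).
Implicit Types (S B g : seq nat) (phi psi : Sinf -> R) (v w : Sinf).

(** The coefficient of the word [g] in the product of the factors 1 - T_(l,b),
    for [b] decreasing: a sign if [g] is decreasing, and 0 otherwise. *)
Fixpoint desc_sign (g : seq nat) : R :=
  if g is x :: g' then - (if g' is y :: _ then (y < x)%N%:R else 1) * desc_sign g' else 1.

Lemma desc_sign_max a m b : all (fun x => x < m)%N (a ++ b) ->
  desc_sign (a ++ m :: b) = (a == [::])%:R * - desc_sign b.
Proof.
rewrite all_cat => /andP[am bm]; case: a am => [|x a] /=.
  move=> _; rewrite mul1r; case: b bm => [|y b] /=; first by rewrite mulN1r.
  by move=> /andP[-> _]; rewrite mulN1r.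
move=> /andP[xm]; rewrite mul0r.
elim: a x xm => [|y a IH] x xm /=.
  by move=> _; rewrite [(m < x)%N]ltnNge (ltnW xm) oppr0 mul0r.
by move=> /andP[ym am]; rewrite IH // mulr0.
Qed.

Lemma Dop_words l a n phi v : Dop l (dwn a n) phi v =
  \sum_(g <- U (iota a n)) desc_sign g * opw (grp l g) phi v.
Proof.
elim: n phi v => [|n IH] phi v; first by rewrite /U /= big_seq1 mul1r.
have -> : dwn a n.+1 = (a + n)%N :: dwn a n by rewrite -addn1 dwnD.
pose m := (a + n)%N.
have mn : m \notin iota a n by rewrite mem_iota /m ltnn andbF.
have um : uniq (m :: iota a n) by rewrite /= mn iota_uniq.
rewrite (@sum_U_perm _ _ (m :: iota a n)) ?iota_uniq //; last first.
  by move=> x; rewrite [in RHS]inE !mem_iota /m; lia.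
rewrite sum_U_cons //=.
have lt g : g \in U (iota a n) -> all (fun x => x < m)%N g.
  by rewrite mem_U => /andP[_ /allP h]; apply/allP => x /h /=; rewrite mem_iota /m; lia.
rewrite [X in _ + X](bigD1_seq [::]) ?U_uniq ?iota_uniq ?mem_U // [X in _ + (_ + X)]big_seq_cond.
rewrite [X in _ + (_ + X)]big1 ?addr0; last first.
  move=> g /andP[gU gn]; rewrite big_seq big1 // => b bU.
  by rewrite desc_sign_max ?all_cat ?lt // (negPf gn) !(mul0r, mulr0).
rewrite /Rm IH; congr (_ + _).
have -> : T l m (Dop l (dwn a n) phi) v = opw [:: (l, m)] (fun w =>
    \sum_(g <- U (iota a n)) desc_sign g * opw (grp l g) phi w) v.
  by apply: T_ext => w; apply: IH.
rewrite opw_sum -sumrN [LHS]big_seq [RHS]big_seq; apply: eq_bigr => b bU.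
rewrite opwZ desc_sign_max ?lt //= mul1r mulNr.
have -> : uniq b by move: bU; rewrite mem_U => /andP[].
by rewrite mul1r.
Qed.

(** A weighted word followed by a decreasing word with its sign, added over the
    cut: consecutive cuts telescope, and turn the contribution [h] of the last
    letter into [h - 1]. *)
Lemma conv_word B g :
  \sum_(r <- iota 0 (size g).+1) ww t (h t B) B (take r g) * desc_sign (drop r g) = gw t B g.
Proof.
elim: g => [|x g IH]; first by rewrite /= big_seq1 mulr1.
rewrite [size _]/= -[iota 0 _]/(0%N :: iota 1 (size g).+1) big_cons.
rewrite -[iota 1 _]/(iota (1 + 0) _) iotaDl big_map.
rewrite [ww _ _ _ (take 0 _)]/= mul1r [drop 0 _]/=.
case: g IH => [|y g] IH.
  rewrite [iota _ _]/= big_seq1 /= /gw /=; ring.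
rewrite -[iota 0 _]/(0%N :: iota 1 (size g).+1) big_cons.
have -> : gw t B [:: x, y & g] = (h t B x - (y < x)%N%:R) * gw t B (y :: g) by [].
rewrite -IH [X in _ = _ * X]big_cons mulrDr mulr_sumr.
rewrite -[iota 1 _]/(iota (1 + 0) _) iotaDl !big_map.
rewrite addrA; congr (_ + _).
  rewrite -[desc_sign [:: x, y & g]]/(- (y < x)%N%:R * desc_sign (y :: g)).
  by rewrite /= ; ring.
rewrite -[RHS]/(\sum_(i <- iota (1 + 0) (size g).+1) (h t B x - (y < x)%N%:R) *
  (ww t (h t B) B (take i (y :: g)) * desc_sign (drop i (y :: g)))) iotaDl big_map.
by apply: eq_bigr => r _; rewrite mulrA; congr (_ * _).
Qed.

Variables (S : seq nat) (l : nat).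
Hypotheses (uS : uniq S) (lS : all (fun x => l < x)%N S).

Lemma W_D a n B phi w : S = iota a n ->
  W t S l (h t B) B (Dop l (dwn a n) phi) w = W t S l (fun c => h t B c - 1) B phi w.
Proof.
move=> eS; rewrite /W.
transitivity (\sum_(g <- U S) \sum_(b <- U S | uniq (g ++ b)) ww t (h t B) B g * desc_sign b * opw (grp l (g ++ b)) phi w).
  rewrite [LHS]big_seq [RHS]big_seq; apply: eq_bigr => g gU.
  rewrite (_ : opw _ _ w = \sum_(b <- U S) desc_sign b * opw (grp l (g ++ b)) phi w); last first.
    rewrite (@opw_ext _ _ _ (fun u => \sum_(b <- U S) desc_sign b * opw (grp l b) phi u)); last first.
      by move=> u; rewrite Dop_words eS.
    rewrite opw_sum; apply: eq_bigr => b _; rewrite opwZ -opw_cat.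
    by rewrite /grp map_cat.
  rewrite mulr_sumr [RHS]big_mkcond [LHS]big_seq [RHS]big_seq; apply: eq_bigr => b bU.
  rewrite mulrA; case: ifP => // /negP nu; rewrite opw_nkch ?mulr0 //.
  apply/negP => k; apply: nu; move: k => /kch_grp_uniq; apply => x.
  by rewrite mem_cat => /orP[]; [apply: (allP (U_gt lS gU))|apply: (allP (U_gt lS bU))].
rewrite -(sum_split2 uS (fun a b => ww t (h t B) B a * desc_sign b * opw (grp l (a ++ b)) phi w)).
apply: eq_bigr => g _; rewrite -/(gw t B g) -conv_word mulr_suml.
by apply: eq_bigr => r _; rewrite cat_take_drop.
Qed.

End Decreasing.

Section Hop.
Variables (R : comNzRingType) (t : R).
Implicit Types (S B g : seq nat) (phi psi : Sinf -> R) (v w : Sinf).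

Lemma GmSr S i n B phi v : Gm t S i n.+1 B (fun=> phi) v =
  Gm t S i n B (fun M => W t S (i + n) (fun c => h t (flatten M ++ B) c - 1) (flatten M ++ B) phi) v.
Proof.
elim: n i B v => [|n IH] i B v.
  rewrite GmS Gm0 addn0; apply: eq_bigr => g _; congr (_ * opw _ _ _).
  by apply: functional_extensionality => w; rewrite Gm0.
rewrite GmS [RHS]GmS; apply: eq_bigr => g _; congr (_ * opw _ _ _).
apply: functional_extensionality => w; rewrite IH addSnnS; apply: Gm_ext => M u _.
have E x : (x \in flatten M ++ g ++ B) = (x \in (g ++ flatten M) ++ B).
  by rewrite !mem_cat; case: (x \in g); rewrite ?orbT.
by apply: W_ext => x _; rewrite /h E.
Qed.

(** The generating function of the chains with left positions less than [k] and
    right positions from [k] to [N - 1]. *)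
Definition Hop N k phi : Sinf -> R := Gm t (iota k (N - k)) 0 k [::] (fun=> phi).

Lemma Hop0 N phi : Hop N 0 phi = phi.
Proof. by apply: functional_extensionality => v; rewrite /Hop Gm0. Qed.

(** [add_right_end] for all groups from 0 on and no used positions, applied to
    the part of [Aop N l phi] with left position [l]: this part turns the last
    letters that can only be marked into letters that may be unmarked. *)
Lemma Hop_rec N l phi v : (l < N)%N ->
  (1 - t) * Hop N l.+1 phi v + t * Hop N l.+1 (Aop N l phi) v = Hop N l (Aop N l phi) v.
Proof.
move=> lN; pose S := iota l.+1 (N - l.+1).
have uS : uniq S := iota_uniq _ _.
have lS : all (fun x => l < x)%N S by apply/allP => x /=; rewrite mem_iota; lia.
have HE psi u : Hop N l.+1 psi u =
    Gm t S 0 l [::] (fun M => W t S l (fun c => h t (flatten M ++ [::]) c - 1) (flatten M ++ [::]) psi) u.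
  by rewrite /Hop GmSr add0n.
have SE : iota l (N - l) = l :: S by rewrite /S -(subnSK lN).
pose psi := Dop l (dwn l.+1 (N - l.+1)) phi.
have := @add_right_end R t S l uS lS 0 l [::] psi v (add0n l) isT.
rewrite /Hop SE -/(Hop _ _ _) => <-.
have -> : Ksum t S l 0 l [::] psi v = 0.
  rewrite /Ksum /Gm big1 // => M _; rewrite (@opw_ext _ _ _ (fun=> 0)); last first.
    move=> w; rewrite /W0 big1 // => -[|x g] _; first by rewrite mul0r.
    case: (lastP (x :: g)) (isT : x :: g != [::]) => // a c _.
    by rewrite ww_rcons mulr0 mul0r.
  by rewrite opwE; case: kch; rewrite mulr0.
rewrite mulr0 addr0; congr (_ * _ + _ * _); last by rewrite -[LHS]/(Hop _ _ _ _) HE.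
rewrite -[LHS]/(Hop _ _ _ _) HE; apply: Gm_ext => M w _; symmetry.
by apply: (W_D t uS lS).
Qed.

End Hop.

(** * Weights of chains and markings *)

(** Condition [chain_P3] for the cover [f], followed by the list [e]: whether [f] may
    be left unmarked. *)
Definition descends (f : nat * nat) (e : seq (nat * nat)) : bool :=
  if e is f' :: _ then (f.1 < f'.1)%N || ((f.1 == f'.1) && (f'.2 < f.2)%N) else true.

Definition le1_neq (f f' : nat * nat) : bool :=
  (f.1 < f'.1)%N || ((f.1 == f'.1) && (f.2 != f'.2)).

(** The number of covers that must be marked by [chain_P3]. *)
Fixpoint asc (e : seq (nat * nat)) : nat :=
  if e is f :: e' then (~~ descends f e' + asc e')%N else 0%N.

Fixpoint markings n : seq (seq bool) :=
  if n is m.+1 then map (cons true) (markings m) ++ map (cons false) (markings m) else [:: [::]].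

Lemma mem_markings n s : (s \in markings n) = (size s == n).
Proof.
elim: n s => [|n IH] s /=; first by case: s.
have inj m : injective (cons m : seq bool -> _) by move=> x y [].
rewrite mem_cat; case: s => [|[] s].
- by apply/negP => /orP[] /mapP[].
- rewrite (mem_map (inj true)) IH; apply/orP/idP => [[//|/mapP[]]|]; [by []|by left].
- rewrite (mem_map (inj false)) IH; apply/orP/idP => [[/mapP[]|//]|]; [by []|by right].
Qed.

Lemma markings_uniq n : uniq (markings n).
Proof.
elim: n => //= n IH.
have inj m : injective (cons m : seq bool -> _) by move=> x y [].
rewrite cat_uniq !map_inj_uniq ?IH ?andbT //=.
by apply/hasPn => x /mapP[y _ ->]; apply/negP => /mapP[].
Qed.

(** [chain_P2] and [chain_P3]; the list [B] collects the right positions used before. *)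
Fixpoint marks_ok (B : seq nat) (e : seq (nat * nat)) (s : seq bool) : bool :=
  match e, s with
  | f :: e', m :: s' => (if m then f.2 \notin B else descends f e') && marks_ok (f.2 :: B) e' s'
  | [::], [::] => true
  | _, _ => false
  end.

(** [chain_P4]: the covers of the first ascending run, up to the first one that
    descends, are marked. *)
Fixpoint run_marked (e : seq (nat * nat)) (s : seq bool) : bool :=
  match e, s with
  | f :: e', m :: s' => m && (descends f e' || run_marked e' s')
  | _, _ => true
  end.

(** The weights of the groups, computed along the list of all covers. Letters of
    the same group can be added to the used ones, as they are distinct. *)
Section FlatWeight.
Variables (R : comNzRingType) (t : R).
Implicit Types (B g : seq nat) (M : seq (seq nat)) (e : seq (nat * nat)).

Fixpoint flat_wt B e : R :=
  if e is f :: e' then (h t B f.2 - (descends f e')%:R) * flat_wt (f.2 :: B) e' else 1.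

Lemma flat_wt_ext B B' e : B =i B' -> flat_wt B e = flat_wt B' e.
Proof.
elim: e B B' => //= f e IH B B' E; rewrite /h E; congr (_ * _).
by apply: IH => x; rewrite !inE E.
Qed.

Lemma flat_wt_grp B i g e : uniq g -> all (fun f => i < f.1)%N e ->
  flat_wt B (grp i g ++ e) = gw t B g * flat_wt (g ++ B) e.
Proof.
move=> + ie; elim: g B => [|x g IH] B; first by rewrite /gw /= mul1r.
move=> /andP[xg ug] /=; rewrite IH //.
rewrite (@gw_ext _ _ (x :: B) B); last first.
  by move=> y yg; rewrite inE; case: eqP => // e1; move: xg; rewrite -e1 yg.
rewrite (@flat_wt_ext (g ++ x :: B) (x :: g ++ B)); last first.
  by move=> y; rewrite !(inE, mem_cat); case: (y == x); rewrite ?orbT.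
rewrite mulrA; congr (_ * _); case: g {IH xg ug} => [|y g] /=.
  by rewrite /gw /=; case: e ie => //= f e /andP[-> _].
by rewrite ltnn eqxx.
Qed.

Lemma pairs_gt i j M : (i < j)%N -> all (fun f => i < f.1)%N (pairs j M).
Proof. by move=> ij; apply/allP => -[a b] /mem_pairs[aI _] /=; slia. Qed.

Lemma mwt_flat_wt B i M : all uniq M -> mwt t B M = flat_wt B (pairs i M).
Proof.
elim: M B i => //= g M IH B i /andP[ug uM].
by rewrite flat_wt_grp ?pairs_gt // -IH.
Qed.

(** The weight under [chain_P4]: no cover of the first ascending run is unmarked. *)
Fixpoint run_wt B e : R :=
  if e is f :: e' then
    h t B f.2 * (if descends f e' then flat_wt (f.2 :: B) e' else run_wt (f.2 :: B) e')
  else 1.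

(** The letters of the first run are new. Those before its last one go up, so that
    they have to be marked anyway; the last one contributes [t - 1] without [chain_P4]
    and [t] with it. *)
Lemma flat_run_wt B f e : path le1_neq f e -> all (fun b => b < f.2)%N B ->
  t * flat_wt B (f :: e) = (t - 1) * run_wt B (f :: e).
Proof.
elim: e B f => [|f' e IH] B f.
  move=> _ fB; have fnB : f.2 \notin B by apply/negP => /(allP fB); rewrite ltnn.
  by rewrite /= /h (negPf fnB); ring.
move=> /andP[ff pe] fB; have fnB : f.2 \notin B by apply/negP => /(allP fB); rewrite ltnn.
rewrite -[flat_wt B _]/((h t B f.2 - (descends f (f' :: e))%:R) * flat_wt (f.2 :: B) (f' :: e)).
rewrite -[run_wt B _]/(h t B f.2 * (if descends f (f' :: e) then flat_wt (f.2 :: B) (f' :: e)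
  else run_wt (f.2 :: B) (f' :: e))).
rewrite /h (negPf fnB); case: ifP => n /=; first by ring.
rewrite subr0 mulrCA [in LHS]mulrC mulrC IH //; first by rewrite /=; ring.
have lt : (f.2 < f'.2)%N by move: ff n; rewrite /le1_neq /=; slia.
rewrite /= lt; apply/allP => b /(allP fB) /= bf; exact: ltn_trans bf lt.
Qed.

Definition mark_wt (s : seq bool) : R := t ^+ count id s * (-1) ^+ count negb s.

Lemma sum_markingsS n (F : seq bool -> R) : \sum_(s <- markings n.+1) F s =
  \sum_(s <- markings n) F (true :: s) + \sum_(s <- markings n) F (false :: s).
Proof. by rewrite /= big_cat !big_map. Qed.

Lemma flat_wtE B e : flat_wt B e = \sum_(s <- markings (size e)) (marks_ok B e s)%:R * mark_wt s.
Proof.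
elim: e B => [|f e IH] B; first by rewrite /= big_seq1 /mark_wt /= !mul1r.
rewrite sum_markingsS /= IH mulrBl !mulr_sumr -sumrN.
congr (_ + _); apply: eq_bigr => s _; rewrite /mark_wt /= !(add0n, add1n) exprS.
  by rewrite /h; case: (f.2 \in B) => /=; ring.
by case: (descends f e) => /=; ring.
Qed.

Lemma run_wtE B e : run_wt B e = \sum_(s <- markings (size e)) (marks_ok B e s && run_marked e s)%:R * mark_wt s.
Proof.
elim: e B => [|f e IH] B; first by rewrite /= big_seq1 /mark_wt /= !mul1r.
rewrite sum_markingsS /= [X in _ + X]big1 ?addr0; last by move=> s _; rewrite andbF mul0r.
case: ifP => n; rewrite ?flat_wtE ?IH mulr_sumr; apply: eq_bigr => s _;
  rewrite /mark_wt /= !(add0n, add1n) exprS /h ?andbT;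
  case: (f.2 \in B) => /=; ring.
Qed.

End FlatWeight.

(** * Truncation and the recursion for Grothendieck polynomials *)

Definition le1 (f f' : nat * nat) : bool := (f.1 <= f'.1)%N.

Lemma le1_trans : transitive le1.
Proof. by move=> f g h; apply: leq_trans. Qed.

Lemma kch_le1_neq u e : kch u e -> sorted le1 e -> sorted le1_neq e.
Proof.
elim: e u => // f [//|f' e] IH u /= /andP[c1 kc] /andP[l1 p1].
have /= -> := IH _ kc p1; rewrite andbT /le1_neq; move: l1; rewrite /le1 leq_eqVlt orbC.
case: ltnP => //= _ e1; rewrite e1 /=; apply/eqP => e2.
move: kc => /= /andP[+ _]; rewrite -(eqP e1) -e2 => /covP[_].
by rewrite swapL swapR; have /covP[_ ] := c1; slia.
Qed.

(** A window [M] outside of which the permutation is the identity can only grow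
    by a cover (a, M), which brings the value [M] to [a]. The next cover of the
    same group then has a larger right position. So the window grows at most
    once per ascent, and once at the end of each group. *)
Lemma bound_flat e (u : Sinf) M k a0 : (sbound u <= M)%N -> (k <= M)%N -> sorted le1 e ->
  all (fun f => (a0 <= f.1) && (f.1 < k <= f.2))%N e -> kch u e ->
  (sbound (kend u e) <= M + asc e + (k - a0))%N /\
  all (fun f => f.2 < M + asc e + (k - a0))%N e.
Proof.
elim: e u M a0 => [|[a b] e IH] u M a0 uM kM /=; first by move=> *; split=> //; lia.
move=> pe /andP[ab ae] /andP[/covP[/= _ uab H] kc].
have se : sorted le1 e := path_sorted pe.
have ae' a1 : (forall f, f \in e -> a1 <= f.1)%N -> all (fun f => (a1 <= f.1) && (f.1 < k <= f.2))%N e.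
  by move=> h; apply/allP => f fe; have := h f fe; have /= := allP ae f fe; slia.
have ge f : f \in e -> (a <= f.1)%N by move=> fe; exact: (allP (order_path_min le1_trans pe) _ fe).
have aM : (u a < M)%N by apply: Sinf_lt => //; slia.
have bM : (b <= M)%N.
  rewrite leqNgt; apply/negP => Mb; have := H M.
  by rewrite (sboundP uM) (sboundP (leq_trans uM (ltnW Mb))); slia.
have [lt|eM] : (b < M)%N \/ b = M by slia.
  have [|h1 h2] := IH (swap u a b) M a _ kM se (ae' _ ge) kc; first by apply: sbound_swap; slia.
  split; first by slia.
  by apply/andP; split; [slia|apply/allP => f /(allP h2) /=; slia].
subst b.
have uM' : (sbound (swap u a M) <= M.+1)%N by apply: sbound_swap; slia.
case: e IH pe ae kc se ae' ge => [|[a' b'] e] IH pe ae kc se ae' ge.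
  by rewrite /=; move: uM'; split; slia.
have /= aa' := ge _ (mem_head _ _).
have [lt|eq] : (a < a')%N \/ a' = a by slia.
  have ge' f : f \in (a', b') :: e -> (a.+1 <= f.1)%N.
    rewrite inE => /orP[/eqP -> //|fe]; apply: leq_trans lt _.
    by move: se => /(order_path_min le1_trans) /allP /(_ _ fe).
  have [|h1 h2] := IH (swap u a M) M.+1 a.+1 uM' _ se (ae' _ ge') kc; first by slia.
  rewrite /= in h1 h2 *; split; first by slia.
  move: h2 => /andP[h2 h3]; apply/and3P; split; [slia|slia|].
  by apply/allP => f /(allP h3) /=; slia.
subst a'; have [|h1 h2] := IH (swap u a M) M.+1 a uM' _ se (ae' _ ge) kc; first by slia.
have nn : descends (a, M) ((a, b') :: e) = false.
  rewrite /= ltnn eqxx /=; apply/negP => lt.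
  have /= /andP[_ kb] := allP ae _ (mem_head _ _).
  move: kc => /= /andP[/covP[_ + _] _]; rewrite swapL swapD; [|slia|slia].
  by rewrite (sboundP uM) => h; have := @Sinf_lt u b' M uM lt; slia.
rewrite -/(descends (a, M) ((a, b') :: e)) nn /= in h1 h2 *.
split; first by slia.
apply/andP; split; first by slia.
move: h2 => /andP[h2 h3]; apply/andP; split; first by slia.
by apply/allP => f /(allP h3) /=; slia.
Qed.

Lemma pairs_sorted i M : sorted le1 (pairs i M).
Proof.
elim: M i => //= g M IH i; elim: g => //= x g IHg.
rewrite (path_sortedE le1_trans) IHg andbT; apply/allP => -[a b]; rewrite mem_cat /le1 /=.
by move=> /orP[/mapP[y _ [-> _]] //|/mem_pairs[]]; slia.
Qed.

(** Each ascent has to be marked, and contributes a factor [t]. *)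
Lemma flat_wt_coef (P : comNzRingType) B e j : (j < asc e)%N -> (flat_wt ('X : {poly P}) B e)`_j = 0.
Proof.
elim: e B j => //= f e IH B j; case: (descends f e) => /= ja; last first.
  rewrite subr0 /h; case: ifP => _; first by rewrite mul0r coef0.
  by rewrite coefXM; case: eqP => // j0; apply: IH; slia.
rewrite mulrBl mul1r coefB IH // subr0 /h; case: ifP => _; first by rewrite mul0r coef0.
by rewrite coefXM; case: eqP => // j0; apply: IH; slia.
Qed.

Lemma Ms_uniq_groups S n M : M \in Ms S n -> all uniq M.
Proof.
elim: n M => [|n IH] M /=; first by rewrite inE => /eqP ->.
case/allpairsP => -[g M'] /= [gU /IH uM ->] /=; rewrite uM andbT.
by move: gU; rewrite mem_U => /andP[].
Qed.

(** The function [G] stands for [groth]: what is used about it is the transition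
    formula. *)
Section Coef.
Variables (P : comNzRingType) (X : nat -> P) (G : Sinf -> P).
Hypothesis trG : forall n j w, (sbound w <= n)%N -> (j < n)%N -> Aop n.+1 j G w = (1 - X j) * G w.

Notation t := ('X : {poly P}).
Let Gc w : {poly P} := (G w)%:P.

(** The chains which contribute to the coefficient of degree [j] have at most [j]
    ascents, so their endpoints are confined to a window. *)
Lemma Hop_coef_ext N l (phi psi : Sinf -> {poly P}) (v : Sinf) j :
  (forall w : Sinf, (sbound w <= maxn (sbound v) l + j + l)%N -> phi w = psi w) ->
  (Hop t N l phi v)`_j = (Hop t N l psi v)`_j.
Proof.
move=> E; rewrite /Hop /Gm !coef_sum [LHS]big_seq [RHS]big_seq; apply: eq_bigr => M MM.
rewrite !opwE; case: ifP => kc; last by rewrite mulr0.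
have [sM MS] := mem_Ms MM; rewrite (mwt_flat_wt _ _ 0 (Ms_uniq_groups MM)).
have [|||h1 _] := @bound_flat (pairs 0 M) v (maxn (sbound v) l) l 0 _ _ (pairs_sorted _ _) _ kc;
  [exact: leq_maxl|exact: leq_maxr| |].
  apply/allP => -[a b] /mem_pairs[aI /MS]; rewrite sM add0n in aI.
  by rewrite mem_iota /=; slia.
rewrite subn0 in h1; case: (leqP (asc (pairs 0 M)) j) => ja.
  by rewrite E //; slia.
by rewrite !coefM !big1 // => i _; rewrite flat_wt_coef ?mul0r //; have := ltn_ord i; slia.
Qed.

Lemma Aop_polyC N l w : Aop N l Gc w = (Aop N l G w)%:P.
Proof.
apply: (@Aop_add _ _ polyC); [exact: polyCD|exact: polyC0|exact: polyCN].
Qed.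

Lemma HopZ N l (a : P) phi v : Hop t N l (fun w => a%:P * phi w) v = a%:P * Hop t N l phi v.
Proof. exact: GmZ. Qed.

Definition Hop_coef N l j v : P := (Hop t N l Gc v)`_j.

(** The transition formula may be used under the sum over chains, as the relevant
    endpoints are in the window where it holds. *)
Lemma Hop_A N l m v j : (l < N.-1)%N -> (maxn (sbound v) m + j + m < N)%N ->
  (Hop t N m (Aop N l Gc) v)`_j = (1 - X l) * Hop_coef N m j v.
Proof.
move=> lN hN; rewrite (@Hop_coef_ext _ _ _ (fun w => (1 - X l)%:P * Gc w)); last first.
  move=> w wb; rewrite Aop_polyC; have -> : N = N.-1.+1 by slia.
  by rewrite trG ?polyCM //; slia.
by rewrite HopZ coefCM.
Qed.

Lemma Hop_coef_rec N l j v : (maxn (sbound v) l.+1 + j + l.+2 < N)%N ->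
  Hop_coef N l.+1 j v = X l * (if j is i.+1 then Hop_coef N l.+1 i v else 0) + (1 - X l) * Hop_coef N l j v.
Proof.
move=> hN; have lN : (l < N)%N by slia.
have := congr1 (fun p : {poly P} => p`_j) (Hop_rec t Gc v lN).
rewrite /= Hop_A; [|slia|slia].
rewrite mulrBl mul1r coefD coefB !coefXM -/(Hop_coef N l.+1 j v).
case: j hN => [|j] hN /=; first by rewrite subr0 addr0 => ->; rewrite mulr0 add0r.
rewrite Hop_A; [|slia|slia]; rewrite -/(Hop_coef N l.+1 j v) => <-; ring.
Qed.

(** The one-row polynomial with index [p] in the first [k] variables (see
    [qrow_groth]), given by the recursion that [Hop_coef_rec] suggests. *)
Fixpoint qrow l : nat -> P :=
  if l is l'.+1 then
    fix aux p := if p is p'.+1 then X l' * aux p' + (1 - X l') * qrow l' p else 1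
  else fun p => (p == 0%N)%:R.

(** The partial sums of the coefficients are what [chain_P4] leads to, see
    [pieri_poly_coef]; in terms of them the recursion has no case distinction. *)
Lemma Hop_coef_sum N l p v : (maxn (sbound v) l + p + l.+1 < N)%N ->
  G v - \sum_(j < p) Hop_coef N l j v = qrow l p * G v.
Proof.
elim: l p => [|l IHl] p hN.
  case: p hN => [|p] hN; first by rewrite big_ord0 subr0 /= mul1r.
  rewrite big_ord_recl /Hop_coef Hop0 coefC /= big1 ?addr0 ?subrr ?mul0r // => i _.
  by rewrite coefC.
elim: p hN => [|p IHp] hN; first by rewrite big_ord0 subr0 /= mul1r.
rewrite -[qrow _ _]/(X l * qrow l.+1 p + (1 - X l) * qrow l p.+1) mulrDl -!mulrA.
rewrite -IHl -?IHp; [|slia|slia].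
transitivity (G v - \sum_(j < p.+1) (X l * (if j : nat is i.+1 then Hop_coef N l.+1 i v else 0)
   + (1 - X l) * Hop_coef N l j v)).
  by congr (_ - _); apply: eq_bigr => j _; apply: Hop_coef_rec; have := ltn_ord j; slia.
rewrite big_split /= -!mulr_sumr [Y in X l * Y]big_ord_recl /= add0r; ring.
Qed.

End Coef.

(** * From words to marked chains *)

Lemma Ms_uniq S n : uniq S -> uniq (Ms S n).
Proof.
move=> uS; elim: n => //= n IH; apply: allpairs_uniq; [exact: U_uniq|exact: IH|].
by move=> [g M] [g' M'] _ _ /= [-> ->].
Qed.

Lemma pairs_filter i g M : [seq f <- grp i g ++ pairs i.+1 M | f.1 == i] = grp i g /\
  [seq f <- grp i g ++ pairs i.+1 M | f.1 != i] = pairs i.+1 M.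
Proof.
have h1 : all (fun f => f.1 == i) (grp i g) by apply/allP => f /mapP[x _ ->] /=.
have h2 : all (fun f => f.1 != i) (pairs i.+1 M).
  by apply/allP => -[a b] /mem_pairs[aI _] /=; slia.
have h3 : filter (fun f => f.1 != i) (grp i g) = [::].
  by apply/eqP; rewrite -[_ == _]negbK -has_filter -all_predC; apply: sub_all h1 => f /= ->.
have h4 : filter (fun f => f.1 == i) (pairs i.+1 M) = [::].
  by apply/eqP; rewrite -[_ == _]negbK -has_filter -all_predC.
by rewrite !filter_cat (all_filterP h1) (all_filterP h2) h3 h4 cats0.
Qed.

Lemma pairs_inj i M M' : size M = size M' -> pairs i M = pairs i M' -> M = M'.
Proof.
elim: M i M' => [|g M IH] i [|g' M'] //= [sM] E.
have [a1 a2] := pairs_filter i g M; have [b1 b2] := pairs_filter i g' M'.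
have Eg : grp i g = grp i g' by rewrite -a1 -b1 E.
have -> : M = M' by apply: (IH i.+1) => //; rewrite -a2 -b2 E.
by congr cons; move: Eg => /(congr1 (map snd)); rewrite -!map_comp !map_id.
Qed.

(** The chains underlying the sum [Hop], as lists of pairs. *)
Definition pair_lists S k := [seq pairs 0 M | M <- Ms S k].

Lemma pair_lists_uniq S k : uniq S -> uniq (pair_lists S k).
Proof.
move=> uS; rewrite map_inj_in_uniq ?Ms_uniq // => M M' /mem_Ms[s1 _] /mem_Ms[s2 _].
by apply: pairs_inj; rewrite s1.
Qed.

Lemma sorted_first i e : sorted le1 e -> all (fun f => i <= f.1)%N e ->
  e = [seq f <- e | f.1 == i] ++ [seq f <- e | f.1 != i].
Proof.
elim: e => // f e IH /= pe /andP[fi ae].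
have {}IH := IH (path_sorted pe) ae.
case: (f.1 =P i) => [e1|ne] /=; first by rewrite -IH.
have lt : all (fun x => x.1 != i) e.
  by apply/allP => x /(allP (order_path_min le1_trans pe)); rewrite /le1 /=; slia.
rewrite (all_filterP lt) (_ : filter _ e = [::]) //.
by apply/eqP; rewrite -[_ == _]negbK -has_filter -all_predC.
Qed.

(** The groups are recovered from a sorted list by separating the pairs whose
    left position is [i] from the others. *)
Lemma pairs_ex S n i e (v : Sinf) : sorted le1 e ->
  all (fun f => (i <= f.1 < i + n) && (f.1 < f.2) && (f.2 \in S))%N e -> kch v e ->
  exists2 M, M \in Ms S n & pairs i M = e.
Proof.
elim: n i e v => [|n IH] i e v se ae ke.
  exists [::]; first by rewrite inE.
  by case: e ae {se ke} => //= f e /andP[]; slia.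
have /(sorted_first se) E : all (fun f => i <= f.1)%N e.
  by apply/allP => f /(allP ae) /=; slia.
pose g := [seq f.2 | f <- e & f.1 == i]; pose e2 := [seq f <- e | f.1 != i].
have Eg : [seq f <- e | f.1 == i] = grp i g.
  rewrite /g /grp -map_comp -[LHS]map_id; apply/eq_in_map => -[a b].
  by rewrite mem_filter /= => /andP[/eqP <-].
have Ee : e = grp i g ++ e2 by rewrite -Eg.
have := ke; rewrite Ee kch_cat => /andP[kg k2].
have [||M MM pM] := IH i.+1 e2 _ _ _ k2.
- by apply: (sorted_filter le1_trans).
- by apply/allP => f; rewrite mem_filter => /andP[/= fi /(allP ae) /= /andP[h1 ->]]; rewrite andbT; slia.
exists (g :: M); last by rewrite /= pM.
apply/allpairsP; exists (g, M); split=> //=; rewrite mem_U.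
have gg x : x \in g -> (i < x)%N /\ x \in S.
  by move=> /mapP[[a b]]; rewrite mem_filter => /andP[/= /eqP -> /(allP ae) /= /andP[/andP[_ ?] ?] ->].
rewrite (kch_grp_uniq kg) => [|x /gg[]//].
by apply/allP => x /gg[].
Qed.

Lemma mem_pair_lists S k e (v : Sinf) : sorted le1 e ->
  all (fun f => (f.1 < k) && (f.1 < f.2) && (f.2 \in S))%N e -> kch v e -> e \in pair_lists S k.
Proof.
move=> se ae ke; have [|M MM <-] := @pairs_ex S k 0 e v se _ ke; last exact: map_f.
by apply/allP => f /(allP ae).
Qed.

Lemma pair_listsP S k e : e \in pair_lists S k -> sorted le1 e /\ all (fun f => (f.1 < k)%N && (f.2 \in S)) e.
Proof.
move=> /mapP[M MM ->]; split; first exact: pairs_sorted.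
have [sM MS] := mem_Ms MM.
by apply/allP => -[a b] /mem_pairs[aI /MS ->]; rewrite sM in aI; rewrite andbT.
Qed.

Section CoefSum.
Variables (P : comNzRingType) (X : nat -> P) (G : Sinf -> P).
Hypothesis trG : forall n j w, (sbound w <= n)%N -> (j < n)%N -> Aop n.+1 j G w = (1 - X j) * G w.

Notation t := ('X : {poly P}).
Let Gc w : {poly P} := (G w)%:P.

(** The generating function of the non-empty chains satisfying all four
    conditions. *)
Definition pieri_poly N k v : {poly P} :=
  \sum_(e <- pair_lists (iota k (N - k)) k | e != [::]) run_wt t [::] e * opw e Gc v.

Lemma pieri_polyE N k v : t * (Hop t N k Gc v - Gc v) = (t - 1) * pieri_poly N k v.
Proof.
set S := iota k (N - k); have uS : uniq S := iota_uniq _ _.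
have -> : Hop t N k Gc v = \sum_(e <- pair_lists S k) flat_wt t [::] e * opw e Gc v.
  rewrite big_map /Hop /Gm [LHS]big_seq [RHS]big_seq; apply: eq_bigr => M MM.
  by rewrite (mwt_flat_wt _ _ 0 (Ms_uniq_groups MM)).
rewrite (bigD1_seq [::]) ?pair_lists_uniq //=; last exact: (mem_pair_lists (v := v)).
rewrite mul1r addrAC subrr add0r /pieri_poly -/S !mulr_sumr.
rewrite [LHS]big_seq_cond [RHS]big_seq_cond; apply: eq_bigr => -[/andP[_ //]|f e /andP[eL _]].
rewrite (opwE (f :: e)); case: ifP => kc; last by rewrite !mulr0.
have [se _] := pair_listsP eL; rewrite [LHS]mulrA [RHS]mulrA; congr (_ * _); apply: flat_run_wt => //.
exact: kch_le1_neq kc se.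
Qed.

(** [pieri_polyE] read coefficient by coefficient expresses the difference of two
    consecutive coefficients, and the constant coefficient vanishes. *)
Lemma pieri_poly_coef N k p v : (0 < p)%N ->
  (pieri_poly N k v)`_p = G v - \sum_(j < p) Hop_coef G N k j v.
Proof.
case: p => // p _.
have E j : (t * (Hop t N k Gc v - Gc v))`_j = ((t - 1) * pieri_poly N k v)`_j by rewrite pieri_polyE.
have E0 : (pieri_poly N k v)`_0 = 0.
  by have := E 0; rewrite mulrBl mul1r coefB !coefXM /= sub0r => /esym/eqP; rewrite oppr_eq0 => /eqP.
have ES j : (pieri_poly N k v)`_j.+1 = (pieri_poly N k v)`_j - (Hop_coef G N k j v - (if j == 0%N then G v else 0)).
  have := E j.+1; rewrite mulrBl mul1r !coefB !coefXM /= coefB coefC -/(Hop_coef G N k j v) => ->; ring.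
elim: p => [|p IH]; first by rewrite ES E0 big_ord_recl big_ord0 /=; ring.
by rewrite ES IH [in RHS]big_ord_recr /=; ring.
Qed.

Lemma pieri_poly_qrow N k p v : (0 < p)%N -> (maxn (sbound v) k + p + k.+1 < N)%N ->
  (pieri_poly N k v)`_p = qrow X k p * G v.
Proof. by move=> p0 hN; rewrite pieri_poly_coef // (Hop_coef_sum trG). Qed.

Lemma pieri_poly_marks N k p v : (pieri_poly N k v)`_p =
  \sum_(e <- pair_lists (iota k (N - k)) k | e != [::])
   \sum_(s <- markings (size e) | [&& kch v e, marks_ok [::] e s, run_marked e s & count id s == p])
     (-1) ^+ (size s - p) * G (kend v e).
Proof.
rewrite coef_sum; apply: eq_bigr => e _; rewrite run_wtE mulr_suml coef_sum [RHS]big_mkcond.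
apply: eq_bigr => s _; rewrite opwE; case: kch => /=; last by rewrite mulr0 coef0.
rewrite /mark_wt; case: (marks_ok _ _ _ && _) / idP => [/andP[-> ->]|h]; last first.
  by rewrite !mul0r coef0; move: h; case: marks_ok; case: run_marked => //= h; case: (h isT).
rewrite mul1r /= -mulrA coefXnM -(rmorph_sign (@polyC P)) -polyCM coefC subn_eq0.
have sE : size s = (count id s + count negb s)%N by rewrite -(count_predC id).
case: ltngtP => h //.
by rewrite sE h addKn.
Qed.

End CoefSum.

Local Notation d0 := (0%N, 0%N, false).

Lemma is_kchainE k (v : Sinf) (g : seq mcover) : is_kchain k v g =
  all (fun f => f.1 < k <= f.2)%N (unzip1 g) && kch v (unzip1 g).
Proof.
elim: g v => //= x g IH v; rewrite IH /cov /left_pos /right_pos.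
case: (boolP (_ < k <= _)%N) => //= xk.
have -> : (x.1.1 < x.1.2)%N by move: xk; slia.
by rewrite andbCA.
Qed.

Lemma endpointE (v : Sinf) (g : seq mcover) : endpoint v g = kend v (unzip1 g).
Proof. by elim: g v => //= x g IH v; rewrite -IH. Qed.

Lemma kchain_len k (v : Sinf) (g : seq mcover) : is_kchain k v g -> len (endpoint v g) = (len v + size g)%N.
Proof.
elim: g v => [|x g IH] v /=; first by rewrite addn0.
by move=> /and3P[_ /eqP l /IH ->]; rewrite l addSnnS.
Qed.

Lemma chain_P1E (g : seq mcover) : chain_P1 g <-> sorted le1 (unzip1 g).
Proof.
rewrite /unzip1 sorted_map; split=> [h|/(sortedP d0) h]; last exact: h.
by apply/(sortedP d0) => i ig; apply: h.
Qed.

(** The conditions [chain_P2], [chain_P3] and [chain_P4] once more, with their local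
    abbreviations expanded. *)
Definition fresh_marks (g : seq mcover) := forall i j, (j < i < size g)%N ->
  marked (nth d0 g i) -> right_pos (nth d0 g j) <> right_pos (nth d0 g i).

Definition unmarked_desc (g : seq mcover) := forall i, (i.+1 < size g)%N ->
  ~~ marked (nth d0 g i) -> cover_lt (nth d0 g i) (nth d0 g i.+1).

Definition marked_runs (g : seq mcover) := forall r, (0 < r <= size g)%N ->
  (forall i, (i < r)%N -> left_pos (nth d0 g i) = left_pos (nth d0 g 0)) ->
  (forall i, (i.+1 < r)%N -> (right_pos (nth d0 g i) < right_pos (nth d0 g i.+1))%N) ->
  marked (nth d0 g r.-1).

(** The part of [chain_P2] that concerns the covers before [g]. *)
Definition unused (B : seq nat) (g : seq mcover) :=
  forall i, (i < size g)%N -> marked (nth d0 g i) -> right_pos (nth d0 g i) \notin B.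

Lemma marks_okP B (g : seq mcover) : marks_ok B (unzip1 g) (unzip2 g) <->
  [/\ unused B g, fresh_marks g & unmarked_desc g].
Proof.
elim: g B => [|x g IH] B; first by split=> // _; split=> // i j; rewrite ltn0 andbF.

rewrite [marks_ok _ _ _]/=; split.
  move=> /andP[ox /IH [h1 h2 h3]]; split.
  - move=> [|i] /= ig mi; first by move: ox; rewrite /right_pos -/(marked x) mi.
    by have := h1 i ig mi; rewrite inE negb_or => /andP[].
  - move=> [|i] [|j] //= ji mi; last exact: h2.
    by have := h1 i ji mi; rewrite inE negb_or => /andP[/eqP + _] => /nesym.
  move=> [|i] /= ig; last exact: h3.
  by case: g ox ig {IH h1 h2 h3} => //= y g + _ /negPf mx; rewrite -/(marked x) mx.
move=> [h1 h2 h3]; apply/andP; split.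
  case: ifP => mx; first exact: (h1 0%N).
  by case: g h3 {IH h1 h2} => // y g h3; apply: (h3 0%N); rewrite //= /marked mx.
apply/IH; split.
- move=> i ig mi; rewrite inE negb_or (h1 i.+1) // andbT.
  by apply/eqP => e; apply: (h2 i.+1 0%N ig mi).
- by move=> i j ji mi; apply: (h2 i.+1 j.+1).
- by move=> i ig; apply: (h3 i.+1).
Qed.

Lemma marked_runsE (g : seq mcover) : sorted le1_neq (unzip1 g) ->
  (marked_runs g <-> run_marked (unzip1 g) (unzip2 g)).
Proof.
elim: g => [|x g IH] mark_wt; first by split=> // _ [].
have {}IH := IH (path_sorted mark_wt).
case: g IH mark_wt => [|y g] IH mark_wt.
  split=> [h|/andP[mx _] [|[|r]] // _ _ _].
  by rewrite /= andbT; apply: (h 1%N) => // -[].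
have lxy : le1_neq x.1 y.1 by case/andP: mark_wt.
have nxtE : descends x.1 (unzip1 (y :: g)) = ~~ ((left_pos y == left_pos x) && (right_pos x < right_pos y)%N).
  move: lxy; rewrite /le1_neq /left_pos /right_pos /= [y.1.1 == _]eq_sym; slia.
rewrite -[run_marked (unzip1 (x :: y :: g)) _]/(marked x &&
  (descends x.1 (unzip1 (y :: g)) || run_marked (unzip1 (y :: g)) (unzip2 (y :: g)))).
rewrite nxtE; split.
  move=> h; apply/andP; split; first by apply: (h 1%N) => // -[].
  case: (boolP (_ && _)) => //= /andP[/eqP axy bxy]; apply/IH => -[//|r] rg ha hb.
  apply: (h r.+2); first by [].
    by move=> [|i] //= ir; rewrite -axy; apply: ha.
  by move=> [|i] //= ir; apply: hb.
move=> /andP[mx h] [|[|r]] // rg ha hb.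
have ayx := ha 1%N isT; have bxy := hb 0%N isT.
move: h; rewrite /= in ayx bxy; rewrite ayx eqxx bxy /= => /IH h.
apply: (h r.+1) => [//|i ir|i ir]; last exact: (hb i.+1).
by rewrite [RHS]ayx; apply: (ha i.+1).
Qed.

Definition pieri_pair (v : Sinf) k p (e : seq (nat * nat)) (s : seq bool) : bool :=
  [&& all (fun f => f.1 < k <= f.2)%N e, sorted le1 e, kch v e, marks_ok [::] e s, run_marked e s & count id s == p].

Lemma pieri_pairP (v : Sinf) k p (g : seq mcover) :
  pieri_chain v k p g <-> pieri_pair v k p (unzip1 g) (unzip2 g).
Proof.
rewrite /pieri_chain /pieri_pair is_kchainE.
have cE : count marked g = count id (unzip2 g) by rewrite count_map.
split.
  move=> [/andP[ak ke] /eqP cp [/chain_P1E s1 h2 h3 h4]].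
  rewrite ak ke s1 -cE cp andbT /=; apply/andP; split; first by apply/marks_okP.
  by apply/(marked_runsE (kch_le1_neq ke s1)).
move=> /and5P[-> s1 ke o /andP[r c]]; rewrite ke cE; split=> //; first exact/eqP.
have [_ h2 h3] := (marks_okP _ _).1 o; split=> //; first exact/chain_P1E.
by apply/(marked_runsE (kch_le1_neq ke s1)).
Qed.

Lemma asc_le_marks B e s : marks_ok B e s -> (asc e <= count id s)%N.
Proof.
elim: e B s => [|f e IH] B [|m s] //= /andP[fm /IH le].
by case: m fm => [_|->] /=; slia.
Qed.

Lemma sign_scale n (x : poly_inf) : ((-1) ^+ n : int) *: x = (-1) ^+ n * x.
Proof.
by rewrite -signr_odd -[in RHS]signr_odd; case: odd; rewrite ?expr1 ?expr0 ?scaleN1r ?scale1r ?mulN1r ?mul1r.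
Qed.

(** The finite set consists of the admissible markings of the lists in
    [pair_lists], for [N] beyond the reach of the chains with [p] marks. *)
Lemma pieri_sum (v : Sinf) k p : (0 < k)%N -> (0 < p)%N ->
  exists2 S : {fset (seq mcover)}, (forall g, g \in S <-> pieri_chain v k p g) &
    \sum_(g <- S) pieri_sign p g *: groth (endpoint v g) = qrow Xv k p * groth v.
Proof.
move=> k0 p0; pose N := (maxn (sbound v) k + p + k.+2)%N.
pose L := [seq zip e s | e <- pair_lists (iota k (N - k)) k, s <- markings (size e)].
have uL : uniq L.
  apply: allpairs_uniq_dep; [by apply/pair_lists_uniq/iota_uniq|by move=> e _; apply: markings_uniq|].
  move=> [e s] [e' s'].
  case/allpairsPdep => x [y [_ ys [e1 e2]]]; case/allpairsPdep => x' [y' [_ ys' [e1' e2']]].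
  subst x y x' y'; move: ys ys'; rewrite !mem_markings => /= /eqP sE /eqP sE' E.
  have E1 : e = e' by rewrite -(unzip1_zip (s := e) (t := s)) ?E ?unzip1_zip ?sE ?sE'.
  have E2 : s = s' by rewrite -(unzip2_zip (s := e) (t := s)) ?E ?unzip2_zip ?sE ?sE'.
  by subst.
pose Q g := pieri_pair v k p (unzip1 g) (unzip2 g).
pose Lq := [seq g <- L | Q g].
have memL g : (g \in [fset g in Lq]) = (g \in Lq) by rewrite !inE.
(* the enumeration [Lq] is free of repetitions, so sums over the set are sums over it *)
exists [fset g in Lq].
  move=> g; rewrite memL mem_filter; split=> [/andP[q _]|/pieri_pairP q].
    exact/pieri_pairP.
  rewrite /Q q -[g]zip_unzip; move: q => /and5P[ak se ke o /andP[_ /eqP c]].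
  have sz : size (unzip1 g) = size (unzip2 g) by rewrite !size_map.
  apply/allpairsPdep.
  exists (unzip1 g), (unzip2 g); split=> //; last by rewrite mem_markings sz.
  apply: (mem_pair_lists (v := v)) => //.
  have [|||_ bb] := @bound_flat (unzip1 g) v (maxn (sbound v) k) k 0 _ _ se _ ke;
    [exact: leq_maxl|exact: leq_maxr| |].
    by apply/allP => f /(allP ak).
  have := asc_le_marks o; rewrite c => pa.
  apply/allP => f fe; have /= h1 := allP bb f fe; have /= h2 := allP ak f fe.
  by rewrite mem_iota /N; slia.
transitivity (pieri_poly groth N k v)`_p; last first.
  rewrite (pieri_poly_qrow (X := Xv)) //; first exact: groth_transition.
  by rewrite /N; slia.
rewrite pieri_poly_marks (perm_big Lq); last first.
  by apply: uniq_perm => [|//|//]; [apply: fset_uniq|rewrite filter_uniq].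
rewrite big_filter big_mkcond big_allpairs_dep [RHS]big_mkcond.
rewrite [LHS]big_seq [RHS]big_seq; apply: eq_bigr => e eL.
have [se ae] := pair_listsP eL.
case: (e =P [::]) => [->|_] /=.
  by rewrite big_seq1 /Q /pieri_pair /= eq_sym (gtn_eqF p0).
rewrite [LHS]big_seq [RHS]big_seq_cond [RHS]big_mkcondr; apply: eq_bigr => s.
rewrite mem_markings => /eqP sE.
rewrite /Q /pieri_pair unzip1_zip ?unzip2_zip ?sE // se.
have -> : all (fun f => f.1 < k <= f.2)%N e.
  by apply/allP => f /(allP ae) /andP[]; rewrite mem_iota /=; slia.
rewrite /=; case: ifP => // _.
by rewrite sign_scale /pieri_sign size_zip sE minnn endpointE unzip1_zip ?sE.
Qed.

(** * The one-row polynomial *)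

(** From the identity, the first cover must be (k - 1, k), with positions counted
    from 0; by [chain_P1] all covers then have the left position [k - 1], and each of
    them must have the right position next to the previous one. The permutations
    passed are the cycles r_[k,j]. *)
Section Row.
Variable k : nat.
Hypothesis k0 : (0 < k)%N.

Lemma rcycL j : rcyc k j k.-1 = (k.-1 + j)%N.
Proof. by rewrite mkSE /rcyc_fun eqxx. Qed.

Lemma rcycM j i : (k <= i < k + j)%N -> rcyc k j i = i.-1.
Proof.
move=> iI; rewrite mkSE /rcyc_fun; case: eqP => [|_]; first by slia.
by case: ifP => //; slia.
Qed.

Lemma rcycR j i : (k + j <= i)%N -> rcyc k j i = i.
Proof.
move=> iI; rewrite mkSE /rcyc_fun; case: eqP => [|_]; first by slia.
by case: ifP => //; slia.
Qed.

Lemma rcycD j i : (i < k.-1)%N -> rcyc k j i = i.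
Proof.
move=> iI; rewrite mkSE /rcyc_fun; case: eqP => [|_]; first by slia.
by case: ifP => //; slia.
Qed.

Lemma rcycS j : swap (rcyc k j) k.-1 (k + j) = rcyc k j.+1.
Proof.
apply/SinfP => i; case: (i =P k.-1) => [->|i1]; first by rewrite swapL rcycL rcycR //; slia.
case: (i =P (k + j)%N) => [->|i2]; first by rewrite swapR rcycL rcycM; slia.
rewrite swapD //; have [h|[h|h]] : (i < k.-1)%N \/ (k <= i < k + j)%N \/ (k + j < i)%N by slia.
- by rewrite !rcycD.
- by rewrite !rcycM; slia.
- by rewrite !rcycR; slia.
Qed.

Lemma cov_rcyc j b : (k <= b)%N -> cov (rcyc k j) k.-1 b = (b == k + j)%N.
Proof.
move=> kb; apply/idP/eqP => [/covP[_]|->].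
  rewrite rcycL => lt H; have [h|[//|h]] : (b < k + j)%N \/ b = (k + j)%N \/ (k + j < b)%N by slia.
    by move: lt; rewrite rcycM ?kb //; slia.
  by have := H (k + j)%N; rewrite !rcycR //; slia.
apply/covP; rewrite rcycL (@rcycR j (k + j)) //; split; [slia|slia|] => c cI.
by rewrite rcycM; slia.
Qed.

Definition row_covers j n : seq (nat * nat) := [seq (k.-1, i) | i <- iota (k + j) n].

Lemma kch_row_covers j n : kch (rcyc k j) (row_covers j n) /\ kend (rcyc k j) (row_covers j n) = rcyc k (j + n).
Proof.
elim: n j => [|n IH] j; first by rewrite addn0.
by rewrite /row_covers /= cov_rcyc ?leq_addr // eqxx rcycS -addnS -[(j + n.+1)%N]addSnnS; apply: IH.
Qed.

Lemma row_covers_uniq j e : all (fun f => (f.1 == k.-1) && (k <= f.2))%N e -> kch (rcyc k j) e ->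
  e = row_covers j (size e).
Proof.
elim: e j => // -[a b] e IH j /= /andP[/andP[/eqP -> kb] ae] /andP[].
rewrite cov_rcyc // => /eqP ->; rewrite rcycS => /IH -> //.
by rewrite /row_covers /= size_map size_iota addnS.
Qed.

Lemma descends_row j n : descends (k.-1, (k + j)%N) (row_covers j.+1 n) = (n == 0%N).
Proof. by case: n => //= n; rewrite ltnn eqxx /= addnS ltnNge leqnSn. Qed.

Lemma run_marked_row j n s : size s = n -> run_marked (row_covers j n) s -> s = nseq n true.
Proof.
elim: n j s => [|n IH] j [|m s] //= [sn].
rewrite -addnS -/(row_covers j.+1 n) descends_row => /andP[->].
by case: n IH sn => [|n] IH sn /=; [case: s sn|move=> /(IH _ _ sn) ->].
Qed.

Lemma marks_ok_row j n B : all (fun b => b < k + j)%N B ->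
  marks_ok B (row_covers j n) (nseq n true) && run_marked (row_covers j n) (nseq n true).
Proof.
elim: n j B => // n IH j B Bj /=.
have /andP[h1 h2] : marks_ok ((k + j)%N :: B) (row_covers j.+1 n) (nseq n true) && run_marked (row_covers j.+1 n) (nseq n true).
  by apply: IH; rewrite /= addnS ltnSn; apply: sub_all Bj => b /= ; slia.
rewrite -addnS -/(row_covers j.+1 n) h1 h2 orbT !andbT.
by apply/negP => /(allP Bj); rewrite ltnn.
Qed.

Lemma w0_0_rcyc : w0 0 = rcyc k 0.
Proof.
apply/SinfP => i; rewrite !mkSE /rev_fun /rcyc_fun addn0 ltn0.
by case: (i =P k.-1) => // _; case: ifP; slia.
Qed.

Lemma pieri_row p g : (0 < p)%N ->
  pieri_chain (w0 0) k p g <-> g = zip (row_covers 0 p) (nseq p true).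
Proof.
have sp : size (row_covers 0 p) = p by rewrite size_map size_iota.
have sq : size (nseq p true) = p by rewrite size_nseq.
move=> p0; split.
  move/pieri_pairP => /and5P[ak se]; rewrite w0_0_rcyc => ke _ /andP[r /eqP c].
  have sz : size (unzip1 g) = size (unzip2 g) by rewrite !size_map.
  have ae : all (fun f => (f.1 == k.-1) && (k <= f.2))%N (unzip1 g).
    case: (unzip1 g) ak se ke => [//|[a b] e] /= /andP[/= ab ae] pe /andP[/covP[_ ]].
    rewrite (@rcycR 0 b); last by slia.
    have [ea|lt] : a = k.-1 \/ (a < k.-1)%N by slia.
      move=> _ _ _; rewrite ea eqxx; apply/andP; split; first by slia.
      apply/allP => f fe; have := allP ae f fe.
      by have := allP (order_path_min le1_trans pe) f fe; rewrite /le1 /=; slia.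
    rewrite rcycD // => _ H; have := H k.-1; rewrite rcycL; slia.
  have Ee := row_covers_uniq ae ke.
  have Es : unzip2 g = nseq (size (unzip1 g)) true by apply: (run_marked_row (j := 0) (esym sz)); rewrite -Ee.
  have szp : size (unzip1 g) = p by move: c; rewrite Es count_nseq /= mul1n.
  by rewrite -[LHS]zip_unzip Es szp Ee szp.
move=> ->; apply/pieri_pairP; rewrite unzip1_zip ?unzip2_zip ?sp ?sq // /pieri_pair w0_0_rcyc.
have [-> _] := kch_row_covers 0 p.
have /andP[-> ->] := @marks_ok_row 0 p [::] isT.
rewrite count_nseq mul1n eqxx !andbT; apply/andP; split.
  by apply/allP => f /mapP[x]; rewrite mem_iota => xI -> /=; slia.
by have := pairs_sorted k.-1 [:: iota (k + 0) p]; rewrite /= cats0.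
Qed.

Lemma qrow_groth p : (0 < p)%N -> qrow Xv k p = groth_row p k.
Proof.
move=> p0; have [S SP] := pieri_sum (w0 0) k0 p0.
have -> : groth (w0 0) = 1 by rewrite groth_w0 /mon big_ord0.
rewrite mulr1 => <-; set g := zip (row_covers 0 p) (nseq p true).
have -> : S = [fset g].
  apply/fsetP => x; rewrite in_fset1; apply/idP/eqP => [/SP /(pieri_row _ p0)//|->].
  by apply/SP/(pieri_row _ p0).
have sp : size (row_covers 0 p) = p by rewrite size_map size_iota.
rewrite big_seq_fset1 /pieri_sign size_zip sp size_nseq minnn subnn scale1r /groth_row.
rewrite endpointE unzip1_zip ?sp ?size_nseq // w0_0_rcyc.
by have [_ ->] := kch_row_covers 0 p.
Qed.

End Row.

Theorem theorem2 (v : Sinf) (k p : nat) (hk : (1 <= k)%N) (hp : (1 <= p)%N) :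
  (exists S : {fset (seq mcover)},
     (forall g : seq mcover, g \in S <-> pieri_chain v k p g) /\
     groth v * groth_row p k =
       \sum_(g <- S) pieri_sign p g *: groth (endpoint v g)) /\
  (forall g g' : seq mcover,
     pieri_chain v k p g -> pieri_chain v k p g' ->
     endpoint v g = endpoint v g' -> pieri_sign p g = pieri_sign p g').
Proof.
split.
  have [S SP SE] := pieri_sum v hk hp; exists S; split; first exact: SP.
  rewrite (qrow_groth hk hp) in SE.
  apply: etrans (esym SE).
  apply: mulrC.
move=> g g' [kg _ _] [kg' _ _] E.
have := kchain_len kg; rewrite E (kchain_len kg') => /addnI e.
by rewrite /pieri_sign e.
Qed.
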